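(* Let $n\ge1$ and $E=\mathbb{C}/\Lambda$. The identity map of $X_n$ extends to an isomorphism of algebraic curves $\phi:\bar X_n\to\hat X_n$ from the closure $\bar X_n$ of $X_n$ in $\mathrm{Sym}^nE$ to the projective hyperelliptic model $\hat X_n$ of $X_n$.
   Context: $\Lambda\subset\mathbb{C}$ is a lattice; $E$ is identified with $y^2=4x^3-g_2x-g_3$ via $(\wp,\wp')$, $g_i=g_i(\Lambda)$; $\mathrm{Sym}^nE=E^n/S_n$. $X_n\subset\mathrm{Sym}^nE$ is the set of unordered $n$-tuples $\{(x_i,y_i)\}_{i=1}^n$ of points of $E\smallsetminus E[2]$ with $x_i\ne x_j$ for $i\ne j$ and $\sum_{i=1}^nx_i^ry_i=0$ for $r=0,\dots,n-2$. Let $s_0=1$, $s_k=0$ for $k<0$, and define $s_1,\dots,s_n\in\mathbb{Q}[g_2,g_3][B]$ by: for $\mu=n-1,\dots,0$, $0=2(n-\mu)(2\mu+1)(n+\mu+1)s_{n-\mu}-4(\mu+1)Bs_{n-\mu-1}+\frac12g_2(\mu+1)(\mu+2)(2\mu+3)s_{n-\mu-2}-g_3(\mu+1)(\mu+2)(\mu+3)s_{n-\mu-3}$. Put $\ell_n(B)=4Bs_n^2+4g_3s_{n-2}s_n-g_2s_{n-1}s_n-g_3s_{n-1}^2$, of degree $2n+1$ in $B$. $\hat X_n$ is the projective curve obtained by gluing the affine curves $C^2=\ell_n(B)$ and $v^2=u\cdot(u^{2n+1}\ell_n(1/u))$ (near $u=0$) along $B=1/u$, $C=v/u^{n+1}$.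 The curve $X_n$ is identified with the open subset of $\hat X_n$ which is the locus $\ell_n(B)\ne0$ of $C^2=\ell_n(B)$, via $B=(2n-1)\sum_{i=1}^nx_i$ and $C=y_i\prod_{j\ne i}(x_i-x_j)$ (independent of $i$). *)

(* Defs.v *)
From mathcomp Require Import all_boot all_order all_algebra all_fingroup.
From mathcomp Require Import generic_quotient complex.
From mathcomp Require Import all_classical all_reals all_analysis.
From mathcomp Require Import ring.

Set Implicit Arguments.
Unset Strict Implicit.
Unset Printing Implicit Defensive.

Import Order.TTheory GRing.Theory Num.Theory.
Import numFieldNormedType.Exports.

Local Open Scope classical_set_scope.
Local Open Scope quotient_scope.
Local Open Scope ring_scope.

(* Reduced varieties over an algebraically closed field K, in the classical
   language of spaces with functions: a set of points, its Zariski-open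
   subsets, and for each open U the K-valued regular functions on U.  Regular
   functions on U are represented by total functions whose values outside U
   are irrelevant. *)
Record kspace (K : Type) := KSpace {
  kpt :> choiceType;
  kopen : set (set kpt);
  kreg : set kpt -> set (kpt -> K) }.

Section Spaces.
Variable K : fieldType.

Definition kmorphism (X Y : kspace K) (phi : X -> Y) : Prop :=
  (forall V, kopen V -> kopen (phi @^-1` V)) /\
  (forall V f, kopen V -> kreg V f -> kreg (phi @^-1` V) (f \o phi)).

Definition kisomorphism (X Y : kspace K) (phi : X -> Y) : Prop :=
  kmorphism phi /\
  exists psi : Y -> X, [/\ cancel phi psi, cancel psi phi & kmorphism psi].

(* For the locally closed X_n in Sym^n E this is also the closure in the complex
   topology. *)
Definition kclosure (X : kspace K) (A : set X) : set X :=
  [set p | forall U : set X, kopen U -> U p -> (U `&` A) !=set0].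

Inductive polyfun (T J : Type) (x : J -> T -> K) : (T -> K) -> Prop :=
| polyfun_cst c : polyfun x (fun=> c)
| polyfun_var j : polyfun x (x j)
| polyfun_add F G : polyfun x F -> polyfun x G -> polyfun x (fun p => F p + G p)
| polyfun_mul F G : polyfun x F -> polyfun x G -> polyfun x (fun p => F p * G p).

(* The space covered by affine charts dom i with coordinates x i j.  The values
   of x i j outside dom i play no role. *)
Section Charts.
Variables (T : choiceType) (I J : Type).
Variables (dom : I -> set T) (x : I -> J -> T -> K).

Definition charted_open : set (set T) :=
  [set U | forall p, U p -> exists i G,
     [/\ dom i p, polyfun (x i) G, G p != 0 &
         forall q, dom i q -> G q != 0 -> U q]].

Definition charted_reg (U : set T) : set (T -> K) :=
  [set f | charted_open U /\ forall p, U p -> exists i F G,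
     [/\ dom i p, polyfun (x i) F, polyfun (x i) G, G p != 0 &
         forall q, dom i q -> U q -> G q != 0 -> f q = F q / G q]].

Definition charted : kspace K := KSpace charted_open charted_reg.
End Charts.

Definition subspace_open (X : kspace K) (A : set X) : set (set A) :=
  [set U | exists2 V : set X, kopen V & U = [set p | V (val p)]].

Definition subspace_reg (X : kspace K) (A : set X) (U : set A) : set (A -> K) :=
  [set f | subspace_open U /\ forall p, U p -> exists (V : set X) (g : X -> K),
     [/\ kopen V, V (val p), kreg V g &
         forall q, U q -> V (val q) -> f q = g (val q)]].

Definition subspace (X : kspace K) (A : set X) : kspace K :=
  KSpace (@subspace_open X A) (@subspace_reg X A).

Definition disjoint_union (X Y : kspace K) : kspace K :=
  @KSpace K (X + Y)%type
    [set U | kopen (inl @^-1` U) /\ kopen (inr @^-1` U)]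
    (fun U => [set f : (X + Y)%type -> K | kreg (inl @^-1` U) (f \o inl) /\
                       kreg (inr @^-1` U) (f \o inr)]).

Definition quotient_space (X : kspace K) (Q : choiceType) (pr : X -> Q) :
    kspace K :=
  @KSpace K Q
    [set U | kopen (pr @^-1` U)]
    (fun U => [set f : Q -> K | kreg (pr @^-1` U) (f \o pr)]).

Definition affine_plane : kspace K :=
  @charted (K * K)%type unit bool (fun=> setT)
    (fun=> fun second p => if second then p.2 else p.1).

End Spaces.

Section SymmetricPower.
Variables (n : nat) (T : choiceType).

Definition perm_rel : rel {ffun 'I_n -> T} :=
  fun p q => [exists s : 'S_n, q == [ffun i => p (s i)]].

Lemma perm_rel_refl : reflexive perm_rel.
Proof.
move=> p; apply/existsP; exists 1%g; apply/eqP/ffunP => i.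
by rewrite ffunE perm1.
Qed.

Lemma perm_rel_sym : symmetric perm_rel.
Proof.
suff H p q : perm_rel p q -> perm_rel q p by move=> p q; apply/idP/idP; exact: H.
case/existsP=> s /eqP ->; apply/existsP; exists (s^-1)%g.
by apply/eqP/ffunP => i; rewrite !ffunE permKV.
Qed.

Lemma perm_rel_trans : transitive perm_rel.
Proof.
move=> q p r /existsP[s /eqP ->] /existsP[t /eqP ->].
by apply/existsP; exists (t * s)%g; apply/eqP/ffunP => i; rewrite !ffunE permM.
Qed.

Canonical perm_equiv :=
  EquivRel perm_rel perm_rel_refl perm_rel_sym perm_rel_trans.

Definition sympow := {eq_quot perm_equiv}.

End SymmetricPower.

Section Curves.
Variables (K : numClosedFieldType) (g2 g3 : K).

(* E = C/Lambda is taken as the plane cubic onto which (wp, wp') maps it, with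
   g2, g3 the invariants of Lambda; None is the point at infinity [0 : 1 : 0],
   the image of 0. *)
Definition weierstrass : set (option (K * K)) :=
  [set p | if p is Some (x, y) then y ^+ 2 = 4 * x ^+ 3 - g2 * x - g3 else True].

Definition E : choiceType := set_type weierstrass.

Definition hcoord (p : option (K * K)) (k : 'I_3) : K :=
  if p is Some (x, y) then [tuple x; y; 1]`_k else [tuple 0; 1; 0]`_k.

(* p is in E[2] iff - p = p, and - (x, y) = (x, - y). *)
Definition two_torsion (p : E) : Prop :=
  (if val p is Some (x, y) then Some (x, - y) else None) = val p.

Section FixN.
Variable n : nat.

(* E^n as a subvariety of (P^2)^n, covered by the products of the standard
   charts [X_(sigma i) != 0] of the n factors. *)
Definition En : kspace K :=
  @charted K {ffun 'I_n -> E} ('I_n -> 'I_3) ('I_n * 'I_3)%type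
    (fun sigma => [set P | forall i, hcoord (val (P i)) (sigma i) != 0])
    (fun sigma ik P =>
       hcoord (val (P ik.1)) ik.2 / hcoord (val (P ik.1)) (sigma ik.1)).

(* U is open in E^n / S_n iff its preimage is open, and its regular functions
   are the S_n-invariant regular functions on that preimage. *)
Definition SymE : kspace K :=
  @quotient_space K En (sympow n E) (\pi_(sympow n E)).

Definition tupleX (P : {ffun 'I_n -> E}) (x y : 'I_n -> K) : Prop :=
  [/\ forall i, val (P i) = Some (x i, y i),
      forall i, ~ two_torsion (P i),
      forall i j, i != j -> x i != x j &
      forall r, (r + 2 <= n)%N -> \sum_i x i ^+ r * y i = 0].

Definition Xn : set SymE :=
  [set q | exists P x y, tupleX P x y /\ q = \pi_(sympow n E) P].

Definition barX : kspace K := subspace (kclosure Xn).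

(* s_k in terms of s_(k-1), s_(k-2), s_(k-3), where mu = n - k. *)
Definition lame_step (k : nat) (a b c : {poly K}) : {poly K} :=
  let mu : K := (n - k)%:R in
  (2 * k%:R * (2 * mu + 1) * (n%:R + mu + 1))^-1 *:
    ((4 * (mu + 1)) *: ('X * a)
     - (2^-1 * g2 * (mu + 1) * (mu + 2) * (2 * mu + 3)) *: b
     + (g3 * (mu + 1) * (mu + 2) * (mu + 3)) *: c).

(* The triple (s_k, s_(k-1), s_(k-2)). *)
Fixpoint lame_triple (k : nat) : {poly K} * {poly K} * {poly K} :=
  if k is k'.+1 then
    let: (a, b, c) := lame_triple k' in (lame_step k a b c, a, b)
  else (1, 0, 0).

Definition s_ (k : int) : {poly K} :=
  if k is Posz k then (lame_triple k).1.1 else 0.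

Lemma s_rec (mu : nat) : (mu < n)%N ->
  let m : K := mu%:R in let N : K := n%:R in let k : int := n%:Z - mu%:Z in
  0 = (2 * (N - m) * (2 * m + 1) * (N + m + 1)) *: s_ k
      - (4 * (m + 1)) *: ('X * s_ (k - 1))
      + (2^-1 * g2 * (m + 1) * (m + 2) * (2 * m + 3)) *: s_ (k - 2)
      - (g3 * (m + 1) * (m + 2) * (m + 3)) *: s_ (k - 3).
Proof.
move=> mun m N k.
have -> : k = (n - mu)%N :> int by rewrite /k subzn // ltnW.
have : (n - (n - mu) = mu)%N by rewrite subKn // ltnW.
have : (n - mu)%:R = N - m by rewrite natrB // ltnW.
have : (0 < n - mu)%N by rewrite subn_gt0.
clear k; case: (n - mu)%N => // j _ Ej nj.
have -> : s_ (j.+1%:Z - 1) = (lame_triple j).1.1.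
  by rewrite subzn // subSS subn0.
have -> : s_ (j.+1%:Z - 2) = (lame_triple j).1.2.
  case: j {Ej nj} => [|j] //; rewrite subzn // !subSS subn0 /=.
  by case: (lame_triple j) => -[].
have -> : s_ (j.+1%:Z - 3) = (lame_triple j).2.
  case: j {Ej nj} => [|[|j]] //; rewrite subzn // !subSS subn0 /=.
  by case: (lame_triple j) => -[].
rewrite [s_ _]/=; case: (lame_triple j) => -[a b c] /=.
rewrite /lame_step nj Ej -/m -/N scalerA divff ?scale1r.
  rewrite addrAC -addrA -[X in _ = X + _]addrA.
  set u := _ *: ('X * a); set v := _ *: b; set w := _ *: c.
  by ring.
have gt0 : 0 < N - m by rewrite -Ej ltr0n.
have m0 : 0 <= m by rewrite ler0n.
have N0 : 0 <= N by rewrite ler0n.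
rewrite !mulf_neq0 // ?pnatr_eq0 ?gt_eqF //.
  by rewrite ltr_wpDl ?mulr_ge0.
by rewrite ltr_wpDl ?addr_ge0.
Qed.

Definition ell : {poly K} :=
  let s k := s_ (n%:Z - k) in
  4 *: ('X * s 0 ^+ 2) + (4 * g3) *: (s 2 * s 0) - g2 *: (s 1 * s 0)
  - g3 *: s 1 ^+ 2.

(* u^(2n+1) * ell (1/u) *)
Definition ell_rev : {poly K} :=
  \poly_(i < (2 * n).+2) ell`_((2 * n).+1 - i).

Definition curve_fin : set (affine_plane K) :=
  [set p : K * K | p.2 ^+ 2 = ell.[p.1]].

Definition curve_inf : set (affine_plane K) :=
  [set p : K * K | p.2 ^+ 2 = p.1 * ell_rev.[p.1]].

Definition two_charts : kspace K :=
  disjoint_union (subspace curve_fin) (subspace curve_inf).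

(* B = 1/u and C = v/u^(n+1), for p = (B, C) and q = (u, v). *)
Definition glued (p q : K * K) : bool :=
  [&& q.1 != 0, p.1 == q.1^-1 & p.2 == q.2 / q.1 ^+ n.+1].

Definition glue_rel : rel (curve_fin + curve_inf)%type := fun a b =>
  match a, b with
  | inl p, inl q => p == q
  | inr p, inr q => p == q
  | inl p, inr q => glued (val p) (val q)
  | inr p, inl q => glued (val q) (val p)
  end.

Lemma glued_injl p p' q : glued p q -> glued p' q -> p = p'.
Proof.
case: p p' => [a b] [a' b'].
by case/and3P=> _ /= /eqP-> /eqP-> /and3P[_ /= /eqP-> /eqP->].
Qed.

Lemma glued_injr p q q' : glued p q -> glued p q' -> q = q'.
Proof.
case: p q q' => [a b] [c d] [c' d'].
case/and3P=> /= c0 /eqP-> /eqP-> /and3P[/= c0' /eqP/invr_inj <- /eqP].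
by move/mulIf => -> //; rewrite invr_eq0 expf_neq0.
Qed.

Lemma glue_rel_refl : reflexive glue_rel.
Proof. by case=> p /=. Qed.

Lemma glue_rel_sym : symmetric glue_rel.
Proof. by case=> p [] q //=; rewrite eq_sym. Qed.

Lemma glue_rel_trans : transitive glue_rel.
Proof.
case=> q [] p [] r //=.
- by move=> /eqP->.
- by move=> /eqP->.
- by move=> pq /eqP<-.
- by move=> pq qr; apply/eqP/val_inj; exact: glued_injr pq qr.
- by move=> pq qr; apply/eqP/val_inj; exact: glued_injl pq qr.
- by move=> pq /eqP<-.
- by move=> /eqP->.
- by move=> /eqP->.
Qed.

Canonical glue_equiv :=
  EquivRel glue_rel glue_rel_refl glue_rel_sym glue_rel_trans.

Definition hatX_pt := {eq_quot glue_equiv}.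

Definition hatX : kspace K :=
  @quotient_space K two_charts hatX_pt (\pi_hatX_pt).

(* On X_n, phi is the identification of X_n with an open subset of hatX given
   by the coordinates (B, C). *)
Definition extends_identity (phi : barX -> hatX) : Prop :=
  forall (p : barX) (P : {ffun 'I_n -> E}) (x y : 'I_n -> K),
    tupleX P x y -> val p = \pi_(sympow n E) P ->
    exists BC : curve_fin,
      [/\ phi p = \pi_hatX_pt (inl BC),
          (val BC).1 = (2 * n - 1)%:R * \sum_i x i &
          forall i, (val BC).2 = y i * \prod_(j | j != i) (x i - x j)].

End FixN.
End Curves.

Section Lattices.
Variable R : realType.

Definition is_lattice (Lambda : set R[i]) : Prop :=
  exists w1 w2 : R[i],
    (forall a b : R, a%:C%C * w1 + b%:C%C * w2 = 0 -> a = 0 /\ b = 0) /\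
    Lambda = [set w | exists m k : int, w = m%:~R * w1 + k%:~R * w2].

(* Sum of w^-k over the nonzero w in Lambda, for k > 2, where the series
   converges absolutely.  The field C is used with R[i], on which this makes
   the topology of the norm available. *)
Definition eisenstein (C : numClosedFieldType) (Lambda : set C) (k : nat) : C :=
  lim ((fun N : nat =>
          \sum_(w \in [set w : C | [/\ Lambda w, w != 0 & `|w| <= N%:R]])
            w ^- k) @ \oo).

Definition lattice_g2 (Lambda : set R[i]) : R[i] := 60 * eisenstein Lambda 4.
Definition lattice_g3 (Lambda : set R[i]) : R[i] := 140 * eisenstein Lambda 6.

End Lattices.

(* Main.v *)
From mathcomp Require Import all_boot all_order all_algebra all_fingroup.
From mathcomp Require Import generic_quotient complex.
From mathcomp Require Import all_classical all_reals all_analysis.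
From mathcomp Require Import ring zify.
Require Import Defs.

Set Implicit Arguments.
Unset Strict Implicit.
Unset Printing Implicit Defensive.

Import Order.TTheory GRing.Theory Num.Theory.

Local Open Scope classical_set_scope.
Local Open Scope quotient_scope.
Local Open Scope ring_scope.

(* Write f_B = \sum_k (-1)^k s_k(B) X^(n-k), p = 4 X^3 - g2 X - g3.  The recursion
   for the s_k says that f_B solves the symmetric square of the Lame equation,
   whose first integral reads p f_B'^2 = ell(B) modulo f_B.  Hence a point (B, C)
   of C^2 = ell(B) determines the n points (x_i, y_i) of E where the x_i are the
   roots of f_B and C = y_i f_B'(x_i); when C = 0 the roots that are not roots
   of p are double and carry opposite values of y.  Symmetric functions of these
   points are polynomials in the power sums of the x_i and in the moments
   \sum x_i^r y_i, which are polynomials in B and C; conversely B and C are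
   themselves such sums.  This gives a closed embedding of the affine curve into
   Sym^n (E \ O).

   Near infinity, u = 1/B and v = C u^(n+1), the same argument with the
   coordinates t = X/Y and w = Z/Y at O shows that the curve extends by n O.
   There u is a rational function of the coefficients of \prod_i (1 - X / x_i),
   and v is a unit times \sum_i t_i, because the leading coefficient of
   \sum_i x_i f_B'(x_i) in B does not vanish.  A point of the closure with some
   but not all entries at O is excluded since B is integral over each x_i, and
   each x_j is integral over B. *)

(** * Interpolation and moments *)

(** Nothing guarantees that [ell] is squarefree, so [hatX] may be singular, and neither extension of
    maps from a smooth curve nor bijectivity of a birational morphism would give an isomorphism.
    Regularity has to be proved in both directions by explicit coordinates. The map that can be
    written down is [psi], from points of the curve to classes of tuples; [phi] is its set-theoretic
    inverse. The roots x_i cannot be ordered regularly in (B, C), so the tuple over a point is an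
    arbitrary choice. Only its symmetric functions are regular, and in characteristic zero averaging
    over ['S_n] reduces questions about open sets and functions on Sym^n E to polarised power sums.
    The closure enters twice. Points with C != 0 lie in X_n and are dense in the curve, which puts
    the image of [psi] in the closure. Conversely, symmetric polynomial relations valid on X_n
    persist on the closure, which makes [psi] surjective. *)

Section Interpolation.
Variables (K : numClosedFieldType) (n : nat).
Implicit Types (x y : 'I_n -> K) (q : {poly K}).

Definition prodX x : {poly K} := \prod_i ('X - (x i)%:P).

Definition cofX x (i : 'I_n) : {poly K} := \prod_(j | j != i) ('X - (x j)%:P).

Lemma prodX_cofX x i : prodX x = ('X - (x i)%:P) * cofX x i.
Proof. by rewrite /prodX (bigD1 i). Qed.

Lemma prodX_monic x : prodX x \is monic.
Proof. by apply: monic_prod => i _; exact: monicXsubC. Qed.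

Lemma size_prodX x : size (prodX x) = n.+1.
Proof. by rewrite /prodX -big_enum /= size_prod_XsubC size_enum_ord. Qed.

Lemma cofX_monic x i : cofX x i \is monic.
Proof. by apply: monic_prod => j _; exact: monicXsubC. Qed.

Lemma size_cofX x i : size (cofX x i) = n.
Proof.
have := size_prodX x; rewrite (prodX_cofX x i) size_monicM ?monicXsubC //.
  by rewrite size_XsubC; case.
by rewrite monic_neq0 // cofX_monic.
Qed.

Lemma prodX_root x i : (prodX x).[x i] = 0.
Proof. by rewrite (prodX_cofX x i) hornerM hornerXsubC subrr mul0r. Qed.

Lemma cofX_off x i j : j != i -> (cofX x i).[x j] = 0.
Proof.
by move=> ji; rewrite /cofX (bigD1 j) //= hornerM hornerXsubC subrr mul0r.
Qed.

Lemma cofX_diag x i : (cofX x i).[x i] = (prodX x)^`().[x i].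
Proof.
by rewrite (prodX_cofX x i) derivM derivXsubC mul1r hornerD hornerM hornerXsubC subrr
  mul0r addr0.
Qed.

Lemma cofX_coef x i : (cofX x i)`_n.-1 = 1.
Proof. by have /monicP := cofX_monic x i; rewrite lead_coefE size_cofX. Qed.

Lemma deriv_prodX_neq0 x i : injective x -> (prodX x)^`().[x i] != 0.
Proof.
move=> inj; rewrite -cofX_diag horner_prod; apply/prodf_neq0 => j ji.
by rewrite hornerXsubC subr_eq0; apply: contra ji => /eqP/inj->.
Qed.

(** The moments of degree at most n - 2 vanish, so only the top coefficient of [q] contributes. *)
Lemma moment_poly x y q : (size q <= n)%N ->
  (forall r, (r + 2 <= n)%N -> \sum_i x i ^+ r * y i = 0) ->
  \sum_i q.[x i] * y i = q`_n.-1 * \sum_i x i ^+ n.-1 * y i.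
Proof.
move=> sq m0.
have -> : \sum_i q.[x i] * y i =
    \sum_(r < n) q`_r * \sum_i x i ^+ r * y i.
  under eq_bigr do rewrite (horner_coef_wide _ sq) mulr_suml.
  rewrite exchange_big; apply: eq_bigr => r _.
  by rewrite mulr_sumr; apply: eq_bigr => i _; rewrite mulrA.
case: n q x y sq m0 => [|m] q x y sq m0; first by rewrite !big_ord0 mulr0.
rewrite big_ord_recr /= big1 ?add0r // => r _.
by rewrite m0 ?mulr0 // addn2 !ltnS.
Qed.

(* The cofactor of x i vanishes at every other x j, even when x j = x i. *)
Lemma moment_cofX x y i :
  (forall r, (r + 2 <= n)%N -> \sum_i x i ^+ r * y i = 0) ->
  (prodX x)^`().[x i] * y i = \sum_i x i ^+ n.-1 * y i.
Proof.
move/(moment_poly (q := cofX x i)); rewrite size_cofX => /(_ (leqnn n)).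
rewrite cofX_coef mul1r (bigD1 i) //= [X in _ + X]big1 ?addr0 ?cofX_diag //.
by move=> j ji; rewrite cofX_off ?mul0r.
Qed.

Lemma poly_eq_on x q (r : {poly K}) : injective x -> (size q <= n)%N -> (size r
    <= n)%N ->
  (forall i, q.[x i] = r.[x i]) -> q = r.
Proof.
move=> inj sq sr e; apply/eqP; rewrite -subr_eq0; apply/eqP.
apply: (@roots_geq_poly_eq0 _ _ (codom x)).
- by apply/allP => _ /codomP[i ->]; apply/rootP; rewrite hornerD hornerN e subrr.
- by apply/injectiveP.
- rewrite size_codom card_ord (leq_trans (size_polyD _ _)) //.
  by rewrite size_polyN geq_max sq sr.
Qed.

(** Comparison of the coefficients of X^(n-1) in the interpolation formula, the cofactors being
    monic of degree n - 1. *)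
Lemma lagrange_coef x q : injective x -> (size q <= n)%N ->
  \sum_i q.[x i] / (prodX x)^`().[x i] = q`_n.-1.
Proof.
move=> inj sq.
have -> : q = \sum_i (q.[x i] / (prodX x)^`().[x i]) *: cofX x i.
  apply: (poly_eq_on inj sq).
    rewrite (leq_trans (size_sum _ _ _)) //; apply/bigmax_leqP => i _.
    by rewrite (leq_trans (size_scale_leq _ _)) // size_cofX.
  move=> i; rewrite horner_sum (bigD1 i) //= big1 ?addr0.
    by rewrite hornerZ cofX_diag divfK // deriv_prodX_neq0.
  by move=> j ji; rewrite hornerZ cofX_off ?mulr0 // eq_sym.
rewrite coef_sum; apply: eq_bigr => i _; rewrite coefZ cofX_coef mulr1.
rewrite horner_sum (bigD1 i) //= big1 ?addr0.
  by rewrite hornerZ cofX_diag divfK // deriv_prodX_neq0.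
by move=> j ji; rewrite hornerZ cofX_off ?mulr0 // eq_sym.
Qed.

Lemma monic_prodX q : q \is monic -> size q = n.+1 -> exists x, q = prodX x.
Proof.
move=> /monicP mq sq; have [r] := closed_field_poly_normal q.
rewrite mq scale1r => qr; have sr : size r = n.
  by move: sq; rewrite qr size_prod_XsubC; case.
exists (fun i : 'I_n => nth (0 : K) r i); rewrite /prodX {1}qr (big_nth 0) big_mkord.
by rewrite sr.
Qed.

End Interpolation.

Lemma exists_nonroot (K : numFieldType) (q : {poly K}) :
  q != 0 -> exists a, q.[a] != 0.
Proof.
move=> q0; apply: contrapT => h; move/negP: q0; apply; apply/eqP.
apply: (@roots_geq_poly_eq0 _ q [seq i%:R | i <- iota 0 (size q)]).
- apply/allP => _ /mapP[i _ ->]; apply/rootP; apply: contrapT => /eqP e.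
  by apply: h; exists i%:R.
- by rewrite map_inj_uniq ?iota_uniq // => i j /eqP; rewrite eqr_nat => /eqP.
- by rewrite size_map size_iota.
Qed.

(** * The Lame equation *)

Lemma dvd_prodX (K : numClosedFieldType) (n : nat) (x : 'I_n -> K) (q : {poly K}) :
  injective x -> (forall i, q.[x i] = 0) -> exists r, q = prodX x * r.
Proof.
move=> inj q0; have [||r ->] := @uniq_roots_prod_XsubC _ q (codom x).
- by apply/allP => _ /codomP[i ->]; apply/rootP.
- by rewrite uniq_rootsE; apply/injectiveP.
exists r; rewrite mulrC; congr (_ * _).
by rewrite big_image.
Qed.

Lemma deriv_eq0 (K : numClosedFieldType) (q : {poly K}) :
  q^`() = 0 -> q = (q.[0])%:P.
Proof.
move=> q0; apply/polyP => -[|i]; rewrite coefC ?horner_coef0 //=.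
have /(congr1 (fun r : {poly K} => r`_i)) := q0.
rewrite coef_deriv coef0 => /eqP.
by rewrite mulrn_eq0 /= => /eqP.
Qed.

Section LameEquation.
Variables (K : numClosedFieldType) (g2 g3 : K).
Implicit Types (f h : {poly K}).

Definition wpoly : {poly K} := 4 *: 'X^3 - g2 *: 'X - g3%:P.

Lemma horner_wpoly a : wpoly.[a] = 4 * a ^+ 3 - g2 * a - g3.
Proof. by rewrite !hornerE. Qed.

(* The symmetric square of the Lame equation in the coordinate x = wp(z). *)
Definition lame_ode f h : {poly K} :=
  wpoly * f^`()^`()^`() *+ 2 + wpoly^`() * f^`()^`() *+ 3 + wpoly^`()^`() * f^`()
  - f^`() * h *+ 2 - f * h^`().

Definition lame_quot f h : {poly K} :=
  wpoly * f^`()^`() *+ 2 + wpoly^`() * f^`() - f * h.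

Lemma lame_odeB f1 f2 h : lame_ode (f1 - f2) h = lame_ode f1 h - lame_ode f2 h.
Proof. by rewrite /lame_ode !derivB; ring. Qed.

(** For al = 4 n (n + 1) and be = 4 B this is, up to the factor -2 and the alternating signs, the
    recursion that defines s_(n - mu). *)
Lemma coef_lame_ode f (al be : K) mu : let m : K := mu%:R in
  (lame_ode f (al *: 'X + be%:P))`_mu =
  (2 * m + 1) * (4 * m * (m + 1) - al) * f`_mu - 2 * be * (m + 1) * f`_mu.+1
  - g2 * (m + 1) * (m + 2) * (2 * m + 3) * f`_mu.+2
  - 2 * g3 * (m + 1) * (m + 2) * (m + 3) * f`_mu.+3.
Proof.
move=> m; rewrite /lame_ode.
have -> : wpoly^`() = 12 *: 'X^2 - g2%:P.
  rewrite /wpoly !(derivB, derivZ, derivXn, derivX, derivC) -!mul_polyC; ring.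
have -> : (12 *: 'X^2 - g2%:P : {poly K})^`() = 24 *: 'X.
  rewrite !(derivB, derivZ, derivXn, derivX, derivC) -!mul_polyC; ring.
have -> : (al *: 'X + be%:P)^`() = al%:P by rewrite derivD derivZ derivX derivC
    addr0 alg_polyC.
rewrite /wpoly !mulrBl !mulrDl -!scalerAl !mulrDr -!scalerAr.
rewrite [_ * be%:P]mulrC [_ * al%:P]mulrC !mul_polyC [_ * 'X]mulrC.
rewrite !(coefB, coefD, coefMn, coefZ, coefN, coefXnM, coefXM, coef_deriv) /m.
case: mu @m => [|[|[|mu]]] /=; rewrite ?subSS ?subn0 ?coef_deriv.
all: ring.
Qed.

(** The derivative of the left-hand side is [- f * lame_ode f h]. *)
Lemma first_integral f h : lame_ode f h = 0 ->
  wpoly * f^`() ^+ 2 - f * lame_quot f h =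
  ((wpoly * f^`() ^+ 2 - f * lame_quot f h).[0])%:P.
Proof.
move=> ode; apply: deriv_eq0.
rewrite -[RHS](mulr0 (- f)) -ode /lame_ode /lame_quot.
rewrite !expr2 !(derivB, derivD, derivM, derivMn); ring.
Qed.

Section Degree.
Variable n : nat.

(** Four times the potential n (n + 1) wp + B of the Lame equation. *)
Definition lame_h (B : K) : {poly K} :=
  (4 * n%:R * (n%:R + 1)) *: 'X + (4 * B)%:P.

Definition lame_poly (B : K) : {poly K} :=
  \poly_(k < n.+1) ((-1) ^+ (n + k) * (s_ g2 g3 n (n%:Z - k%:Z)).[B]).

(** Holds without a bound on [k]: beyond n the index of [s_] is negative and [s_] vanishes there. *)
Lemma lame_poly_coef B k :
  (lame_poly B)`_k = (-1) ^+ (n + k) * (s_ g2 g3 n (n%:Z - k%:Z)).[B].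
Proof.
rewrite coef_poly ltnS; case: leqP => // nk.
have -> : n%:Z - k%:Z = Negz (k - n.+1).
  by rewrite NegzE -subSn // subSS -[k in LHS](subnK (ltnW nk)) PoszD opprD
      addrCA subrr addr0.
by rewrite /= horner0 mulr0.
Qed.

Lemma lame_poly_monic B : lame_poly B \is monic /\ size (lame_poly B) = n.+1.
Proof.
have c : (lame_poly B)`_n = 1.
  by rewrite lame_poly_coef subrr /= hornerC mulr1 addnn -mul2n exprM sqrrN
      expr1n expr1n.
have sz : size (lame_poly B) = n.+1.
  apply/eqP; rewrite eqn_leq size_poly /= ltnNge; apply/negP => /leq_sizeP/(_ n
      (leqnn n)).
  by move/eqP; rewrite c oner_eq0.
by split => //; rewrite monicE lead_coefE sz c.
Qed.

Lemma lame_poly_ode B : lame_ode (lame_poly B) (lame_h B) = 0.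
Proof.
apply/polyP => mu; rewrite coef_lame_ode coef0.
case: (ltngtP mu n) => [lt|gt|->].
- have /= := s_rec g2 g3 lt.
  move/(congr1 (fun q : {poly K} => q.[B])); rewrite horner0.
  rewrite !(hornerD, hornerN, hornerZ, hornerM, hornerX) !lame_poly_coef.
  have e j : n%:Z - (mu + j)%N%:Z = n%:Z - mu%:Z - j%:Z by rewrite PoszD opprD addrA.
  rewrite -[mu.+3]addn3 -[mu.+2]addn2 -[mu.+1]addn1 !e !addnA !exprD.
  move: (_.[B]) (_.[B]) (_.[B]) (_.[B]) => s0 s1 s2 s3 rec.
  rewrite -[RHS](mulr0 (-2 * (-1) ^+ n * (-1) ^+ mu)) rec.
  by field.
- have z j : (mu <= j)%N -> (lame_poly B)`_j = 0.
    move=> mj; rewrite nth_default //; case: (lame_poly_monic B) => _ ->.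
    exact: leq_trans gt mj.
  by rewrite !z ?leqnn ?leqW //; ring.
(* Remaining case mu = n: the factor 4 mu (mu + 1) - 4 n (n + 1) vanishes. *)
have z j : (n < j)%N -> (lame_poly B)`_j = 0.
  by move=> nj; rewrite nth_default //; case: (lame_poly_monic B) => _ ->.
have l1 := ltnSn n; have l2 := leqW l1; have l3 := leqW l2.
by rewrite (z _ l1) (z _ l2) (z _ l3); ring.
Qed.

(** The first integral is constant, so it can be evaluated at X = 0, where it involves only s_n,
    s_(n-1) and s_(n-2); the formula for [ell] is this value. *)
Lemma lame_poly_integral B :
  wpoly * (lame_poly B)^`() ^+ 2 -
    lame_poly B * lame_quot (lame_poly B) (lame_h B) = ((ell g2 g3 n).[B])%:P.
Proof.
rewrite first_integral ?lame_poly_ode //; congr (_%:P).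
have f0 : (lame_poly B).[0] = (-1) ^+ n * (s_ g2 g3 n n%:Z).[B].
  by rewrite horner_coef0 lame_poly_coef addn0 subr0.
have f1 : (lame_poly B)^`().[0] = - (-1) ^+ n * (s_ g2 g3 n (n%:Z - 1)).[B].
  by rewrite horner_coef0 coef_deriv lame_poly_coef exprD; ring.
have f2 : (lame_poly B)^`()^`().[0] = 2 * (-1) ^+ n * (s_ g2 g3 n (n%:Z - 2)).[B].
  by rewrite horner_coef0 !coef_deriv lame_poly_coef exprD; ring.
have sg : (-1 : K) ^+ n * (-1) ^+ n = 1 by rewrite -exprD addnn -mul2n exprM
    sqrrN expr1n expr1n.
have w0 : wpoly.[0] = - g3 by rewrite horner_wpoly; ring.
have w1 : wpoly^`().[0] = - g2.
  rewrite /wpoly !(derivB, derivZ, derivXn, derivX, derivC) !(hornerD, hornerN).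
  by rewrite !hornerZ hornerMn hornerXn !hornerC /= expr0n /= !(mulr0n, mul0rn); ring.
have h0 : (lame_h B).[0] = 4 * B by rewrite /lame_h !hornerE.
rewrite /lame_quot; move: wpoly (lame_h B) (lame_poly B) f0 f1 f2 w0 w1 h0.
move=> w h f f0 f1 f2 w0 w1 h0.
rewrite !(hornerD, hornerN, hornerM, horner_exp, hornerMn) f0 f1 f2 w0 w1 h0.
rewrite /ell subr0 !(hornerD, hornerN, hornerZ, hornerM, horner_exp, hornerX).
move: (s_ g2 g3 n n%:Z).[B] (s_ g2 g3 n (n%:Z - 1)).[B] (s_ g2 g3 n (n%:Z - 2)).[B].
move=> a b c.
transitivity ((-1) ^+ n * (-1) ^+ n *
  (4 * (B * a ^+ 2) + 4 * g3 * (c * a) - g2 * (b * a) - g3 * b ^+ 2)); last first.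
  by rewrite sg mul1r; ring.
ring.
Qed.

(** The coefficients of X^n and X^(n-1) in the equation determine [al] and [be]. The difference from
    [lame_poly] then solves the same linear equation; if it had degree m < n, its leading
    coefficient would be annihilated by (2 m + 1) (4 m (m + 1) - 4 n (n + 1)) != 0. *)
Lemma lame_poly_unique f (al be : K) : (0 < n)%N -> f \is monic -> size f = n.+1 ->
  lame_ode f (al *: 'X + be%:P) = 0 -> f = lame_poly (- (2 * n - 1)%:R * f`_n.-1).
Proof.
move=> n0 /monicP mf sf ode.
have fn : f`_n = 1 by rewrite -mf lead_coefE sf.
have fz j : (n < j)%N -> f`_j = 0 by move=> nj; rewrite nth_default ?sf.
have l1 := ltnSn n; have l2 := leqW l1; have l3 := leqW l2.
have cf := coef_lame_ode f al be; rewrite /= ode in cf.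
have eal : al = 4 * n%:R * (n%:R + 1).
  have := cf n; rewrite coef0 fn (fz _ l1) (fz _ l2) (fz _ l3) !mulr0 !subr0
      mulr1 => /esym/eqP.
  rewrite mulf_eq0 subr_eq0 => /orP[|/eqP <- //].
  by rewrite gt_eqF // ltr_wpDl // mulr_ge0.
set B := _ * f`_n.-1.
have ebe : be = 4 * B.
  have := cf n.-1; rewrite coef0 prednK // fn eal (fz _ l1) (fz _ l2).
  have -> : n.-1%:R = n%:R - 1 :> K by rewrite -subn1 natrB.
  move=> e; rewrite /B natrB ?natrM; last by rewrite -[1%N]muln1 leq_mul.
  apply: (@mulfI _ (2 * n%:R)); first by rewrite mulf_neq0 // pnatr_eq0 -lt0n.
  apply/eqP; rewrite -subr_eq0; apply/eqP.
  by rewrite -[RHS]oppr0 [in RHS]e; ring.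
apply/eqP; rewrite -subr_eq0; apply: contrapT => /negP d0.
set d := f - _ in d0.
have dode : lame_ode d (lame_h B) = 0.
  by rewrite lame_odeB lame_poly_ode subr0 /lame_h -eal -ebe.
have [mB sB] := lame_poly_monic B.
have sd : (size d <= n)%N.
  apply/leq_sizeP => j nj; rewrite coefB; case: (ltngtP n j) nj => // [nj _|<- _].
    by rewrite !nth_default ?subr0 ?sf ?sB.
  by move/monicP: mB; rewrite lead_coefE sB fn /= => ->; rewrite subrr.
have [m sm] : exists m, size d = m.+1.
  by exists (size d).-1; rewrite prednK // size_poly_gt0.
have := coef_lame_ode d (4 * n%:R * (n%:R + 1)) (4 * B) m.
have dz j : (m < j)%N -> d`_j = 0 by move=> mj; rewrite nth_default ?sm.
have k1 := ltnSn m; have k2 := leqW k1; have k3 := leqW k2.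
rewrite /= dode coef0 (dz _ k1) (dz _ k2) (dz _ k3) !mulr0 !subr0.
have mn : (m < n)%N by rewrite -sm.
move/esym/eqP; rewrite !mulf_eq0 -[d`_m == 0]negbK.
have -> /= : d`_m != 0 by rewrite -[m]/(m.+1.-1) -sm -lead_coefE lead_coef_eq0.
rewrite orbF => /orP[|].
  by rewrite gt_eqF // ltr_wpDl // mulr_ge0.
rewrite subr_eq0 -!mulrA (inj_eq (mulfI _)) ?pnatr_eq0 //.
by rewrite !natr1 -!natrM eqr_nat ltn_eqF // ltn_mul.
Qed.

End Degree.
End LameEquation.

(** * Tuples attached to the points of C^2 = ell(B) *)

Section LameTuples.
Variables (K : numClosedFieldType) (g2 g3 : K) (n : nat).
Hypothesis n_gt0 : (0 < n)%N.
Implicit Types (x y : 'I_n -> K) (B C : K).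

(** Unlike [tupleX], this allows repeated x_i and vanishing y_i, and so also describes the tuples
    over the points with C = 0. *)
Definition lame_tuple B C x y : Prop :=
  [/\ forall i, y i ^+ 2 = (wpoly g2 g3).[x i],
      prodX x = lame_poly g2 g3 n B,
      forall r, (r + 2 <= n)%N -> \sum_i x i ^+ r * y i = 0 &
      \sum_i x i ^+ n.-1 * y i = C].

Lemma prodX_coef_pred x : (prodX x)`_n.-1 = - \sum_i x i.
Proof.
have := @coefPn_prod_XsubC K (codom x); rewrite size_codom card_ord !big_image /=.
by apply; rewrite -lt0n.
Qed.

Lemma lame_tuple_C B C x y i : lame_tuple B C x y -> (prodX x)^`().[x i] * y i = C.
Proof. by case=> _ _ m0 mC; rewrite moment_cofX. Qed.

(** The recursion at mu = n - 1 gives s_1 = B / (2 n - 1); this is the origin of the factor 2 n - 1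
    in B = (2 n - 1) \sum x_i. *)
Lemma lame_poly_coef_pred B : (lame_poly g2 g3 n B)`_n.-1 = - (B / (2 * n - 1)%:R).
Proof.
rewrite lame_poly_coef; case: n n_gt0 => // m _.
have -> : m.+1%:Z - m.+1.-1%:Z = 1%N by lia.
have -> : (-1 : K) ^+ (m.+1 + m.+1.-1) = -1.
  by rewrite addSn exprS addnn -mul2n exprM sqrrN !expr1n mulr1.
have -> : (2 * m.+1 - 1 = (2 * m).+1)%N by lia.
rewrite /= /lame_step !hornerE subn1 /=.
have -> : (2 * m).+1%:R = 2 * m%:R + 1 :> K by rewrite -natr1 natrM.
have -> : m.+1%:R = m%:R + 1 :> K by rewrite -natr1.
have m0 : 0 <= m%:R :> K by [].
have a0 : 2 * m%:R + 1 != 0 :> K by rewrite gt_eqF // ltr_wpDl // mulr_ge0.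
have b0 : m%:R + 1 != 0 :> K by rewrite gt_eqF // ltr_wpDl.
field; rewrite a0 /=.
by rewrite gt_eqF // ltr_wpDl // !addr_ge0.
Qed.

Lemma lame_tuple_B B C x y : lame_tuple B C x y -> B = (2 * n - 1)%:R * \sum_i x i.
Proof.
case=> _ e _ _; rewrite -[\sum_i _]opprK -prodX_coef_pred e lame_poly_coef_pred opprK.
by rewrite mulrC divfK // pnatr_eq0; lia.
Qed.

Lemma lame_tuple_curve B C x y : lame_tuple B C x y -> C ^+ 2 = (ell g2 g3 n).[B].
Proof.
move=> t; rewrite -(lame_tuple_C (Ordinal n_gt0) t).
case: t => yy e _ _; move: (Ordinal n_gt0) => i.
have /(congr1 (fun q : {poly K} => q.[x i])) := lame_poly_integral g2 g3 n B.
rewrite -e [in RHS]hornerC => <-.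
rewrite [in RHS]hornerD hornerN [(prodX x * _).[_]]hornerM prodX_root mul0r subr0
  hornerM horner_exp.
by rewrite exprMn yy mulrC.
Qed.

(** By the moment conditions f'(x_i) y_i = C for all i, so f divides p f'^2 - C^2, with quotient g.
    Differentiating, f' (p' f' + 2 p f'' - g) = f g'; as f' is nonzero at the roots, f divides the
    bracket, with quotient h, and g' = f' h. Eliminating g gives the third order equation with this
    h, and degrees force h to be linear, so that uniqueness applies. *)
Lemma tuple_lame x y : injective x -> (forall i, y i ^+ 2 = (wpoly g2 g3).[x i]) ->
  (forall i, y i != 0) ->
  (forall r, (r + 2 <= n)%N -> \sum_i x i ^+ r * y i = 0) ->
  lame_tuple ((2 * n - 1)%:R * \sum_i x i) (\sum_i x i ^+ n.-1 * y i) x y.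
Proof.
move=> inj yy y0 m0; split=> //.
set f := prodX x; set C := \sum_i x i ^+ n.-1 * y i.
have fC i : f^`().[x i] * y i = C by rewrite moment_cofX.
have f'0 i : f^`().[x i] != 0 by exact: deriv_prodX_neq0.
pose w := wpoly g2 g3.
have [|g eg] := @dvd_prodX _ _ x (w * f^`() ^+ 2 - (C ^+ 2)%:P) inj.
  move=> i; rewrite hornerD hornerN hornerM horner_exp hornerC -yy -(fC i); ring.
have eg' : f^`() * (w^`() * f^`() + w * f^`()^`() *+ 2) = f^`() * g + f * g^`().
  have := congr1 (fun q : {poly K} => q^`()) eg.
  by rewrite /= !expr2 !(derivB, derivM, derivC) -/f subr0 => <-; ring.
have [|h eh] := @dvd_prodX _ _ x (w^`() * f^`() + w * f^`()^`() *+ 2 - g) inj.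
  move=> i; apply: (mulfI (f'0 i)); rewrite mulr0 -hornerM mulrBr eg' addrAC
      subrr add0r.
  by rewrite hornerM prodX_root mul0r.
rewrite -/f in eh eg.
have f0 : f != 0 by rewrite monic_neq0 // prodX_monic.
have g'E : g^`() = f^`() * h.
  apply: (mulfI f0); rewrite mulrCA -eh mulrBr eg'; ring.
have gE : g = w^`() * f^`() + w * f^`()^`() *+ 2 - f * h by rewrite -eh; ring.
have ode : lame_ode g2 g3 f h = 0.
  rewrite /lame_ode -/w; clearbody w.
  have := congr1 (fun q : {poly K} => q^`()) gE.
  rewrite g'E !(derivB, derivD, derivM, derivMn) => /eqP; rewrite -subr_eq0 => /eqP e.
  by rewrite -[RHS]oppr0 -[in RHS]e; ring.
have sf : size f = n.+1 by exact: size_prodX.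
have sf' : (size f^`() <= n)%N by rewrite (leq_trans (size_poly _ _)) // sf.
have sf'' : (size f^`()^`() <= n.-1)%N.
  by rewrite (leq_trans (size_poly _ _)) //; lia.
have sw : (size w <= 4)%N.
  apply/leq_sizeP => j j4; rewrite !coefB !coefZ coefXn coefX coefC.
  by case: j j4 => [|[|[|[|j]]]] //= _; rewrite !mulr0 !subr0.
have sw' : (size w^`() <= 3)%N.
  by rewrite (leq_trans (size_poly _ _)) //; lia.
(* The degree of p f'^2 is at most 2 n + 1 and f is monic of degree n. The same count for [eh] below
   makes [h] at most linear. *)
have sg : (size g <= n.+2)%N.
  have [->|g0] := eqVneq g 0; first by rewrite size_poly0.
  have := size_monicM (prodX_monic x) g0; rewrite -/f -eg sf => /= e.
  suff: (n + size g <= n + n.+2)%N by rewrite leq_add2l.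
  rewrite -[(n + size g)%N]e (leq_trans (size_polyD _ _)) // geq_max size_polyN.
  rewrite (leq_trans (size_polyC_leq1 _)) ?addnS ?andbT //.
  rewrite (leq_trans (size_polyMleq _ _)) // expr2.
  have := size_polyMleq f^`() f^`(); move: sw sf'.
  by move: (size (f^`() * f^`())) (size w) (size f^`()) => a b c; lia.
have sh : (size h <= 2)%N.
  have [->|h0] := eqVneq h 0; first by rewrite size_poly0.
  have := size_monicM (prodX_monic x) h0; rewrite -/f -eh sf => /= e.
  suff: (n + size h <= n + 2)%N by rewrite leq_add2l.
  rewrite -[(n + size h)%N]e (leq_trans (size_polyD _ _)) // geq_max size_polyN
      addn2 sg andbT.
  rewrite (leq_trans (size_polyD _ _)) // geq_max mulr2n.
  rewrite (leq_trans (size_polyMleq _ _)) /=; last first.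
    by move: sw' sf'; move: (size w^`()) (size f^`()) => a b; lia.
  rewrite (leq_trans (size_polyD _ _)) // maxnn.
  rewrite (leq_trans (size_polyMleq _ _)) //.
  by move: sw sf''; move: (size w) (size f^`()^`()) => a b; lia.
have hE : h = h`_1 *: 'X + (h`_0)%:P.
  apply/polyP => j; rewrite coefD coefZ coefX coefC.
  case: j => [|[|j]]; rewrite ?(mulr0, mulr1, add0r, addr0) //.
  by rewrite nth_default ?(leq_trans sh).
rewrite hE in ode.
apply: etrans (lame_poly_unique n_gt0 (prodX_monic x) sf ode) _.
rewrite prodX_coef_pred; congr lame_poly.
by rewrite mulrNN.
Qed.


(** At a root the first integral reads p(x_i) f'(x_i)^2 = C^2 != 0, so the roots are simple and y_i
    = C / f'(x_i) lies over x_i. Lagrange interpolation of X^r then evaluates the moments. *)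
Lemma lame_tuple_exists_neq0 B C : C != 0 -> C ^+ 2 = (ell g2 g3 n).[B] ->
  exists x y, lame_tuple B C x y.
Proof.
move=> C0 Cell; have [mB sB] := lame_poly_monic g2 g3 n B.
have [x fx] := monic_prodX mB sB.
have int i : (wpoly g2 g3).[x i] * (prodX x)^`().[x i] ^+ 2 = C ^+ 2.
  have /(congr1 (fun q : {poly K} => q.[x i])) := lame_poly_integral g2 g3 n B.
  rewrite fx [in RHS]hornerC -Cell => <-.
  by rewrite [in RHS]hornerD hornerN [(prodX x * _).[_]]hornerM prodX_root mul0r subr0
  hornerM horner_exp.
have f'0 i : (prodX x)^`().[x i] != 0.
  apply/eqP => f'0; have := int i; rewrite f'0 expr0n mulr0 => /esym/eqP.
  by rewrite sqrf_eq0 (negPf C0).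
have inj : injective x.
  move=> i j xij; apply/eqP; apply: contraT => ij.
  by have := f'0 j; rewrite -cofX_diag -xij cofX_off // eqxx.
exists x, (fun i => C / (prodX x)^`().[x i]).
have mom r : (r < n)%N ->
    \sum_i x i ^+ r * (C / (prodX x)^`().[x i]) = C * (r == n.-1)%:R.
  move=> rn; have := @lagrange_coef _ _ x 'X^r inj.
  rewrite size_polyXn => /(_ rn); rewrite coefXn eq_sym => <-.
  by rewrite mulr_sumr; apply: eq_bigr => i _; rewrite hornerXn mulrCA.
split=> //.
- by move=> i; rewrite expr_div_n -(int i) mulfK // sqrf_eq0.
- move=> r rn; rewrite mom; last by lia.
  by rewrite (_ : (r == n.-1) = false) ?mulr0 //; lia.
- by rewrite mom ?eqxx ?mulr1 // prednK.
Qed.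

(* The exponents of the third order equation at a point a that is not a root
   of the cubic are 0, 1, 2; where ell vanishes the value 1 is excluded by the
   first integral. *)
Lemma lame_root_double B x a : (ell g2 g3 n).[B] = 0 ->
  prodX x = lame_poly g2 g3 n B -> (wpoly g2 g3).[a] != 0 ->
  (exists i, x i = a) -> #|[set i | x i == a]%SET| = 2.
Proof.
move=> l0 fx wa [i0 xi0]; set m := #|_|.
have fE : prodX x = ('X - a%:P) ^+ m * \prod_(i | x i != a) ('X - (x i)%:P).
  rewrite /prodX (bigID (fun i => x i == a)) /=; congr (_ * _).
  rewrite (eq_bigr (fun=> 'X - a%:P)) => [|i /eqP -> //].
  by rewrite prodr_const /m; congr (_ ^+ _); apply: eq_card => i; rewrite [RHS]inE.
set q := \prod_(i | x i != a) _ in fE; set l := 'X - a%:P in fE.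
have qa : q.[a] != 0.
  rewrite horner_prod; apply/prodf_neq0 => i xi.
  by rewrite hornerXsubC subr_eq0 eq_sym.
have l'1 : l^`() = 1 by rewrite /l derivXsubC.
have la : l.[a] = 0 by rewrite hornerXsubC subrr.
have := lame_poly_integral g2 g3 n B; rewrite l0 -fx fE /lame_quot.
have m0 : (0 < m)%N by apply/card_gt0P; exists i0; rewrite inE xi0.
move: (wpoly g2 g3) wa => w wa; move: (lame_h n B) => h.
have l0' : l != 0 by rewrite monic_neq0 // monicXsubC.
clear fE; clearbody m l q.
case: m m0 => [//|[|k]] _.
  rewrite expr1 => /(congr1 (fun r : {poly K} => r.[a])).
  rewrite derivM l'1 mul1r hornerC.
  rewrite !(hornerD, hornerN, hornerM, horner_exp) la !mul0r subr0 addr0.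
  move/eqP; rewrite mulf_eq0 (negPf wa) /= sqrf_eq0.
  by rewrite (negPf qa).
pose A := q *+ k.+2 + l * q^`().
pose A2 := A *+ k.+1 + l * A^`().
have d j (r : {poly K}) : (l ^+ j.+1 * r)^`() = l ^+ j * (r *+ j.+1 + l * r^`()).
  by rewrite derivM deriv_exp l'1 mul1r /= mulrDr mulrnAl mulrnAr mulrA -exprSr.
rewrite !d -/A -/A2 => e.
have {e} : l ^+ (k.+1 + k.+1) * (w * A ^+ 2 - q * (w * A2 *+ 2 + w^`() * (l * A)
    - l ^+ 2 * q * h)) = 0.
  rewrite -[RHS]e exprD !exprS; ring.
move/eqP; rewrite mulf_eq0 (negPf (expf_neq0 _ l0')) /=.
move/eqP/(congr1 (fun r : {poly K} => r.[a])).
have Aa : A.[a] = q.[a] * k.+2%:R.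
  by rewrite /A hornerD hornerMn hornerM la mul0r addr0 mulr_natr.
have A2a : A2.[a] = A.[a] * k.+1%:R.
  by rewrite /A2 hornerD hornerMn hornerM la mul0r addr0 mulr_natr.
move: A A2 Aa A2a => {d} A A2 Aa A2a.
rewrite !(hornerD, hornerN, hornerM, horner_exp, hornerMn) la hornerC A2a Aa => e.
(* With multiplicity m = k + 2, dividing by l^(2 m - 2) and evaluating at a leaves p(a) q(a)^2 m (m
   - 2 (m - 1)), which forces m = 2. *)
have : w.[a] * q.[a] ^+ 2 * (k.+2%:R * (k.+2%:R - 2 * k.+1%:R)) = 0.
  by rewrite -[RHS]e; ring.
move/eqP; rewrite !mulf_eq0 (negPf wa) (negPf qa) pnatr_eq0 /= subr_eq0 -natrM eqr_nat.
by move/eqP => ?; lia.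
Qed.

(** The two copies of a double root receive opposite values of y, and y = 0 at the roots of p. The
    involution [other] that exchanges the copies changes the sign of every moment, so all moments
    vanish. *)
Lemma lame_tuple_exists0 B : (ell g2 g3 n).[B] = 0 ->
  exists x y, lame_tuple B 0 x y.
Proof.
move=> l0; have [mB sB] := lame_poly_monic g2 g3 n B.
have [x fx] := monic_prodX mB sB.
pose b a := sqrtC (wpoly g2 g3).[a].
(* True when an earlier index carries the same root; it decides which copy gets the minus sign. At a
   root of p, whatever its multiplicity, both signs give 0. *)
pose fst (i : 'I_n) := [exists j : 'I_n, (j < i)%N && (x j == x i)].
pose y (i : 'I_n) := if fst i then - b (x i) else b (x i).
(* The default of [odflt] is never reached: off the roots of p a second copy exists. *)
pose other (i : 'I_n) := if (wpoly g2 g3).[x i] == 0 then i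
                else odflt i [pick j | (j != i) && (x j == x i)].
have otherP i : (wpoly g2 g3).[x i] != 0 -> [/\ other i != i, x (other i) = x i &
    forall j, x j = x i -> j = i \/ j = other i].
  move=> wi; rewrite /other (negPf wi).
  have /eqP/cards2P[j [k [jk e]]] : #|[set j | x j == x i]%SET| = 2.
    by apply: (lame_root_double l0 (esym fx) wi); exists i.
  have mem z : (x z == x i) = (z == j) || (z == k).
    by have := congr1 (fun A : {set 'I_n} => z \in A) e; rewrite !inE.
  case: pickP => [z /andP[zi /eqP xz]|none] /=.
    split=> // z' /eqP; have := mem z; rewrite xz eqxx mem => /esym/orP h /orP h'.
    have := mem i; rewrite eqxx => /esym/orP h''.
    move: zi h h' h'' jk => /eqP zi.
    move=> [] /eqP ? [] /eqP ? [] /eqP ?; subst => //; by [left|right|rewrite eqxx].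
  exfalso; have := mem i; rewrite eqxx => /esym/orP[] /eqP ei.
    by have := none k; rewrite mem eqxx orbT andbT ei eq_sym jk.
  by have := none j; rewrite mem eqxx andbT ei jk.
have xo i : x (other i) = x i.
  have [e|wi] := boolP ((wpoly g2 g3).[x i] == 0); first by rewrite /other e.
  by case: (otherP i wi).
have inv : involutive other.
  move=> i; have [e|wi] := boolP ((wpoly g2 g3).[x i] == 0).
    by rewrite /other e e.
  have [ne _ al] := otherP i wi.
  have wo : (wpoly g2 g3).[x (other i)] != 0 by rewrite xo.
  have [ne' xoo _] := otherP (other i) wo.
  have [//|eo] : other (other i) = i \/ other (other i) = other i.
    by apply: al; rewrite xoo xo.
  by rewrite eo eqxx in ne'.
have yo i : y (other i) = - y i.
  have [e|wi] := boolP ((wpoly g2 g3).[x i] == 0).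
    have b0 : b (x i) = 0 by rewrite /b (eqP e) sqrtC0.
    by rewrite /y xo b0 oppr0 !if_same oppr0.
  have [ne _ al] := otherP i wi; rewrite /y xo.
  have F1 : fst i = (other i < i)%N.
    apply/existsP/idP => [[j /andP[ji /eqP /al[e|e]]]|lt].
    - by rewrite e ltnn in ji.
    - by rewrite -e.
    - by exists (other i); rewrite lt xo eqxx.
  have F2 : fst (other i) = (i < other i)%N.
    apply/existsP/idP => [[j /andP[ji]]|lt].
      rewrite xo => /eqP /al[e|e]; first by rewrite e in ji.
      by rewrite e ltnn in ji.
    by exists i; rewrite lt xo eqxx.
  rewrite F1 F2; have ne' : (other i : nat) != i by exact: ne.
  by case: ltngtP ne' => // _ _; rewrite opprK.
have mom r : \sum_i x i ^+ r * y i = 0.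
  have e : \sum_i x i ^+ r * y i = - \sum_i x i ^+ r * y i.
    rewrite {1}(reindex_inj (inv_inj inv)) -sumrN; apply: eq_bigr => i _.
    by rewrite xo yo mulrN.
  apply/eqP; rewrite -[_ == 0](mulrn_eq0 _ 2) mulr2n.
  by rewrite {1}e addNr.
exists x, y; split=> // i; rewrite /y; case: ifP => _; rewrite ?sqrrN /b sqrtCK //.
Qed.

Lemma lame_tuple_exists B C : C ^+ 2 = (ell g2 g3 n).[B] ->
  exists x y, lame_tuple B C x y.
Proof.
have [->|C0] := eqVneq C 0; last exact: lame_tuple_exists_neq0.
by rewrite expr0n => /esym/lame_tuple_exists0.
Qed.

(** An entry over a has y_i = b or y_i = -b; it contributes b + b or -b + b to the right-hand
    side. *)
Lemma lame_tuple_count B C x y (a b : K) : lame_tuple B C x y ->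
  b ^+ 2 = (wpoly g2 g3).[a] ->
  (#|[set i | (x i, y i) == (a, b)]%SET|%:R * (2 * b) =
    \sum_i (x i == a)%:R * y i + b * #|[set i | x i == a]%SET|%:R :> K).
Proof.
case=> yy _ _ _ ba; rewrite -!sum1dep_card !natr_sum mulr_sumr mulr_suml.
rewrite [X in X = _]big_mkcond [X in _ + X]big_mkcond -big_split /=.
apply: eq_bigr => i _; rewrite xpair_eqE.
have [xi|] /= := eqVneq (x i) a; last by rewrite mul0r addr0.
have : (y i - b) * (y i + b) == 0 by rewrite -subr_sqr yy xi ba subrr.
rewrite mulf_eq0 subr_eq0 addr_eq0.
have [->|/= _ /eqP ->] := eqVneq (y i) b; first by move=> _; ring.
by ring.
Qed.

(** The polynomial determines the multiset of the x_i. The sum of the y_i over the entries with x_i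
    = a is isolated by a polynomial of degree below n that vanishes at the other roots, hence is
    determined by C through the moments. Both together determine the multiplicity of each point (a,
    b). *)
Lemma lame_tuple_perm B C x y x' y' : lame_tuple B C x y -> lame_tuple B C x' y' ->
  exists s : 'S_n, forall i, x' i = x (s i) /\ y' i = y (s i).
Proof.
move=> t t'.
have [yy fx m0 mC] := t; have [yy' fx' m0' mC'] := t'.
have pe : perm_eq (codom x) (codom x').
  by apply: prod_XsubC_eq; rewrite !big_image /= -!/(prodX _) fx fx'.
have card_codom (T : eqType) (f : 'I_n -> T) a : count_mem a (codom f) = #|[set i
    | f i == a]%SET|.
  by rewrite count_map -sum1_count big_enum_cond /= sum1dep_card.
have xx' a : #|[set i | x i == a]%SET| = #|[set i | x' i == a]%SET|.
  by rewrite -!card_codom; have /seq.permP := pe; apply.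
have Y a : \sum_i (x i == a)%:R * y i = \sum_i (x' i == a)%:R * y' i :> K.
  pose d := rem a (undup (codom x)).
  pose q : {poly K} := \prod_(z <- d) ('X - z%:P).
  have [ia|ia] := boolP (a \in codom x); last first.
    rewrite !big1 // => i _.
    - have [e|] := eqVneq (x' i) a; last by rewrite mul0r.
      by rewrite (perm_mem pe) -e codom_f in ia.
    - have [e|] := eqVneq (x i) a; last by rewrite mul0r.
      by rewrite -e codom_f in ia.
  have sq : (size q <= n)%N.
    rewrite size_prod_XsubC size_rem ?mem_undup // prednK.
      by rewrite (leq_trans (size_undup _)) // size_codom card_ord.
    by rewrite -has_predT; apply/hasP; exists a; rewrite ?mem_undup.
  have qa : q.[a] != 0.
    rewrite -[_ == 0]/(root q a) root_prod_XsubC mem_rem_uniq ?undup_uniq //.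
    by rewrite inE eqxx.
  have qz z : z \in codom x -> q.[z] = q.[a] * (z == a)%:R.
    move=> zx; have [->|za] := eqVneq z a; first by rewrite mulr1.
    rewrite mulr0; apply/rootP; rewrite root_prod_XsubC mem_rem_uniq ?undup_uniq //.
    by rewrite inE za mem_undup.
  apply: (mulfI qa); transitivity (\sum_i q.[x i] * y i).
    by rewrite mulr_sumr; apply: eq_bigr => i _; rewrite (qz (x i)) ?codom_f // mulrA.
  rewrite (moment_poly sq m0) mC -mC' -(moment_poly sq m0').
  rewrite mulr_sumr; apply: eq_bigr => i _; rewrite (qz (x' i)) ?mulrA //.
  by rewrite (perm_mem pe) codom_f.
have N z : #|[set i | (x i, y i) == z]%SET| = #|[set i | (x' i, y' i) == z]%SET|.
  case: z => a b; have [ba|ba] := eqVneq (b ^+ 2) (wpoly g2 g3).[a]; last first.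
    have e0 (u v : 'I_n -> K) : (forall i, v i ^+ 2 = (wpoly g2 g3).[u i]) ->
      #|[set i | (u i, v i) == (a, b)]%SET| = 0.
      move=> uv; apply/eqP; rewrite cards_eq0; apply/eqP/setP => i; rewrite !inE.
      by apply/negbTE; apply: contra ba => /eqP[<- <-]; rewrite uv.
    by rewrite !e0.
  have [b0|b0] := eqVneq b 0.
    have e0 (u v : 'I_n -> K) : (forall i, v i ^+ 2 = (wpoly g2 g3).[u i]) ->
      #|[set i | (u i, v i) == (a, b)]%SET| = #|[set i | u i == a]%SET|.
      move=> uv; apply: eq_card => i; rewrite !inE xpair_eqE.
      have [ua|] //= := eqVneq (u i) a.
      by rewrite b0 -(sqrf_eq0 (v i)) uv ua -ba b0 expr0n eqxx.
    by rewrite (e0 _ _ yy) (e0 _ _ yy').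
  have := lame_tuple_count t ba; rewrite Y xx' -(lame_tuple_count t' ba).
  have b2 : 2 * b != 0 by rewrite mulf_neq0 // pnatr_eq0.
  by move/(mulIf b2)/eqP; rewrite eqr_nat => /eqP.
have : perm_eq [tuple (x' i, y' i) | i < n] [tuple (x i, y i) | i < n].
  apply/allP => z _ /=; have e (u v : 'I_n -> K) : count_mem z [tuple (u i, v i)
      | i < n] = #|[set i | (u i, v i) == z]%SET|.
    exact: (card_codom _ (fun i => (u i, v i)) z).
  by rewrite !e N.
case/tuple_permP => s es; exists s => i.
have /(congr1 (fun t : seq (K * K) => nth (0, 0) t i)) := es.
rewrite -!tnth_nth !tnth_mktuple => -[-> ->]; by [].
Qed.

End LameTuples.

(** * Symmetric functions *)

Section FunctionAlgebras.
Variables (K : numClosedFieldType) (T : Type).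

(** Used for polynomials in coordinates, for germs of rational functions, and in [kappa_poly] for
    functions that are polynomial in a parameter. *)
Definition fun_alg (A : (T -> K) -> Prop) : Prop :=
  [/\ forall c, A (fun=> c),
      forall f g, A f -> A g -> A (fun t => f t + g t) &
      forall f g, A f -> A g -> A (fun t => f t * g t)].

Lemma polyfun_alg J (x : J -> T -> K) : fun_alg (polyfun x).
Proof.
by split; [exact: polyfun_cst|exact: polyfun_add|exact: polyfun_mul].
Qed.

Variable A : (T -> K) -> Prop.
Hypothesis algA : fun_alg A.

Lemma alg_cst c : A (fun=> c). Proof. by case: algA. Qed.

Lemma alg_add f g : A f -> A g -> A (fun t => f t + g t).
Proof. by case: algA => _ + _; apply. Qed.

Lemma alg_mul f g : A f -> A g -> A (fun t => f t * g t).
Proof. by case: algA => _ _; apply. Qed.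

Lemma alg_ext f g : (forall t, f t = g t) -> A f -> A g.
Proof. by move=> /funext ->. Qed.

Lemma alg_scale c f : A f -> A (fun t => c * f t).
Proof. by move=> Af; apply: alg_mul => //; exact: alg_cst. Qed.

Lemma alg_opp f : A f -> A (fun t => - f t).
Proof. by move=> /(alg_scale (-1)); apply: alg_ext => t; rewrite mulN1r. Qed.

Lemma alg_sub f g : A f -> A g -> A (fun t => f t - g t).
Proof. by move=> Af /alg_opp; exact: alg_add. Qed.

Lemma alg_exp f r : A f -> A (fun t => f t ^+ r).
Proof.
move=> Af; elim: r => [|r IH].
  by apply: alg_ext (alg_cst 1) => t; rewrite expr0.
by apply: alg_ext (alg_mul Af IH) => t; rewrite exprS.
Qed.

Lemma alg_sum I (r : seq I) (P : pred I) F : (forall i, P i -> A (F i)) ->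
  A (fun t => \sum_(i <- r | P i) F i t).
Proof.
move=> AF; elim: r => [|i r IH].
  by apply: alg_ext (alg_cst 0) => t; rewrite big_nil.
have [Pi|Pi] := boolP (P i).
  by apply: alg_ext (alg_add (AF i Pi) IH) => t; rewrite big_cons Pi.
by apply: alg_ext IH => t; rewrite big_cons (negPf Pi).
Qed.

Lemma alg_prod I (r : seq I) (P : pred I) F : (forall i, P i -> A (F i)) ->
  A (fun t => \prod_(i <- r | P i) F i t).
Proof.
move=> AF; elim: r => [|i r IH].
  by apply: alg_ext (alg_cst 1) => t; rewrite big_nil.
have [Pi|Pi] := boolP (P i).
  by apply: alg_ext (alg_mul (AF i Pi) IH) => t; rewrite big_cons Pi.
by apply: alg_ext IH => t; rewrite big_cons (negPf Pi).
Qed.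

Lemma alg_horner (q : {poly K}) f : A f -> A (fun t => q.[f t]).
Proof.
move=> Af; apply: (@alg_ext (fun t => \sum_(i < size q) q`_i * f t ^+ i)).
  by move=> t; rewrite horner_coef.
by apply: alg_sum => i _; apply/alg_scale/alg_exp.
Qed.

Lemma alg_coef_prod I (r : seq I) (F : I -> T -> {poly K}) :
  (forall i k, A (fun t => (F i t)`_k)) ->
  forall k, A (fun t => (\prod_(i <- r) F i t)`_k).
Proof.
move=> AF; elim: r => [|i r IH] k.
  by apply: alg_ext (alg_cst (1 : {poly K})`_k) => t; rewrite big_nil.
apply: (@alg_ext (fun t =>
  \sum_(j < k.+1) (F i t)`_j * (\prod_(i <- r) F i t)`_(k - j))).
  by move=> t; rewrite big_cons coefM.
by apply: alg_sum => j _; apply: alg_mul.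
Qed.

Lemma alg_comp J T' (x : J -> T' -> K) (b : T -> T') F :
  (forall j, A (fun t => x j (b t))) -> polyfun x F -> A (fun t => F (b t)).
Proof.
move=> Ax; elim=> [c|j|G H _ AG _ AH|G H _ AG _ AH].
- exact: alg_cst.
- exact: Ax.
- exact: alg_add AG AH.
- exact: alg_mul AG AH.
Qed.

(** * Power sums and moments from the coefficients of the polynomial *)

Section PowerSums.
Variables (n : nat) (xs : T -> 'I_n -> K).
Hypothesis n_gt0 : (0 < n)%N.
Hypothesis Axs : forall k, A (fun t => (prodX (xs t))`_k).

(** Each x_i^n is a combination of lower powers with the coefficients of [prodX], so the moments
    satisfy a linear recursion of order n whatever the weights. *)
Lemma alg_moments (ys : T -> 'I_n -> K) :
  (forall r, (r < n)%N -> A (fun t => \sum_i xs t i ^+ r * ys t i)) ->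
  forall r, A (fun t => \sum_i xs t i ^+ r * ys t i).
Proof.
move=> Am; elim/ltn_ind => r IH; case: (ltnP r n) => [/Am //|nr].
apply: (@alg_ext (fun t => - \sum_(k < n) (prodX (xs t))`_k *
  \sum_i xs t i ^+ (k + (r - n)) * ys t i)); last first.
  by apply: alg_opp; apply: alg_sum => k _; apply: alg_mul => //; apply: IH;
     have := ltn_ord k; lia.
move=> t; apply/eqP; rewrite eq_sym -subr_eq0 opprK; apply/eqP.
transitivity (\sum_(k < n.+1) (prodX (xs t))`_k *
  \sum_i xs t i ^+ (k + (r - n)) * ys t i).
  rewrite big_ord_recr /= addrC subnKC //; congr (_ + _).
  by have /monicP := prodX_monic (xs t); rewrite lead_coefE size_prodX /= => ->;
      rewrite mul1r.
transitivity (\sum_i (prodX (xs t)).[xs t i] * (xs t i ^+ (r - n) * ys t i)).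
  under eq_bigr do rewrite mulr_sumr.
  rewrite exchange_big; apply: eq_bigr => i _.
  rewrite horner_coef size_prodX mulr_suml; apply: eq_bigr => k _.
  by rewrite exprD !mulrA.
by rewrite big1 // => i _; rewrite prodX_root mul0r.
Qed.

Lemma deriv_big_prod (I : eqType) (r : seq I) (F : I -> {poly K}) : uniq r ->
  (\prod_(i <- r) F i)^`() = \sum_(i <- r) (F i)^`() * \prod_(j <- r | j != i) F j.
Proof.
elim: r => [|a r IH] /=; first by rewrite !big_nil derivC.
case/andP=> ar ur; rewrite !big_cons eqxx /= derivM IH //; congr (_ * _ + _).
  rewrite big_seq [RHS]big_seq_cond; apply: eq_bigl => j.
  by case: (boolP (j \in r)) => //= jr; apply/esym; apply: contraNneq ar => <-.
rewrite mulr_sumr; apply: eq_big_seq => i ir.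
rewrite big_cons ifT; last by apply: contraNneq ar => ->.
by rewrite mulrCA.
Qed.

Lemma sum_cofX (x : 'I_n -> K) : \sum_i cofX x i = (prodX x)^`().
Proof.
rewrite /prodX deriv_big_prod ?index_enum_uniq //; apply: eq_bigr => i _.
by rewrite derivXsubC mul1r.
Qed.

Lemma cofX_coef_rec (x : 'I_n -> K) i k :
  (cofX x i)`_k = (prodX x)`_k.+1 + x i * (cofX x i)`_k.+1.
Proof. by rewrite (prodX_cofX x i) mulrBl coefB coefXM coefCM subrK. Qed.

(* Newton's identities, run on the coefficients of the cofactors of prodX. *)
Lemma alg_power_sums r : A (fun t => \sum_i xs t i ^+ r).
Proof.
apply: (@alg_ext (fun t => \sum_i xs t i ^+ r * 1)).
  by move=> t; apply: eq_bigr => i _; rewrite mulr1.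
apply: (alg_moments (ys := fun _ _ => 1)) => {}r.
elim/ltn_ind: r => r IH rn.
(* At j = r the coefficient is the leading one, 1, which leaves the power sum; at j = 0 the sum is a
   coefficient of the derivative of [prodX]. *)
suff H j : (j <= r)%N ->
    A (fun t => \sum_i xs t i ^+ j * (cofX (xs t) i)`_(n.-1 - r + j)).
  apply: alg_ext (H r (leqnn r)) => t; apply: eq_bigr => i _.
  by rewrite subnK ?cofX_coef; last lia.
elim: j => [_|j IHj jr].
  apply: (@alg_ext (fun t => (prodX (xs t))`_(n.-1 - r).+1 * (n.-1 - r).+1%:R)).
    move=> t; rewrite mulr_natr -coef_deriv -sum_cofX coef_sum; apply: eq_bigr => i _.
    by rewrite expr0 mul1r addn0.
  by apply: alg_mul => //; exact: alg_cst.
apply: (@alg_ext (fun t =>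
    \sum_i xs t i ^+ j * (cofX (xs t) i)`_(n.-1 - r + j) -
    (prodX (xs t))`_(n.-1 - r + j).+1 * \sum_i xs t i ^+ j * 1)).
  move=> t; rewrite mulr_sumr -sumrB; apply: eq_bigr => i _.
  by rewrite cofX_coef_rec addnS exprSr; ring.
apply: alg_sub; first by apply: IHj; exact: ltnW.
by apply: alg_mul => //; apply: IH => //; lia.
Qed.

End PowerSums.

(** * Invariants of the symmetric group *)

Section SymmetricFunctions.
Variables (n : nat) (J Y : Type) (c : J -> Y -> K) (Q : T -> 'I_n -> Y).
Hypothesis AQ : forall m, polyfun c m -> A (fun t => \sum_i m (Q t i)).

(* Multiplying the sum for D :\ a by the power sum of m a gives n - #|D :\ a|
   times the sum for D, plus sums for D :\ a with one factor changed. *)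
Lemma alg_perm_prod (D : {set 'I_n}) (m : 'I_n -> Y -> K) :
  (forall i, polyfun c (m i)) ->
  A (fun t => \sum_(s : 'S_n) \prod_(i in D) m i (Q t (s i))).
Proof.
elim: {D}#|D| {-2}D (erefl #|D|) m => [|d IH] D cD m pm.
  have -> : D = finset.set0 by apply/eqP; rewrite -cards_eq0 cD.
  apply: (@alg_ext (fun=> \sum_(s : 'S_n) 1)); last exact: alg_cst.
  by move=> t; apply: eq_bigr => s _; rewrite big_set0.
have [a aD] : exists a, a \in D by apply/card_gt0P; rewrite cD.
have cD' : #|(D :\ a)%SET| = d by move: cD; rewrite (cardsD1 a) aD add1n => -[].
set D' := (D :\ a)%SET in cD'.
pose U i t := \sum_(s : 'S_n) m a (Q t (s i)) * \prod_(k in D') m k (Q t (s k)).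
have UE t : \sum_(s : 'S_n) \prod_(i in D) m i (Q t (s i)) = U a t.
  by apply: eq_bigr => s _; rewrite (big_setD1 a).
have U_in i : i \in D' -> A (U i).
  move=> iD'.
  apply: alg_ext (IH D' cD' (fun k => if k == i then (fun y => m a y * m i y)
      else m k) _).
    move=> t; apply: eq_bigr => s _.
    rewrite (bigD1 i) //= eqxx [in RHS](bigD1 i) //= mulrA; congr (_ * _).
    by apply: eq_bigr => k /andP[_ /negPf ->].
  by move=> k; case: ifP => // _; exact: polyfun_mul.
have U_out i t : i \notin D' -> U i t = U a t.
  move=> iD'; rewrite /U (reindex_inj (mulgI (tperm a i))) /=.
  apply: eq_bigr => s _; rewrite permM tpermR; congr (_ * _).
  apply: eq_bigr => k kD'; rewrite permM tpermD //.
    by apply: contraTneq kD' => <-; rewrite !inE eqxx.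
  by apply: contraNneq iD' => ->.
have tot t : (\sum_i m a (Q t i)) *
      (\sum_(s : 'S_n) \prod_(i in D') m i (Q t (s i))) =
    \sum_(i in D') U i t + #|(~: D')%SET|%:R * U a t.
  rewrite -[LHS]/(_) mulr_sumr.
  transitivity (\sum_i U i t).
    rewrite /U exchange_big; apply: eq_bigr => s _ /=.
    by rewrite (reindex_inj (@perm_inj _ s)) mulr_suml.
  rewrite (bigID (mem D')) /=; congr (_ + _).
  rewrite (eq_bigr (fun=> U a t)) => [|i iD']; last by rewrite U_out.
  rewrite sumr_const mulr_natl; congr (_ *+ _).
  by apply: eq_card => i; rewrite [RHS]finset.inE.
have N0 : #|(~: D')%SET|%:R != 0 :> K.
  by rewrite pnatr_eq0 cards_eq0; apply/set0Pn; exists a; rewrite !inE eqxx.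
apply: (@alg_ext (fun t => #|(~: D')%SET|%:R^-1 * ((\sum_i m a (Q t i)) *
   (\sum_(s : 'S_n) \prod_(i in D') m i (Q t (s i))) - \sum_(i in D') U i t))).
  by move=> t; rewrite tot UE addrAC subrr add0r mulKf.
apply: alg_scale; apply: alg_sub; first by apply: alg_mul; [exact: AQ|exact: IH].
by apply: alg_sum => i iD'; exact: U_in.
Qed.

(* Polarised power sums generate the invariants of the symmetric group. *)
Lemma alg_symmetrize (G : {ffun 'I_n -> Y} -> K) :
  polyfun (fun (ik : 'I_n * J) (P : {ffun 'I_n -> Y}) => c ik.2 (P ik.1)) G ->
  A (fun t => \sum_(s : 'S_n) G [ffun i => Q t (s i)]).
Proof.
move=> pG.
(* The additional factor \prod_i m_i lets the induction pass through products: a coordinate of the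
   entry i is absorbed into m_i. *)
pose sym (H : {ffun 'I_n -> Y} -> K) := forall m : 'I_n -> Y -> K,
  (forall i, polyfun c (m i)) ->
  A (fun t => \sum_(s : 'S_n) H [ffun i => Q t (s i)] * \prod_i m i (Q t (s i))).
have sym1 : sym (fun=> 1).
  move=> m pm; apply: alg_ext (alg_perm_prod [set: 'I_n]%SET pm) => t.
  by apply: eq_bigr => s _; rewrite mul1r; apply: eq_bigl => i; rewrite inE.
suff: forall H, sym H -> sym (fun P => G P * H P).
  move=> /(_ _ sym1) /(_ (fun _ _ => 1)) AG.
  apply: alg_ext (AG (fun=> polyfun_cst _ _)) => t.
  by apply: eq_bigr => s _; rewrite mulr1 big1 ?mulr1.
elim: pG => [a|[i k]|F1 F2 _ H1 _ H2|F1 F2 _ H1 _ H2] H sH m pm.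
- apply: alg_ext (alg_scale a (sH m pm)) => t.
  by rewrite mulr_sumr; apply: eq_bigr => s _; rewrite mulrA.
- apply: alg_ext (sH (fun j => if j == i then (fun y => c k y * m i y) else m j) _).
    move=> t; apply: eq_bigr => s _; rewrite /= ffunE.
    rewrite (bigD1 i) //= eqxx [in RHS](bigD1 i) //=.
    rewrite (eq_bigr (fun j => m j (Q t (s j)))) => [|j /negPf -> //]; ring.
  move=> j; case: ifP => // _; apply: polyfun_mul => //; exact: polyfun_var.
- apply: alg_ext (alg_add (H1 H sH m pm) (H2 H sH m pm)) => t.
  by rewrite -big_split; apply: eq_bigr => s _ /=; rewrite !mulrDl.
- apply: alg_ext (H1 _ (H2 _ sH) m pm) => t.
  by apply: eq_bigr => s _; rewrite !mulrA.
Qed.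

End SymmetricFunctions.
End FunctionAlgebras.

(** * Germs and local charts *)

Section Germs.
Variables (K : numClosedFieldType) (T J : Type) (x : J -> T -> K) (p : T).
Implicit Types (U V : set T) (f g : T -> K).

Definition znear U : Prop :=
  exists G, [/\ polyfun x G, G p != 0 & forall q, G q != 0 -> U q].

(** The set [U] confines the equality to points where the formula has a meaning, such as the domain
    of a chart; elsewhere the coordinates take junk values. *)
Definition germ U f : Prop :=
  exists F G, [/\ polyfun x F, polyfun x G, G p != 0 &
    znear [set q | U q -> f q = F q / G q]].

Lemma znearW U V : (forall q, U q -> V q) -> znear U -> znear V.
Proof. by move=> UV [G [pG Gp GU]]; exists G; split=> // q /GU/UV. Qed.

Lemma znearI U V : znear U -> znear V -> znear (U `&` V).
Proof.
move=> [G [pG Gp GU]] [H [pH Hp HV]]; exists (fun q => G q * H q); split.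
- exact: polyfun_mul.
- by rewrite mulf_neq0.
- by move=> q; rewrite mulf_eq0 negb_or => /andP[/GU ? /HV].
Qed.

Lemma znear_at U : znear U -> U p.
Proof. by move=> [G [_ Gp GU]]; exact: GU. Qed.

Lemma znear_polyfun G : polyfun x G -> G p != 0 -> znear [set q | G q != 0].
Proof. by move=> pG Gp; exists G. Qed.

Lemma znear_all U : (forall q, U q) -> znear U.
Proof.
move=> h; exists (fun=> 1); split=> //; exact: polyfun_cst.
Qed.

Lemma germ_polyfun U f : polyfun x f -> germ U f.
Proof.
move=> pf; exists f, (fun=> 1); split=> //.
  exact: polyfun_cst.
by apply: znear_all => q _; rewrite divr1.
Qed.

Lemma germ_near U V f g : germ U f -> znear [set q | V q -> U q /\ g q = f q] ->
  germ V g.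
Proof.
move=> [F [G [pF pG Gp n]]] n'; exists F, G; split=> //.
apply: znearW (znearI n n') => q /= [h h'] Vq.
by case: (h' Vq) => Uq ->; exact: h.
Qed.

Lemma germ_alg U : fun_alg (germ U).
Proof.
split.
- by move=> c; apply: germ_polyfun; exact: polyfun_cst.
- move=> f g [F [G [pF pG Gp n]]] [F' [G' [pF' pG' Gp' n']]].
  exists (fun q => F q * G' q + F' q * G q), (fun q => G q * G' q); split.
  + by apply: polyfun_add; apply: polyfun_mul.
  + exact: polyfun_mul.
  + by rewrite mulf_neq0.
  apply: znearW (znearI (znearI n n') (znearI (znear_polyfun pG Gp)
      (znear_polyfun pG' Gp'))).
  by move=> q [[/= h h'] [G0 G0']] Uq; rewrite h // h' // addf_div.
- move=> f g [F [G [pF pG Gp n]]] [F' [G' [pF' pG' Gp' n']]].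
  exists (fun q => F q * F' q), (fun q => G q * G' q); split.
  + exact: polyfun_mul.
  + exact: polyfun_mul.
  + by rewrite mulf_neq0.
  apply: znearW (znearI n n') => q [/= h h'] Uq; rewrite h // h' //.
  by rewrite mulf_div.
Qed.

Lemma germ_neq0 U f : U p -> germ U f -> f p != 0 -> znear [set q | U q -> f q != 0].
Proof.
move=> Up [F [G [pF pG Gp n]]] fp.
have Fp : F p != 0.
  by have /= := znear_at n; move=> /(_ Up) e; move: fp; rewrite e mulf_eq0
      negb_or => /andP[].
apply: znearW (znearI n (znearI (znear_polyfun pF Fp) (znear_polyfun pG Gp))).
by move=> q [/= h [F0 G0]] Uq; rewrite h // mulf_neq0 // invr_eq0.
Qed.

Lemma germ_inv U f : U p -> germ U f -> f p != 0 -> germ U (fun q => (f q)^-1).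
Proof.
move=> Up [F [G [pF pG Gp n]]] fp.
have Fp : F p != 0.
  by have /= := znear_at n; move=> /(_ Up) e; move: fp; rewrite e mulf_eq0
      negb_or => /andP[].
exists G, F; split=> //; apply: znearW n => q /= h Uq.
by rewrite h // invf_div.
Qed.

End Germs.

(** * Open sets and regular functions on plane curves, in terms of germs *)

Section PlaneCharts.
Variables (K : numClosedFieldType) (A : set (affine_plane K)).

Definition plane_coord (second : bool) (p : K * K) : K := if second then p.2 else p.1.

Definition curve_coord (second : bool) (a : A) : K := plane_coord second (val a).

Lemma curve_polyfun F : polyfun plane_coord F -> polyfun curve_coord (F \o val).
Proof.
elim=> [c|j|G H _ pG _ pH|G H _ pG _ pH].
- exact: polyfun_cst.
- exact: (polyfun_var curve_coord j).
- exact: polyfun_add pG pH.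
- exact: polyfun_mul pG pH.
Qed.

Lemma polyfun_curve F : polyfun curve_coord F ->
  exists2 F', polyfun plane_coord F' & forall a, F a = F' (val a).
Proof.
elim=> [c|j|G H _ [G' pG eG] _ [H' pH eH]|G H _ [G' pG eG] _ [H' pH eH]].
- by exists (fun=> c) => //; exact: polyfun_cst.
- by exists (plane_coord j) => //; exact: polyfun_var.
- exists (fun p => G' p + H' p); first exact: polyfun_add.
  by move=> a; rewrite eG eH.
- exists (fun p => G' p * H' p); first exact: polyfun_mul.
  by move=> a; rewrite eG eH.
Qed.

Lemma affine_plane_open (V : set (affine_plane K)) : kopen V <->
  forall p, V p -> znear plane_coord p V.
Proof.
split=> [h p /h [[] [G [_ pG Gp GV]]]|h p /h [G [pG Gp GV]]].
  by exists G; split=> // q; apply: GV.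
by exists tt, G; split=> // q _; exact: GV.
Qed.

Lemma curve_open (U : set A) :
  (forall a, U a -> znear curve_coord a U) -> kopen (U : set (subspace A)).
Proof.
(* The union of all basic open sets of the plane whose trace on the curve lies in [U]. *)
move=> h; exists [set p | exists2 G, polyfun plane_coord G &
    G p != 0 /\ forall a : A, G (val a) != 0 -> U a].
  apply/affine_plane_open => p [G pG [Gp GU]]; exists G; split=> // q Gq.
  by exists G.
apply/seteqP; split=> [a /h[G [/polyfun_curve[G' pG' e]]]|a [G pG [Ga]]]; last exact.
by rewrite e => Ga GU; exists G' => //; split=> // a'; rewrite -e; exact: GU.
Qed.

Lemma curve_open_near (U : set A) a : kopen (U : set (subspace A)) -> U a ->
  znear curve_coord a U.
Proof.
move=> [V /affine_plane_open oV ->] Va; have [G [pG Gp GV]] := oV _ Va.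
exists (G \o val); split=> //; first exact: curve_polyfun.
by move=> q; exact: GV.
Qed.

Lemma curve_reg (U : set A) f : kopen (U : set (subspace A)) ->
  (forall a, U a -> germ curve_coord a U f) -> kreg (U : set (subspace A)) f.
Proof.
move=> oU h; split=> // a /h[F [G [/polyfun_curve[F' pF' eF] /polyfun_curve[G'
    pG' eG]]]].
rewrite eG => Ga [H [/polyfun_curve[H' pH' eH]]]; rewrite eH => Ha e.
pose V : set (affine_plane K) := [set p | H' p * G' p != 0].
have oV : kopen V.
  apply/affine_plane_open => p Vp; exists (fun p => H' p * G' p).
  by split=> //; exact: polyfun_mul.
exists V, (fun p => F' p / G' p); split=> //.
- by rewrite /V /= mulf_neq0.
- split; first exact: oV.
  move=> p; rewrite /V /= mulf_eq0 negb_or => /andP[_ Gp].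
  by exists tt, F', G'; split.
- move=> q Uq; rewrite /V /= mulf_eq0 negb_or => /andP[Hq _].
  by rewrite -eF -eG; apply: e => //; rewrite eH.
Qed.

Lemma curve_reg_at (U : set A) f a : kreg (U : set (subspace A)) f -> U a ->
  germ curve_coord a U f.
Proof.
move=> [_ h] /h[V [g [/affine_plane_open oV Va [_ rg] e]]].
have [H [pH Ha HV]] := oV _ Va.
have [[] [F [G [_ pF pG Ga eg]]]] := rg _ Va.
exists (F \o val), (G \o val); split=> //; try exact: curve_polyfun.
exists (fun q => H (val q) * G (val q)); split.
- by apply: polyfun_mul; [exact: (curve_polyfun pH)|exact: (curve_polyfun pG)].
- by rewrite mulf_neq0.
- move=> q; rewrite mulf_eq0 negb_or => /andP[/HV Hq Gq] Uq.
  by rewrite e //=; apply: eg.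
Qed.

End PlaneCharts.

(** * Open sets and regular functions on the symmetric power *)

Section SymmetricProduct.
Variables (K : numClosedFieldType) (g2 g3 : K) (n : nat).
Local Notation E := (E g2 g3).
Local Notation SymE := (SymE g2 g3 n).
Local Notation tuples := {ffun 'I_n -> E}.
Implicit Types (P Q : tuples) (c k : 'I_3).

Definition pact (s : 'S_n) P : tuples := [ffun i => P (s i)].

Definition invariant_set (S : set tuples) : Prop := forall s P, S P -> S (pact s P).

Lemma pactM s t P : pact s (pact t P) = pact (s * t)%g P.
Proof. by apply/ffunP => i; rewrite !ffunE permM. Qed.

Lemma pact1 P : pact 1 P = P.
Proof. by apply/ffunP => i; rewrite ffunE perm1. Qed.

Lemma pi_pact s P : \pi_(sympow n E) (pact s P) = \pi P.
Proof.
by apply/eqP; rewrite eq_sym piE; apply/existsP; exists s.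
Qed.

Lemma pi_eq P Q : \pi_(sympow n E) P = \pi Q -> exists s, Q = pact s P.
Proof. by move/eqP; rewrite piE => /existsP[s /eqP ->]; exists s. Qed.

Lemma repr_pi P : exists s, repr (\pi_(sympow n E) P) = pact s P.
Proof. by apply: pi_eq; rewrite reprK. Qed.

Definition ecoord c k (e : E) : K := hcoord (val e) k / hcoord (val e) c.

(** The same chart of the plane is used for every factor: the domain [ndom c] is then stable under
    permutations, as averaging requires. *)
Definition ncoord c (ik : 'I_n * 'I_3) P : K := ecoord c ik.2 (P ik.1).

Definition ndom c : set tuples := [set P | forall i, hcoord (val (P i)) c != 0].

Lemma ndom_pact c s P : ndom c P -> ndom c (pact s P).
Proof. by move=> d i; rewrite ffunE. Qed.

Lemma ecoord_inj c (e e' : E) : hcoord (val e) c != 0 -> hcoord (val e') c != 0 ->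
  (forall k, ecoord c k e = ecoord c k e') -> e = e'.
Proof.
move=> c0 c0' h; apply: val_inj; move: c0 c0' h; rewrite /ecoord.
move: (val e) (val e') => {}e {}e' c0 c0' h.
have {}h k : hcoord e k * hcoord e' c = hcoord e' k * hcoord e c.
  by have /eqP := h k; rewrite eqr_div // => /eqP.
have h0 := h ord0; have h1 := h (inord 1); have h2 := h ord_max.
move: h0 h1 h2; rewrite /hcoord.
case: e e' c0 c0' {h} => [[a b]|] [[a' b']|] //= c0 c0'.
- rewrite inordK //= !mul1r => ha hb hc; move: ha hb.
  by rewrite -hc => /(mulIf c0') -> /(mulIf c0') ->.
- by move=> _ _ /eqP; rewrite mul1r mul0r (negPf c0').
- by move=> _ _ /eqP; rewrite mul1r mul0r eq_sym (negPf c0).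
Qed.

Lemma separator c P Q : ndom c P -> ndom c Q -> Q != P ->
  exists e, [/\ polyfun (ncoord c) e, e P = 1 & e Q = 0].
Proof.
move=> dP dQ QP.
have [i iPQ] : exists i, P i != Q i.
  apply: contrapT => h; move/negP: QP; apply; apply/eqP/ffunP => i.
  by apply/eqP; apply: contrapT => /negP; rewrite eq_sym => ?; apply: h; exists i.
have [k kPQ] : exists k, ncoord c (i, k) P != ncoord c (i, k) Q.
  apply: contrapT => h; move/negP: iPQ; apply; apply/eqP.
  apply: (ecoord_inj (dP i) (dQ i)) => k; apply/eqP; apply: contrapT => /negP ?.
  by apply: h; exists k.
exists (fun R => (ncoord c (i, k) R - ncoord c (i, k) Q) *
  (ncoord c (i, k) P - ncoord c (i, k) Q)^-1); split.
- apply: polyfun_mul; last exact: polyfun_cst.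
  by apply: polyfun_add; [exact: polyfun_var|exact: polyfun_cst].
- by rewrite divff // subr_eq0.
- by rewrite subrr mul0r.
Qed.

Lemma orbit_separator c P : ndom c P -> exists e, [/\ polyfun (ncoord c) e, e P = 1 &
  forall s, pact s P != P -> e (pact s P) = 0].
Proof.
move=> dP.
have h s : exists e, [/\ polyfun (ncoord c) e, e P = 1 &
    pact s P != P -> e (pact s P) = 0].
  have [->|sP] := eqVneq (pact s P) P.
    by exists (fun=> 1); split=> //; exact: polyfun_cst.
  have [e [pe e1 e0]] := separator dP (ndom_pact s dP) sP.
  by exists e.
have [e he] := choice h.
exists (fun Q => \prod_s e s Q); split.
- by apply: (alg_prod (polyfun_alg _)) => s _; case: (he s).
- by rewrite big1 // => s _; case: (he s).
- move=> s sP; rewrite (bigD1 s) //=; case: (he s) => _ _ ->//.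
  by rewrite mul0r.
Qed.

Definition symm (G : tuples -> K) P : K := \sum_s G (pact s P).

(** Only the permutations that fix P contribute, each by G P, and their number is nonzero in
    characteristic zero. *)
Lemma symm_localized c P (G e : tuples -> K) : e P = 1 ->
  (forall s, pact s P != P -> e (pact s P) = 0) -> G P != 0 ->
  symm (fun Q => e Q * G Q) P != 0.
Proof.
move=> e1 e0 GP; rewrite /symm.
rewrite (bigID (fun s => pact s P == P)) /= [X in _ + X]big1; last first.
  by move=> s /e0 ->; rewrite mul0r.
rewrite addr0 (eq_bigr (fun=> G P)); last by move=> s /eqP ->; rewrite e1 mul1r.
rewrite sumr_const -mulr_natr mulf_neq0 // pnatr_eq0 -lt0n.
by apply/card_gt0P; exists 1%g; apply/eqP; rewrite pact1.
Qed.

(** The orbit separator keeps the average from cancelling at P. Where the average is nonzero some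
    permuted tuple lies in [U], hence so does the tuple itself. *)
Lemma symm_near c (U : set tuples) P : invariant_set U -> ndom c P ->
  znear (ncoord c) P [set Q | ndom c Q -> U Q] ->
  exists G, [/\ polyfun (ncoord c) G, symm G P != 0 &
    forall Q, ndom c Q -> symm G Q != 0 -> U Q].
Proof.
move=> iU dP [G [pG GP GU]]; have [e [pe e1 e0]] := orbit_separator dP.
exists (fun Q => e Q * G Q); split; first exact: polyfun_mul.
  exact: (symm_localized c e1 e0).
move=> Q dQ; apply: contraNP => nU; rewrite /symm big1 // => s _.
have [->|Gs] := eqVneq (G (pact s Q)) 0; first by rewrite mulr0.
case: nU; rewrite -[Q]pact1 -(mulVg s) -pactM; apply: iU.
by apply: GU => //; exact: ndom_pact.
Qed.

(* The factor H * G, with H the function that witnesses the germ, makes the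
   identity f G = F hold on all of U, also where the denominator vanishes. *)
Lemma symm_germ c (U : set tuples) (f : tuples -> K) P : invariant_set U ->
  (forall s Q, U Q -> f (pact s Q) = f Q) -> ndom c P ->
  germ (ncoord c) P [set Q | ndom c Q /\ U Q] f ->
  exists F G, [/\ polyfun (ncoord c) F, polyfun (ncoord c) G, symm G P != 0 &
    forall Q, ndom c Q -> U Q -> f Q * symm G Q = symm F Q].
Proof.
move=> iU inf dP [F [G [pF pG GP [H [pH HP HU]]]]].
have [e [pe e1 e0]] := orbit_separator dP.
pose M Q := G Q * (H Q * G Q).
exists (fun Q => e Q * (F Q * (H Q * G Q))), (fun Q => e Q * M Q); split.
- by do !apply: polyfun_mul.
- by do !apply: polyfun_mul.
- by apply: (symm_localized c e1 e0); rewrite /M !mulf_neq0.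
move=> Q dQ UQ; rewrite /symm mulr_sumr; apply: eq_bigr => s _.
rewrite -(inf s Q UQ) /M mulrCA; congr (_ * _).
have [->|HG] := eqVneq (H (pact s Q) * G (pact s Q)) 0; first by rewrite !mulr0.
move: (HG); rewrite mulf_eq0 negb_or => /andP[H0 G0].
rewrite (HU _ H0) /=; first by rewrite -mulrA mulKf.
by split; [exact: ndom_pact|exact: iU].
Qed.

Lemma chart_var c (sigma : 'I_n -> 'I_3) (ik : 'I_n * 'I_3) Q : ndom c Q ->
  hcoord (val (Q ik.1)) ik.2 / hcoord (val (Q ik.1)) (sigma ik.1) =
  ncoord c ik Q * (ncoord c (ik.1, sigma ik.1) Q)^-1.
Proof.
by move=> dQ; rewrite /ncoord /ecoord /= invf_div mulrA divfK //; exact: dQ.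
Qed.

Section ChartChange.
Variables (c : 'I_3) (sigma : 'I_n -> 'I_3) (P : tuples).
Hypotheses (dP : ndom c P) (sP : forall i, hcoord (val (P i)) (sigma i) != 0).

(** On the overlap a coordinate of the chart [sigma] is a quotient of two coordinates of the chart
    [c]. *)
Lemma chart_germ F :
  polyfun (fun (ik : 'I_n * 'I_3) (P : tuples) =>
    hcoord (val (P ik.1)) ik.2 / hcoord (val (P ik.1)) (sigma ik.1)) F ->
  germ (ncoord c) P (ndom c) F.
Proof.
apply: (alg_comp (germ_alg _ _ _) (b := id)) => ik.
apply: (@germ_near _ _ _ _ _ (ndom c) _ (fun Q => ncoord c ik Q * (ncoord c
    (ik.1, sigma ik.1) Q)^-1)).
  apply: (alg_mul (germ_alg _ _ _)); first by apply/germ_polyfun/polyfun_var.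
  apply: germ_inv => //; first by apply/germ_polyfun/polyfun_var.
  by rewrite /ncoord /ecoord mulf_neq0 ?invr_eq0.
by apply: znear_all => Q dQ; split=> //; exact: chart_var.
Qed.

Lemma chart_near : znear (ncoord c) P
  [set Q | ndom c Q -> forall i, hcoord (val (Q i)) (sigma i) != 0].
Proof.
exists (fun Q => \prod_i ncoord c (i, sigma i) Q); split.
- by apply: (alg_prod (polyfun_alg _)) => i _; exact: polyfun_var.
- by apply/prodf_neq0 => i _; rewrite /ncoord /ecoord mulf_neq0 ?invr_eq0.
- move=> Q /prodf_neq0 h dQ i; have := h i isT.
  by rewrite /ncoord /ecoord mulf_eq0 negb_or => /andP[].
Qed.
End ChartChange.

Lemma En_open_near c (U : set tuples) P : kopen (U : set (En g2 g3 n)) -> U P ->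
  ndom c P -> znear (ncoord c) P [set Q | ndom c Q -> U Q].
Proof.
move=> oU UP dP; have [sigma [G [sP pG GP GU]]] := oU _ UP.
have gG := chart_germ dP sP pG.
apply: znearW (znearI (germ_neq0 dP gG GP) (chart_near dP sP)) => Q [/= h1 h2] dQ.
by apply: GU; [exact: h2|exact: h1].
Qed.

Lemma En_reg_germ c (U : set tuples) f P : kreg (U : set (En g2 g3 n)) f -> U P ->
  ndom c P -> germ (ncoord c) P [set Q | ndom c Q /\ U Q] f.
Proof.
move=> [_ rU] UP dP; have [sigma [F [G [sP pF pG GP GU]]]] := rU _ UP.
have gG := chart_germ dP sP pG.
apply: (@germ_near _ _ _ _ _ (ndom c) _ (fun Q => F Q * (G Q)^-1)).
  apply: (alg_mul (germ_alg _ _ _)); first exact: chart_germ pF.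
  exact: germ_inv.
apply: znearW (znearI (germ_neq0 dP gG GP) (chart_near dP sP)) => Q [/= h1 h2] [dQ UQ].
by split=> //; apply: GU => //; [exact: h2|exact: h1].
Qed.

Lemma SymE_open c (S : set tuples) : invariant_set S -> (forall P, S P -> ndom c P) ->
  (forall P, S P -> znear (ncoord c) P [set Q | ndom c Q -> S Q]) ->
  kopen ([set q | S (repr q)] : set SymE).
Proof.
move=> iS dS nS P /= SP.
have {}SP : S P.
  have [s e] := repr_pi P; rewrite e in SP.
  by rewrite -[P]pact1 -(mulVg s) -pactM; exact: iS.
have [G [pG GP GS]] := nS P SP.
exists (fun=> c), G; split=> //; first exact: dS.
move=> Q dQ GQ /=; have [s ->] := repr_pi Q; apply: iS.
exact: GS.
Qed.

Lemma SymE_open_bigcup I (W : I -> set SymE) (D : set I) :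
  (forall i, D i -> kopen (W i)) -> kopen (\bigcup_(i in D) W i).
Proof.
move=> oW P [i Di Wi]; have [sigma [G [sP pG GP GU]]] := oW i Di P Wi.
by exists sigma, G; split=> // Q dQ GQ; exists i => //; exact: GU.
Qed.

Lemma SymE_reg c (W : set SymE) (g : SymE -> K) : kopen W ->
  (forall q, W q -> ndom c (repr q)) ->
  (forall P, W (\pi P) -> germ (ncoord c) P (ndom c) (fun P => g (\pi P))) ->
  kreg W g.
Proof.
move=> oW dW gW; split=> // P WP.
have [F [G [pF pG GP [H [pH HP HG]]]]] := gW _ WP.
have dP : ndom c P.
  have := dW _ WP; have [s ->] := repr_pi P => d.
  by rewrite -[P]pact1 -(mulVg s) -pactM; exact: ndom_pact.
exists (fun=> c), (fun Q => F Q * H Q), (fun Q => G Q * H Q); split.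
- exact: dP.
- exact: polyfun_mul.
- exact: polyfun_mul.
- by rewrite mulf_neq0.
move=> Q dQ WQ; rewrite mulf_eq0 negb_or => /andP[GQ HQ] /=.
by rewrite (HG Q HQ) // -mulf_div divff // mulr1.
Qed.

(** * Families of tuples with regular symmetric sums *)

Section Parametrization.
Variables (T J : Type) (x : J -> T -> K) (p : T) (D : set T) (c : 'I_3).
Variable Pt : T -> tuples.
Hypotheses (Dp : D p) (dPt : forall t, D t -> ndom c (Pt t)).
Hypothesis gPt : forall m, polyfun (ecoord c) m ->
  germ x p D (fun t => \sum_i m (Pt t i)).

Lemma symm_param G : polyfun (ncoord c) G -> germ x p D (fun t => symm G (Pt t)).
Proof. exact: (alg_symmetrize (germ_alg _ _ _) gPt). Qed.

(** A neighbourhood in Sym^n E can be cut out by a symmetrised polynomial, which pulls back to a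
    germ although the single entries of [Pt] need not be regular. *)
Lemma param_open (V : set SymE) : kopen V -> V (\pi_(sympow n E) (Pt p)) ->
  znear x p [set t | D t -> V (\pi_(sympow n E) (Pt t))].
Proof.
move=> oV Vp.
have iV : invariant_set (\pi_(sympow n E) @^-1` V).
  by move=> s P /=; rewrite pi_pact.
have [G [pG Gp GV]] := symm_near iV (dPt Dp) (En_open_near oV Vp (dPt Dp)).
apply: znearW (germ_neq0 Dp (symm_param pG) Gp) => t /= h Dt.
by apply: GV; [exact: dPt|exact: h].
Qed.

Lemma param_reg (V : set SymE) f : kreg V f -> V (\pi_(sympow n E) (Pt p)) ->
  germ x p [set t | D t /\ V (\pi_(sympow n E) (Pt t))] (fun t => f (\pi_(sympow
      n E) (Pt t))).
Proof.
move=> rV Vp.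
have iV : invariant_set (\pi_(sympow n E) @^-1` V).
  by move=> s P /=; rewrite pi_pact.
have inf s Q : (\pi_(sympow n E) @^-1` V) Q ->
    (f \o \pi_(sympow n E)) (pact s Q) = (f \o \pi_(sympow n E)) Q.
  by move=> _ /=; rewrite pi_pact.
have [F [G [pF pG Gp GV]]] := symm_germ iV inf (dPt Dp) (En_reg_germ rV Vp (dPt Dp)).
have gG := symm_param pG.
apply: (@germ_near _ _ _ _ _ D _ (fun t => symm F (Pt t) * (symm G (Pt t))^-1)).
  apply: (alg_mul (germ_alg _ _ _)); first exact: symm_param.
  exact: germ_inv.
apply: znearW (germ_neq0 Dp gG Gp) => t /= h [Dt Vt]; split=> //.
by rewrite -(GV (Pt t)) ?mulfK //; [exact: h|exact: dPt].
Qed.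
End Parametrization.

(** * Open sets and functions on the symmetric power from invariant coordinates *)

Section Coordinates.
Variables (c : 'I_3) (S : set tuples) (b : tuples -> K * K).
Hypotheses (iS : invariant_set S) (dS : forall P, S P -> ndom c P).
Hypothesis nS : forall P, S P -> znear (ncoord c) P [set Q | ndom c Q -> S Q].
Hypothesis ib : forall s P, S P -> b (pact s P) = b P.
Hypothesis gb : forall P j, S P ->
  germ (ncoord c) P (ndom c) (fun Q => plane_coord j (b Q)).

Lemma coord_open G : polyfun (@plane_coord K) G ->
  kopen ([set q | S (repr q) /\ G (b (repr q)) != 0] : set SymE).
Proof.
move=> pG; apply: (@SymE_open c [set P | S P /\ G (b P) != 0]).
- by move=> s P [SP GP]; split; [exact: iS|rewrite ib].
- by move=> P [/dS].
- move=> P [SP GP].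
  have gG : germ (ncoord c) P (ndom c) (fun Q => G (b Q)).
    by apply: (alg_comp (germ_alg _ _ _)) pG => j; exact: gb.
  apply: znearW (znearI (nS SP) (germ_neq0 (dS SP) gG GP)) => Q [/= h1 h2] dQ.
  by split; [exact: h1|exact: h2].
Qed.

Lemma coord_reg F G : polyfun (@plane_coord K) F -> polyfun (@plane_coord K) G ->
  kreg ([set q | S (repr q) /\ G (b (repr q)) != 0] : set SymE)
    (fun q => F (b (repr q)) / G (b (repr q))).
Proof.
move=> pF pG; apply: (@SymE_reg c).
- exact: coord_open.
- by move=> q [/dS].
move=> P [SP GP].
have {}SP : S P.
  have [s e] := repr_pi P; rewrite e in SP.
  by rewrite -[P]pact1 -(mulVg s) -pactM; exact: iS.
have [s e] := repr_pi P; rewrite e ib // in GP.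
have dP := dS SP.
have gH H : polyfun (@plane_coord K) H -> germ (ncoord c) P (ndom c) (fun Q => H (b Q)).
  by apply: (alg_comp (germ_alg _ _ _)) => j; exact: gb.
apply: (@germ_near _ _ _ _ _ (ndom c) _ (fun Q => F (b Q) * (G (b Q))^-1)).
  apply: (alg_mul (germ_alg _ _ _)); first exact: gH.
  by apply: germ_inv => //; exact: gH.
apply: znearW (nS SP) => Q /= h dQ; split=> //.
by have [s' ->] := repr_pi Q; rewrite ib //; exact: h.
Qed.
End Coordinates.

End SymmetricProduct.

(** * The coefficients s_k and the curve near infinity *)

Lemma poly_ext (K : numFieldType) (p q : {poly K}) :
  (forall a, p.[a] = q.[a]) -> p = q.
Proof.
move=> e; apply/eqP; rewrite -subr_eq0; apply: contraT => /exists_nonroot[a].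
by rewrite hornerD hornerN e subrr eqxx.
Qed.

Section LameCoefficients.
Variables (K : numClosedFieldType) (n : nat).
Hypothesis n_gt0 : (0 < n)%N.
Implicit Types (u B : K) (k : nat).

Lemma s_triple (g2 g3 : K) k : let t := lame_triple g2 g3 n k in
  [/\ s_ g2 g3 n k%:Z = t.1.1, s_ g2 g3 n (k%:Z - 1) = t.1.2 &
      s_ g2 g3 n (k%:Z - 2) = t.2].
Proof.
split=> //.
- case: k => [|k] //; rewrite subzn // subn1 /=.
  by case: (lame_triple _ _ _ k) => -[].
- case: k => [|[|k]] //; rewrite subzn // !subSS subn0 /=.
  by case: (lame_triple _ _ _ k) => -[].
Qed.

(** With B, g2, g3 of weights 1, 2, 3 the recursion makes s_k homogeneous of weight k. The factors u
    and u^2 on the left stand for the exponents k - 1 and k - 2, which would be negative for small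
    k. *)
Lemma triple_scale (g2 g3 : K) u B k :
  let t := lame_triple g2 g3 n k in
  let t' := lame_triple (g2 * u ^+ 2) (g3 * u ^+ 3) n k in
  [/\ t'.1.1.[u * B] = u ^+ k * t.1.1.[B],
      t'.1.2.[u * B] * u = u ^+ k * t.1.2.[B] &
      t'.2.[u * B] * u ^+ 2 = u ^+ k * t.2.[B]].
Proof.
elim: k => [|k] /=.
  by rewrite !hornerC !mulr0 !mul0r expr0 mul1r; split.
case: (lame_triple g2 g3 n k) => -[a b] c.
case: (lame_triple _ _ n k) => -[a' b'] c' /= [ea eb ec]; split.
- rewrite /lame_step !(hornerZ, hornerD, hornerN, hornerM, hornerX) ea.
  set X := (2 * _ * _ * _)^-1; rewrite [u ^+ k.+1]exprS.
  transitivity (X * ((4 * ((n - k.+1)%:R + 1) * (u * B * (u ^+ k * a.[B]))) -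
    2^-1 * g2 * ((n - k.+1)%:R + 1) * ((n - k.+1)%:R + 2) * (2 * (n - k.+1)%:R +
        3) * u * (b'.[u * B] * u) +
    g3 * ((n - k.+1)%:R + 1) * ((n - k.+1)%:R + 2) * ((n - k.+1)%:R + 3) * u *
        (c'.[u * B] * u ^+ 2))).
    ring.
  rewrite eb ec; ring.
- by rewrite ea exprS; ring.
- by rewrite expr2 mulrA eb exprS; ring.
Qed.

Lemma s_scale (g2 g3 : K) u B (j : int) :
  (s_ (g2 * u ^+ 2) (g3 * u ^+ 3) n j).[u * B] = u ^+ `|j|%N * (s_ g2 g3 n j).[B].
Proof.
case: j => k /=; last by rewrite !horner0 mulr0.
by have [] := triple_scale g2 g3 u B k.
Qed.

Lemma step_const_gt0 k : (k < n)%N ->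
  let mu : K := (n - k.+1)%:R in
  (2 * k.+1%:R * (2 * mu + 1) * (n%:R + mu + 1))^-1 * (4 * (mu + 1)) != 0.
Proof.
move=> kn /=; move: (n - k.+1)%:R (ler0n K (n - k.+1)) => mu mu0.
rewrite mulf_neq0 // ?invr_eq0 !mulf_neq0 // ?pnatr_eq0 // gt_eqF //.
- by rewrite ltr_wpDl // mulr_ge0.
- by rewrite ltr_wpDl // addr_ge0.
- by rewrite ltr_wpDl.
Qed.

Lemma triple_size (g2 g3 : K) k : let t := lame_triple g2 g3 n k in
  [/\ (size t.1.1 <= k.+1)%N, (size t.1.2 <= k)%N & (size t.2 <= k.-1)%N].
Proof.
elim: k => [|k] /=; first by rewrite size_polyC size_poly0 oner_eq0.
case: (lame_triple g2 g3 n k) => -[a b] c /= [sa sb sc]; split=> //.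
rewrite /lame_step (leq_trans (size_scale_leq _ _)) //.
rewrite (leq_trans (size_polyD _ _)) // geq_max; apply/andP; split; last first.
  by rewrite (leq_trans (size_scale_leq _ _)) // (leq_trans sc) //; lia.
rewrite (leq_trans (size_polyD _ _)) // geq_max size_polyN; apply/andP; split;
    last first.
  by rewrite (leq_trans (size_scale_leq _ _)) // (leq_trans sb) //; lia.
rewrite (leq_trans (size_scale_leq _ _)) // (leq_trans (size_polyMleq _ _)) //.
by rewrite size_polyX.
Qed.

(** Only the term B s_(k-1) of the recursion reaches degree k in B. *)
Lemma triple_lead (g2 g3 : K) k : (k <= n)%N -> (lame_triple g2 g3 n k).1.1`_k != 0.
Proof.
elim: k => [|k IH] kn /=; first by rewrite coefC oner_neq0.
have := IH (ltnW kn); have [] := triple_size g2 g3 k.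
case: (lame_triple g2 g3 n k) => -[a b] c /= sa sb sc a0.
rewrite /lame_step coefZ coefD coefB !coefZ coefXM /=.
rewrite [b`__]nth_default ?(leq_trans sb) //.
rewrite [c`__]nth_default; last by rewrite (leq_trans sc) //; lia.
by rewrite !mulr0 subr0 addr0 mulrA mulf_neq0 // step_const_gt0.
Qed.

(** For g2 = g3 = 0 the recursion has a single term, so s_k(1) is a product of nonzero constants. *)
Lemma triple00_neq0 k : (k <= n)%N -> (lame_triple (0 : K) 0 n k).1.1.[1] != 0.
Proof.
elim: k => [|k IH] kn /=; first by rewrite hornerC oner_neq0.
have := IH (ltnW kn).
case: (lame_triple 0 0 n k) => -[a b] c /= a0.
rewrite /lame_step !(hornerZ, hornerD, hornerN, hornerM, hornerX) !(mulr0, mul0r)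
    subr0 addr0.
by rewrite mul1r mulrA mulf_neq0 // step_const_gt0.
Qed.

Lemma ell_lead (g2 g3 : K) :
  size (ell g2 g3 n) = (2 * n).+2 /\ lead_coef (ell g2 g3 n) != 0.
Proof.
suff sz : size (ell g2 g3 n) = (2 * n).+2.
  by split=> //; rewrite lead_coef_eq0 -size_poly_eq0 sz.
have := triple_lead g2 g3 (leqnn n); have := triple_size g2 g3 n.
rewrite /ell subr0; case: (s_triple g2 g3 n) => -> -> ->.
case: (lame_triple g2 g3 n n) => -[a b] c [/= sa sb sc] an.
have sa' : size a = n.+1.
  apply/eqP; rewrite eqn_leq sa ltnNge; apply: contra an => h.
  by rewrite nth_default.
have a0 : a != 0 by rewrite -size_poly_eq0 sa'.
have saa : size (4 *: ('X * a ^+ 2)) = (2 * n).+2.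
  rewrite size_scale ?pnatr_eq0 // mulrC size_mulX ?expf_neq0 //.
  by rewrite expr2 size_mul // sa'; lia.
rewrite -!addrA size_polyDl ?saa // ltnS.
rewrite (leq_trans (size_polyD _ _)) // geq_max; apply/andP; split.
  rewrite (leq_trans (size_scale_leq _ _)) // (leq_trans (size_polyMleq _ _)) //.
  by move: sb sc sa'; move: (size a) (size b) (size c) => *; lia.
rewrite (leq_trans (size_polyD _ _)) // geq_max !size_polyN; apply/andP; split.
  rewrite (leq_trans (size_scale_leq _ _)) // (leq_trans (size_polyMleq _ _)) //.
  by move: sb sc sa'; move: (size a) (size b) (size c) => *; lia.
rewrite (leq_trans (size_scale_leq _ _)) // expr2 (leq_trans (size_polyMleq _ _)) //.
by move: sb sc sa'; move: (size a) (size b) (size c) => *; lia.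
Qed.

Lemma ell_neq0 (g2 g3 : K) : ell g2 g3 n != 0.
Proof. by rewrite -size_poly_eq0; case: (ell_lead g2 g3) => ->. Qed.

Lemma ell_rev0_neq0 (g2 g3 : K) : (ell_rev g2 g3 n).[0] != 0.
Proof.
rewrite horner_coef0 coef_poly /= subn0.
by case: (ell_lead g2 g3) => s; rewrite lead_coefE s.
Qed.

Lemma ell_revE (g2 g3 : K) u : u != 0 ->
  (ell_rev g2 g3 n).[u] = u ^+ (2 * n).+1 * (ell g2 g3 n).[u^-1].
Proof.
move=> u0; rewrite horner_poly horner_coef (ell_lead g2 g3).1 mulr_sumr.
rewrite (reindex_inj rev_ord_inj) /=; apply: eq_bigr => i _.
have ile : (i <= (2 * n).+1)%N by rewrite -ltnS.
have -> : ((2 * n).+2 - i.+1 = (2 * n).+1 - i)%N by lia.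
rewrite subKn // mulrCA; congr (_ * _); rewrite exprVn.
move: (2 * n).+1 (nat_of_ord i) ile => m j jm.
by rewrite -{2}(subnK jm) exprD mulfK // expf_neq0.
Qed.

Lemma curve_inf_fin (g2 g3 : K) u v : u != 0 -> v ^+ 2 = u * (ell_rev g2 g3 n).[u] ->
  (v / u ^+ n.+1) ^+ 2 = (ell g2 g3 n).[u^-1].
Proof.
move=> u0 e; rewrite expr_div_n e ell_revE // mulrA -exprS -exprM.
have -> : (n.+1 * 2 = (2 * n).+2)%N by lia.
by rewrite mulrAC divff ?mul1r // expf_neq0.
Qed.

(** By homogeneity this is u^n f_(1/u)(X/u) when u != 0; it remains a monic polynomial of degree n
    at u = 0, where the cubic degenerates to 4 X^3. *)
Definition lame_hat (g2 g3 : K) u : {poly K} := lame_poly (g2 * u ^+ 2) (g3 * u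
    ^+ 3) n 1.

Lemma lame_hat_scale (g2 g3 : K) u (x : 'I_n -> K) : u != 0 ->
  prodX x = lame_poly g2 g3 n u^-1 ->
  prodX (fun i => u * x i) = lame_hat g2 g3 u.
Proof.
move=> u0 fx; apply: poly_ext => b; rewrite -[b](mulVKf u0); set a := _ * b.
transitivity (u ^+ n * (prodX x).[a]).
  rewrite /prodX !horner_prod -[X in _ ^+ X]card_ord -prodr_const -big_split /=.
  by apply: eq_bigr => i _; rewrite !hornerXsubC mulrBr.
rewrite fx /lame_hat !horner_poly mulr_sumr; apply: eq_bigr => k _.
have := s_scale g2 g3 u u^-1 (n%:Z - k%:Z); rewrite divff // => ->.
have kn : (k <= n)%N by rewrite -ltnS.
have -> : `|n%:Z - k%:Z|%N = (n - k)%N by rewrite subzn.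
have -> : u ^+ n = u ^+ (n - k) * u ^+ k by rewrite -exprD subnK.
by rewrite [(u * a) ^+ k]exprMn; ring.
Qed.

Lemma lame_hat_closed (T : Type) (A : (T -> K) -> Prop) (u : T -> K) (g2 g3 : K)
    : fun_alg A ->
  A u -> forall k, A (fun t => (lame_hat g2 g3 (u t))`_k).
Proof.
move=> algA Au k.
suff H j : let tr t := lame_triple (g2 * u t ^+ 2) (g3 * u t ^+ 3) n j in
    [/\ A (fun t => (tr t).1.1.[1]), A (fun t => (tr t).1.2.[1]) & A (fun t =>
        (tr t).2.[1])].
  apply: (alg_ext (f := fun t => (-1) ^+ (n + k) *
     (s_ (g2 * u t ^+ 2) (g3 * u t ^+ 3) n (n%:Z - k%:Z)).[1])).
    by move=> t; rewrite lame_poly_coef.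
  apply: alg_scale => //; case: (n%:Z - k%:Z) => j /=; first by case: (H j).
  by apply: alg_ext (alg_cst algA 0) => t; rewrite horner0.
elim: j => [|j IH] /=.
  by split; apply: (alg_ext _ (alg_cst algA _)) => t; rewrite hornerC.
have e t : lame_triple (g2 * u t ^+ 2) (g3 * u t ^+ 3) n j.+1 =
    (lame_step (g2 * u t ^+ 2) (g3 * u t ^+ 3) n j.+1
       (lame_triple (g2 * u t ^+ 2) (g3 * u t ^+ 3) n j).1.1
       (lame_triple (g2 * u t ^+ 2) (g3 * u t ^+ 3) n j).1.2
       (lame_triple (g2 * u t ^+ 2) (g3 * u t ^+ 3) n j).2,
     (lame_triple (g2 * u t ^+ 2) (g3 * u t ^+ 3) n j).1.1,
     (lame_triple (g2 * u t ^+ 2) (g3 * u t ^+ 3) n j).1.2).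
  by rewrite /=; case: (lame_triple _ _ _ j) => -[].
case: IH => Aa Ab Ac; split.
- pose m : K := (n - j.+1)%:R.
  apply: (alg_ext (f := fun t => (2 * j.+1%:R * (2 * m + 1) * (n%:R + m + 1))^-1 *
    ((4 * (m + 1)) * (lame_triple (g2 * u t ^+ 2) (g3 * u t ^+ 3) n j).1.1.[1]
     - (2^-1 * g2 * (m + 1) * (m + 2) * (2 * m + 3)) * (u t ^+ 2 *
         (lame_triple (g2 * u t ^+ 2) (g3 * u t ^+ 3) n j).1.2.[1])
     + (g3 * (m + 1) * (m + 2) * (m + 3)) * (u t ^+ 3 *
         (lame_triple (g2 * u t ^+ 2) (g3 * u t ^+ 3) n j).2.[1])))).
    move=> t; have /= -> := e t; rewrite /= /lame_step -/m.
    rewrite !(hornerZ, hornerD, hornerN, hornerM, hornerX) mul1r; congr (_ * _).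
    ring.
  apply: alg_scale => //; apply: alg_add => //; first apply: alg_sub => //.
  + exact: alg_scale.
  + by apply: alg_scale => //; apply: alg_mul => //; exact: alg_exp.
  + by apply: alg_scale => //; apply: alg_mul => //; exact: alg_exp.
- by apply: alg_ext Aa => t; have /= -> := e t.
- by apply: alg_ext Ab => t; have /= -> := e t.
Qed.

Lemma lame_poly_closed (T : Type) (A : (T -> K) -> Prop) (B : T -> K) (g2 g3 : K)
    : fun_alg A ->
  A B -> forall k, A (fun t => (lame_poly g2 g3 n (B t))`_k).
Proof.
move=> algA AB k.
apply: (alg_ext (f := fun t => (-1) ^+ (n + k) * (s_ g2 g3 n (n%:Z - k%:Z)).[B t])).
  by move=> t; rewrite lame_poly_coef.
by apply: alg_scale => //; apply: alg_horner.
Qed.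

(* At the point at infinity the cubic degenerates to 4 X^3 and the sum is
   (L / 4) * \sum 1 / (x^2 f'(x)) for the constant L = ell != 0, which Lagrange
   interpolation evaluates to (L / 4) f'(0) / f(0)^2. *)
Lemma kappa0_neq0 (x : 'I_n -> K) : prodX x = lame_poly 0 0 n 1 ->
  \sum_i x i * (prodX x)^`().[x i] != 0.
Proof.
move=> fx; set f := prodX x.
have [s0 s1] := (triple00_neq0 (leqnn n), triple00_neq0 (leq_pred n)).
have f0 : f.[0] != 0.
  rewrite /f fx horner_coef0 lame_poly_coef subr0 mulf_neq0 //.
  by rewrite expf_neq0 // oppr_eq0 oner_neq0.
have f1 : f`_1 != 0.
  rewrite /f fx lame_poly_coef mulf_neq0 //; first by rewrite expf_neq0 //
      oppr_eq0 oner_neq0.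
  by rewrite subzn // subn1.
pose L := (ell (0 : K) 0 n).[1].
have L0 : L != 0.
  rewrite /L /ell subr0 mulr0 !scale0r !subr0 addr0 hornerZ hornerM hornerX mul1r
      horner_exp.
  by rewrite mulf_neq0 ?pnatr_eq0 // expf_neq0.
have int i : 4 * x i ^+ 3 * f^`().[x i] ^+ 2 = L.
  have /(congr1 (fun q : {poly K} => q.[x i])) := lame_poly_integral 0 0 n (1 : K).
  rewrite -fx [in RHS]hornerC -/f -/L => <-.
  rewrite [in RHS]hornerD hornerN [(f * _).[_]]hornerM prodX_root mul0r subr0.
  by rewrite hornerM horner_exp horner_wpoly mul0r !subr0.
have x0 i : x i != 0.
  by apply: contraNneq L0 => e; rewrite -(int i) e expr0n mulr0 mul0r.
have f'0 i : f^`().[x i] != 0.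
  by apply: contraNneq L0 => e; rewrite -(int i) e expr0n mulr0.
have inj : injective x.
  move=> i j xij; apply/eqP; apply: contraT => ij.
  by have := f'0 j; rewrite -cofX_diag -xij cofX_off // eqxx.
pose h : {poly K} := \poly_(k < n.-1) f`_k.+2.
have fE : f = (f`_0)%:P + f`_1 *: 'X + 'X^2 * h.
  apply/polyP => k; rewrite !coefD coefC coefZ coefX coefXnM.
  case: k => [|[|k]] /=; rewrite ?(mulr0, mulr1, addr0, add0r) //.
  rewrite subSS subn1 coef_poly; case: ltnP => // h'.
  by rewrite nth_default // size_prodX; lia.
(* This is f_0^2 times the inverse of X^2 modulo f: at a root x^2 h = -(f_0 + f_1 x), so q x^2 =
   f_1^2 x^2 + (f_0 - f_1 x) (f_0 + f_1 x) = f_0^2. *)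
pose q : {poly K} := (f`_1 ^+ 2)%:P - f`_0 *: h + f`_1 *: ('X * h).
have sq : (size q <= n)%N.
  have sh : (size h <= n.-1)%N by exact: size_poly.
  rewrite (leq_trans (size_polyD _ _)) // geq_max; apply/andP; split; last first.
    rewrite (leq_trans (size_scale_leq _ _)) // (leq_trans (size_polyMleq _ _)) //.
    by rewrite size_polyX /= -(prednK n_gt0) ltnS.
  rewrite (leq_trans (size_polyD _ _)) // geq_max size_polyN; apply/andP; split.
    by rewrite (leq_trans (size_polyC_leq1 _)).
  by rewrite (leq_trans (size_scale_leq _ _)) // (leq_trans sh) ?leq_pred.
have qx i : q.[x i] * x i ^+ 2 = f`_0 ^+ 2.
  have := congr1 (fun r : {poly K} => r.[x i]) fE; rewrite prodX_root.
  rewrite !(hornerD, hornerZ, hornerM, hornerC, hornerX, hornerXn).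
  rewrite /q !(hornerD, hornerN, hornerZ, hornerM, hornerC, hornerX).
  move: (h.[x i]) => b e.
  transitivity (f`_1 ^+ 2 * x i ^+ 2 - (f`_0 - f`_1 * x i) * (x i ^+ 2 * b));
      first by ring.
  have -> : x i ^+ 2 * b = - (f`_0 + f`_1 * x i).
    by apply/eqP; rewrite -subr_eq0 opprK addrC -e.
  by ring.
(* The coefficient is f_1^2 if n = 1, where h = 0, and f_1 otherwise, since h then has leading
   coefficient 1. *)
have qn : q`_n.-1 != 0.
  rewrite /q coefD coefB !coefZ coefC coefXM [h`_n.-1]nth_default ?size_poly //.
  rewrite mulr0 subr0 coef_poly. case: posnP => n1.
    by rewrite mulr0 addr0 expf_neq0.
  rewrite add0r ltn_predL n1 mulf_neq0 //.
  have -> : n.-2.+2 = n by lia.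
  have /monicP := prodX_monic x; rewrite lead_coefE size_prodX /= => ->.
  exact: oner_neq0.
suff -> : \sum_i x i * f^`().[x i] = L / 4 / f`_0 ^+ 2 * q`_n.-1.
  by rewrite !mulf_neq0 // invr_eq0 ?pnatr_eq0 // expf_neq0 // -horner_coef0.
rewrite -(lagrange_coef inj sq) mulr_sumr; apply: eq_bigr => i _.
have f00 : f`_0 ^+ 2 != 0 by rewrite expf_neq0 // -horner_coef0.
rewrite -(qx i) in f00 *; move: (f00); rewrite mulf_eq0 negb_or => /andP[q0 _].
rewrite -(int i) -/f; move: (x0 i) (f'0 i) q0.
move: (x i) (f^`().[x i]) q.[x i] => a b d a0 b0 d0.
by field; rewrite a0 b0 d0.
Qed.
End LameCoefficients.

(** * Tuples of points on E *)

Section LamePoints.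
Variables (K : numClosedFieldType) (g2 g3 : K) (n : nat).
Hypothesis n_gt0 : (0 < n)%N.
Local Notation E := (E g2 g3).
Local Notation SymE := (SymE g2 g3 n).
Local Notation tuples := {ffun 'I_n -> E}.
Local Notation curve_fin := (curve_fin g2 g3 n).
Local Notation curve_inf := (curve_inf g2 g3 n).
Implicit Types (P Q : tuples) (B C u v : K).

Definition cX : 'I_3 := ord0.
Definition cY : 'I_3 := Ordinal (isT : 1 < 3)%N.
Definition cZ : 'I_3 := ord_max.

Lemma wpolyP (e : E) x y : val e = Some (x, y) -> y ^+ 2 = (wpoly g2 g3).[x].
Proof.
move=> ev; have := set_valP e; rewrite /weierstrass /= ev /=.
by rewrite horner_wpoly.
Qed.

Lemma wpoint x y : y ^+ 2 = (wpoly g2 g3).[x] -> exists e : E, val e = Some (x, y).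
Proof.
rewrite horner_wpoly => h; have h' : weierstrass g2 g3 (Some (x, y)) by [].
by exists (SigSub (mem_set h')).
Qed.

Lemma wpoint_inf : exists e : E, val e = None.
Proof.
have h' : weierstrass g2 g3 None by [].
by exists (SigSub (mem_set h')).
Qed.

Definition lame_point P B C : Prop := exists x y : 'I_n -> K,
  (forall i, val (P i) = Some (x i, y i)) /\ lame_tuple g2 g3 B C x y.

Lemma lame_point_exists B C : C ^+ 2 = (ell g2 g3 n).[B] -> exists P, lame_point P B C.
Proof.
move/(lame_tuple_exists n_gt0) => [x [y t]]; have [yy _ _ _] := t.
have [f hf] := choice (fun i => wpoint (yy i)).
by exists [ffun i => f i], x, y; split=> // i; rewrite ffunE.
Qed.

Lemma lame_point_perm P Q B C : lame_point P B C -> lame_point Q B C ->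
  \pi_(sympow n E) P = \pi Q.
Proof.
move=> [x [y [eP t]]] [x' [y' [eQ t']]].
have [s hs] := lame_tuple_perm t t'; suff -> : Q = pact s P by rewrite pi_pact.
apply/ffunP => i; apply: val_inj; rewrite ffunE eQ eP.
by case: (hs i) => -> ->.
Qed.

Lemma lame_point_pact s P B C : lame_point P B C -> lame_point (pact s P) B C.
Proof.
move=> [x [y [eP [yy fx m0 mC]]]].
exists (x \o s), (y \o s); split; first by move=> i; rewrite ffunE eP.
split.
- by move=> i; exact: yy.
- by rewrite -fx /prodX [in RHS](reindex_inj (@perm_inj _ s)).
- by move=> r rn; rewrite -[RHS](m0 r rn) [RHS](reindex_inj (@perm_inj _ s)).
- by rewrite -mC [RHS](reindex_inj (@perm_inj _ s)).
Qed.

Lemma tupleX_lame P x y : tupleX P x y ->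
  [/\ injective x, forall i, y i != 0, forall i, val (P i) = Some (x i, y i) &
    lame_tuple g2 g3 ((2 * n - 1)%:R * \sum_i x i) (\sum_i x i ^+ n.-1 * y i) x y].
Proof.
move=> [eP nt xx m0].
have inj : injective x.
  by move=> i j xij; apply/eqP; apply: contraT => /xx; rewrite xij eqxx.
have y0 i : y i != 0.
  apply/eqP => y0; case: (nt i); rewrite /two_torsion eP y0 oppr0; by [].
split=> //; apply: tuple_lame => // i; exact: wpolyP (eP i).
Qed.

(** Since f'(x_i) y_i = C != 0, the roots are simple and no y_i vanishes. *)
Lemma lame_tupleX P B C : C != 0 -> lame_point P B C -> @Xn K g2 g3 n
    (\pi_(sympow n E) P).
Proof.
move=> C0 [x [y [eP t]]]; exists P, x, y; split=> //; have [yy fx m0 mC] := t.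
have fy i := lame_tuple_C i t.
have y0 i : y i != 0 by apply: contraNneq C0 => e; rewrite -(fy i) e mulr0.
split=> //.
- move=> i; rewrite /two_torsion eP => -[] /eqP.
  by rewrite eq_sym -addr_eq0 -mulr2n mulrn_eq0 /= (negPf (y0 i)).
- move=> i j ij; apply: contraNneq C0 => xij.
  by rewrite -(fy j) -cofX_diag -xij cofX_off ?mul0r // eq_sym.
Qed.

Lemma curve_fin_pt B C : C ^+ 2 = (ell g2 g3 n).[B] ->
  exists a : curve_fin, val a = (B, C).
Proof.
move=> h; have h' : curve_fin (B, C) by [].
by exists (SigSub (mem_set h')).
Qed.

Lemma curve_finP (a : curve_fin) : (val a).2 ^+ 2 = (ell g2 g3 n).[(val a).1].
Proof. exact: set_valP a. Qed.

Lemma curve_inf_pt u v : v ^+ 2 = u * (ell_rev g2 g3 n).[u] ->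
  exists a : curve_inf, val a = (u, v).
Proof.
move=> h; have h' : curve_inf (u, v) by [].
by exists (SigSub (mem_set h')).
Qed.

Lemma curve_infP (a : curve_inf) :
  (val a).2 ^+ 2 = (val a).1 * (ell_rev g2 g3 n).[(val a).1].
Proof. exact: set_valP a. Qed.

Lemma hcoord_Z (e : E) : hcoord (val e) cZ != 0 -> exists x y, val e = Some (x, y).
Proof.
by rewrite /hcoord; case: (val e) => [[x y] _|]; [exists x, y|rewrite eqxx].
Qed.

Section FiniteChart.
Variables (T J : Type) (z : J -> T -> K) (p : T) (D : set T).
Variables (Pt : T -> tuples) (B C : T -> K).
Hypothesis LP : forall t, D t -> lame_point (Pt t) (B t) (C t).
Hypotheses (gB : germ z p D B) (gC : germ z p D C).

(** Modulo the cubic a polynomial in x and y is al(x) + be(x) y, so its sum over the entries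
    combines power sums and moments, which are polynomials in B and C. *)
Lemma fin_sums m : polyfun (@ecoord _ g2 g3 cZ) m ->
  germ z p D (fun t => \sum_i m (Pt t i)).
Proof.
move=> pm; have algA := germ_alg z p D.
have [al [be hm]] : exists al be : {poly K}, forall (e : E) x y,
    val e = Some (x, y) -> m e = al.[x] + be.[x] * y.
  elim: pm => [c|k|F G _ [a [b hF]] _ [a' [b' hG]]|F G _ [a [b hF]] _ [a' [b' hG]]].
  - by exists c%:P, 0 => e x y _; rewrite hornerC horner0 mul0r addr0.
  - rewrite /ecoord; case: k => -[|[|[|//]]] k3.
    + by exists 'X, 0 => e x y ->; rewrite /= hornerX horner0 mul0r addr0 divr1.
    + by exists 0, 1 => e x y ->; rewrite /= horner0 hornerC mul1r add0r divr1.
    + by exists 1, 0 => e x y ->; rewrite /= horner0 hornerC mul0r addr0 divr1.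
  - exists (a + a'), (b + b') => e x y ev; rewrite (hF _ _ _ ev) (hG _ _ _ ev)
      !hornerD; ring.
  - exists (a * a' + wpoly g2 g3 * (b * b')), (a * b' + b * a') => e x y ev.
    rewrite (hF _ _ _ ev) (hG _ _ _ ev) hornerD [(wpoly _ _ * _).[_]]hornerM
        -(wpolyP ev).
    by rewrite !hornerD !hornerM; ring.
pose xs t i : K := if val (Pt t i) is Some (x, _) then x else 0.
pose ys t i : K := if val (Pt t i) is Some (_, y) then y else 0.
have lt t : D t -> lame_tuple g2 g3 (B t) (C t) (xs t) (ys t).
  move=> Dt; have [x [y [e h]]] := LP Dt.
  have -> : xs t = x by apply/funext => i; rewrite /xs e.
  by have -> : ys t = y by apply/funext => i; rewrite /ys e.
have gxs k : germ z p D (fun t => (prodX (xs t))`_k).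
  apply: germ_near (lame_poly_closed n g2 g3 algA gB k) _.
  by apply: znear_all => t Dt; split=> //; case: (lt t Dt) => _ ->.
have gS r : germ z p D (fun t => \sum_i xs t i ^+ r).
  exact: (alg_power_sums algA n_gt0 gxs).
have gM r : germ z p D (fun t => \sum_i xs t i ^+ r * ys t i).
  apply: (alg_moments algA n_gt0 gxs (ys := ys)) => {}r rn.
  apply: (@germ_near _ _ _ _ _ D _ (fun t => (r == n.-1)%:R * C t)).
    exact: alg_scale.
  apply: znear_all => t Dt; split=> //; case: (lt t Dt) => _ _ m0 mC.
  have [->|rn1] := eqVneq r n.-1; first by rewrite mC mul1r.
  by rewrite m0 ?mul0r //; lia.
have gP (q : {poly K}) (w : T -> 'I_n -> K) :
    (forall r, germ z p D (fun t => \sum_i xs t i ^+ r * w t i)) ->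
    germ z p D (fun t => \sum_i q.[xs t i] * w t i).
  move=> gw; apply: (alg_ext (f := fun t => \sum_(r < size q) q`_r * \sum_i xs t
      i ^+ r * w t i)).
    move=> t; under eq_bigr do rewrite mulr_sumr.
    rewrite exchange_big; apply: eq_bigr => i _; rewrite horner_coef mulr_suml.
    by apply: eq_bigr => r _; rewrite mulrA.
  by apply: alg_sum => // r _; apply: alg_scale.
apply: (@germ_near _ _ _ _ _ D _ (fun t =>
   \sum_i al.[xs t i] * 1 + \sum_i be.[xs t i] * ys t i)).
  apply: alg_add => //; apply: gP => // r.
  by apply: alg_ext (gS r) => t; apply: eq_bigr => i _; rewrite mulr1.
apply: znear_all => t Dt; split=> //; rewrite -big_split; apply: eq_bigr => i _ /=.
have [x [y [e h]]] := LP Dt.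
by rewrite (hm _ _ _ (e i)) /xs /ys e mulr1.
Qed.
End FiniteChart.

(* Near infinity u = 1/B and v = C u^(n+1); the points of the tuple have
   X/Y = (v/L) xi F and Z/Y = (u v/L) F, where xi = u x runs over the roots of
   lame_hat u, F = (lame_hat u)'(xi) and L = ell_rev u. *)
Definition inf_point P (xi : 'I_n -> K) u v : Prop :=
  let L := (ell_rev g2 g3 n).[u] in
  let f := lame_hat n g2 g3 u in
  [/\ prodX xi = f,
      forall i, hcoord (val (P i)) cY != 0,
      forall i, ecoord cY cX (P i) = v / L * (xi i * f^`().[xi i]) &
      forall i, ecoord cY cZ (P i) = u * v / L * f^`().[xi i]].

(** Substituting y = C / f'(x), x = xi / u and C = v / u^(n+1) gives x / y = (u / v) xi F. The
    equation of the curve turns u / v into v / L, which stays regular at u = 0. *)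
Lemma lame_inf_point P u v : u != 0 -> v ^+ 2 = u * (ell_rev g2 g3 n).[u] ->
  (ell_rev g2 g3 n).[u] != 0 -> lame_point P u^-1 (v / u ^+ n.+1) ->
  exists xi, inf_point P xi u v.
Proof.
move=> u0 uv L0 [x [y [e t]]].
have v0 : v != 0 by rewrite -(sqrf_eq0 v) uv mulf_neq0.
have C0 : v / u ^+ n.+1 != 0 by rewrite mulf_neq0 // invr_eq0 expf_neq0.
have fy i := lame_tuple_C i t.
have y0 i : y i != 0 by apply: contraNneq C0 => y0; rewrite -(fy i) y0 mulr0.
have [_ fx _ _] := t.
have fxi := lame_hat_scale u0 fx.
have f'0 i : (prodX x)^`().[x i] != 0.
  by apply: contraNneq C0 => f0; rewrite -(fy i) f0 mul0r.
have F i : (lame_hat n g2 g3 u)^`().[u * x i] = u ^+ n.-1 * (prodX x)^`().[x i].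
  rewrite -fxi -[LHS](cofX_diag (fun i => u * x i) i) -(cofX_diag x) !horner_prod.
  under eq_bigr do rewrite hornerXsubC -mulrBr.
  under [in RHS]eq_bigr do rewrite hornerXsubC.
  rewrite big_split /= prodr_const; congr (_ ^+ _ * _).
  by rewrite cardC1 card_ord.
have yE i : y i = v / u ^+ n.+1 / (prodX x)^`().[x i].
  by rewrite -(fy i) mulrAC divff ?mul1r.
have un : u ^+ n.+1 = u ^+ 2 * u ^+ n.-1 by rewrite -exprD; congr (_ ^+ _); lia.
have L : (ell_rev g2 g3 n).[u] = v ^+ 2 / u by rewrite uv mulrAC divff ?mul1r.
have un0 : u ^+ n.-1 != 0 by rewrite expf_neq0.
exists (fun i => u * x i); split=> //.
- by move=> i; rewrite e /=.
- move=> i; rewrite /ecoord e /= F L yE un.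
  by move: (f'0 i) => f0; field; rewrite v0 u0 f0 un0.
- move=> i; rewrite /ecoord e /= F L yE un.
  by move: (f'0 i) => f0; field; rewrite v0 u0 f0 un0.
Qed.

Lemma origin_inf_point P : (forall i, val (P i) = None) -> exists xi, inf_point P
    xi 0 0.
Proof.
move=> e; have [mf sf] := lame_poly_monic (g2 * 0 ^+ 2) (g3 * 0 ^+ 3) n 1.
have [xi fxi] := monic_prodX mf sf.
exists xi; split=> // i.
- by rewrite e /= oner_neq0.
- by rewrite /ecoord e /= !mul0r.
- by rewrite /ecoord e /= !mul0r.
Qed.

Section InfiniteChart.
Variables (T J : Type) (z : J -> T -> K) (p : T) (D : set T).
Variables (Pt : T -> tuples) (xi : T -> 'I_n -> K) (u v : T -> K).
Hypothesis Dp : D p.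
Hypothesis IP : forall t, D t -> inf_point (Pt t) (xi t) (u t) (v t).
Hypothesis L0 : forall t, D t -> (ell_rev g2 g3 n).[u t] != 0.
Hypotheses (gu : germ z p D u) (gv : germ z p D v).

(** By [inf_point] the coordinates at an entry are polynomials in its xi_i with germs as
    coefficients, so the sum reduces to power sums of the roots of [lame_hat]. *)
Lemma inf_sums m : polyfun (@ecoord _ g2 g3 cY) m ->
  germ z p D (fun t => \sum_i m (Pt t i)).
Proof.
move=> pm; have algA := germ_alg z p D.
pose f t := lame_hat n g2 g3 (u t); pose L t := (ell_rev g2 g3 n).[u t].
have gL : germ z p D (fun t => (L t)^-1).
  by apply: germ_inv => //; [exact: alg_horner|exact: L0].
have gf k : germ z p D (fun t => (f t)`_k) by exact: lame_hat_closed.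
have sf t : size (f t) = n.+1 by case: (lame_poly_monic (g2 * u t ^+ 2) (g3 * u t
    ^+ 3) n 1).
have gf' k : germ z p D (fun t => (f t)^`()`_k).
  apply: (alg_ext (f := fun t => k.+1%:R * (f t)`_k.+1)).
    by move=> t; rewrite coef_deriv mulr_natl.
  exact: alg_scale.
(* The bound [N] does not depend on [t], so the expansion in powers of xi is one fixed finite sum of
   germs. *)
have [N [R [gR sR hR]]] : exists N (R : T -> {poly K}),
    [/\ forall k, germ z p D (fun t => (R t)`_k), forall t, (size (R t) <= N)%N &
        forall t, D t -> forall i, m (Pt t i) = (R t).[xi t i]].
  elim: pm => [c|k|F G _ [N [R [gR sR hR]]] _ [N' [R' [gR' sR' hR']]]|
               F G _ [N [R [gR sR hR]]] _ [N' [R' [gR' sR' hR']]]].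
  - exists 1%N, (fun=> c%:P); split.
    + by move=> k; exact: alg_cst.
    + by move=> t; exact: size_polyC_leq1.
    + by move=> t Dt i; rewrite hornerC.
  - have [->|[->|->]] : k = cX \/ k = cY \/ k = cZ.
      by case: k => -[|[|[|//]]] k3; [left|right; left|right; right]; apply: val_inj.
    + exists n.+2, (fun t => (v t / L t) *: ('X * (f t)^`())); split.
      * move=> k'; apply: (alg_ext (f := fun t => (v t / L t) *
            (if k' is k''.+1 then (f t)^`()`_k'' else 0))).
          by move=> t; rewrite coefZ coefXM; case: k'.
        apply: alg_mul => //; first exact: alg_mul.
        by case: k' => [|k']; [exact: alg_cst|exact: gf'].
      * move=> t; rewrite (leq_trans (size_scale_leq _ _)) // mulrC.
        rewrite (leq_trans (size_polyMleq _ _)) // size_polyX addn2 /= ltnS.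
        by rewrite (leq_trans (size_poly _ _)) // sf.
      * move=> t Dt i; have [_ _ h _] := IP Dt.
        by rewrite h hornerZ hornerM hornerX.
    + exists 1%N, (fun=> 1); split.
      * by move=> k'; exact: alg_cst.
      * by move=> t; rewrite size_poly1.
      * move=> t Dt i; have [_ h _ _] := IP Dt.
        by rewrite hornerC /ecoord divff.
    + exists n.+1, (fun t => (u t * v t / L t) *: (f t)^`()); split.
      * move=> k'; apply: (alg_ext (f := fun t => (u t * v t / L t) * (f t)^`()`_k')).
          by move=> t; rewrite coefZ.
        by apply: alg_mul => //; apply: alg_mul => //; exact: alg_mul.
      * move=> t; rewrite (leq_trans (size_scale_leq _ _)) //.
        by rewrite (leq_trans (size_poly _ _)) // sf.
      * move=> t Dt i; have [_ _ _ h] := IP Dt.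
        by rewrite h hornerZ.
  - exists (maxn N N'), (fun t => R t + R' t); split.
    + move=> k; apply: (alg_ext (f := fun t => (R t)`_k + (R' t)`_k)).
        by move=> t; rewrite coefD.
      exact: alg_add.
    + move=> t; rewrite (leq_trans (size_polyD _ _)) // geq_max !leq_max sR sR'.
      by rewrite orbT.
    + by move=> t Dt i; rewrite hornerD hR // hR'.
  - exists (N + N')%N, (fun t => R t * R' t); split.
    + move=> k; apply: (alg_ext (f := fun t => \sum_(j < k.+1) (R t)`_j * (R'
        t)`_(k - j))).
        by move=> t; rewrite coefM.
      by apply: alg_sum => // j _; exact: alg_mul.
    + move=> t; rewrite (leq_trans (size_polyMleq _ _)) // (leq_trans (leq_pred _)) //.
      exact: leq_add.
    + by move=> t Dt i; rewrite hornerM hR // hR'.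
have gxi k : germ z p D (fun t => (prodX (xi t))`_k).
  apply: germ_near (gf k) _.
  by apply: znear_all => t Dt; split=> //; case: (IP Dt) => ->.
have gS r : germ z p D (fun t => \sum_i xi t i ^+ r).
  exact: (alg_power_sums algA n_gt0 gxi).
apply: (@germ_near _ _ _ _ _ D _ (fun t => \sum_(r < N) (R t)`_r * \sum_i xi t i ^+ r)).
  by apply: alg_sum => // r _; exact: alg_mul.
apply: znear_all => t Dt; split=> //.
under [RHS]eq_bigr do rewrite mulr_sumr.
rewrite exchange_big; apply: eq_bigr => i _.
by rewrite hR // (horner_coef_wide _ (sR t)).
Qed.
End InfiniteChart.

End LamePoints.

(** On the curve [G] reads al + be y. If it vanishes at both points over u, then al and be^2 e
    vanish at u. At least one of these polynomials is nonzero, and u is chosen off its zeros and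
    those of [d]. *)
Lemma curve_density (K : numClosedFieldType) (e d : {poly K}) (A : set (affine_plane K))
    (G : A -> K) (a : A) :
  (forall p : K * K, A p <-> p.2 ^+ 2 = e.[p.1]) -> e != 0 -> d != 0 ->
  polyfun (@curve_coord _ A) G -> G a != 0 ->
  exists a' : A, G a' != 0 /\ d.[(val a').1] != 0.
Proof.
move=> hA e0 d0 pG Ga.
have Ae (b : A) : (val b).2 ^+ 2 = e.[(val b).1] by apply/hA; exact: set_valP.
have [al [be hG]] : exists al be : {poly K}, forall b : A,
    G b = al.[(val b).1] + be.[(val b).1] * (val b).2.
  elim: pG => [c|[]|F H _ [a1 [b1 h1]] _ [a2 [b2 h2]]|F H _ [a1 [b1 h1]] _ [a2
      [b2 h2]]].
  - by exists c%:P, 0 => b; rewrite hornerC horner0 mul0r addr0.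
  - by exists 0, 1 => b; rewrite horner0 hornerC mul1r add0r.
  - by exists 'X, 0 => b; rewrite hornerX horner0 mul0r addr0.
  - exists (a1 + a2), (b1 + b2) => b; rewrite h1 h2 !hornerD; ring.
  - exists (a1 * a2 + e * (b1 * b2)), (a1 * b2 + b1 * a2) => b.
    rewrite h1 h2 hornerD [(e * _).[_]]hornerM -Ae.
    by rewrite !hornerD !hornerM; ring.
pose N := if al == 0 then be ^+ 2 * e else al.
have N0 : N != 0.
  rewrite /N; case: ifP => [/eqP al0|/negbT //].
  rewrite mulf_neq0 // expf_neq0 //; apply: contraNneq Ga => be0.
  by rewrite hG al0 be0 !horner0 mul0r addr0.
have [u] := exists_nonroot (mulf_neq0 N0 d0).
rewrite hornerM mulf_eq0 negb_or => /andP[Nu du].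
have pt v : v ^+ 2 = e.[u] -> exists a' : A, val a' = (u, v).
  move=> h; have h' : A (u, v) by apply/hA.
  by exists (SigSub (mem_set h')).
have [a1 v1] := pt (sqrtC e.[u]) (sqrtCK _).
have [|a2 v2] := pt (- sqrtC e.[u]); first by rewrite sqrrN sqrtCK.
have [G1|G1] := eqVneq (G a1) 0; last by exists a1; rewrite v1.
have [G2|G2] := eqVneq (G a2) 0; last by exists a2; rewrite v2.
move: G1 G2; rewrite !hG v1 v2 /= => G1 G2.
have al0 : al.[u] = 0.
  apply/eqP; rewrite -[_ == 0](mulrn_eq0 _ 2) mulr2n; apply/eqP.
  by rewrite -[RHS]addr0 -{1}G1 -G2; ring.
have be0 : (be ^+ 2 * e).[u] = 0.
  rewrite hornerM horner_exp -(sqrtCK e.[u]) -exprMn.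
  by rewrite al0 add0r in G1; rewrite G1 expr0n.
by move: Nu; rewrite /N; case: ifP; rewrite ?al0 ?be0 eqxx.
Qed.

(** * Elimination of B between a finite entry and an entry near O *)

Section Mixed.
Variables (K : numClosedFieldType) (g2 g3 : K) (n : nat).
Hypothesis n_gt0 : (0 < n)%N.
Local Notation s k := (lame_triple g2 g3 n k).1.1.

Lemma lame_polyE (B : K) : lame_poly g2 g3 n B =
  \poly_(k < n.+1) ((-1) ^+ (n + k) * (s (n - k)).[B]).
Proof.
apply/polyP => k; rewrite !coef_poly; case: ltnP => // kn.
by rewrite subzn.
Qed.

Let sgn k : K := (-1) ^+ (n + k).

(* lame_poly B evaluated at x, and its reversal evaluated at r, expanded in
   powers of B *)
Let aco (l : nat) : {poly K} := \sum_(k < n.+1) (sgn k * (s (n - k))`_l) *: 'X^k.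
Let gco (l : nat) : {poly K} := \sum_(k < n.+1) (sgn k * (s (n - k))`_l) *: 'X^(n - k).

Let s_size k : (size (s (n - k)) <= n.+1)%N.
Proof. by have [h _ _] := triple_size n_gt0 g2 g3 (n - k); rewrite (leq_trans h)
    // ltnS leq_subr. Qed.

Lemma lame_poly_expand B x : (lame_poly g2 g3 n B).[x] = \sum_(l < n.+1) (aco
    l).[x] * B ^+ l.
Proof.
rewrite lame_polyE horner_poly.
under eq_bigr do rewrite (horner_coef_wide _ (s_size _)) mulr_sumr mulr_suml.
rewrite exchange_big; apply: eq_bigr => l _; rewrite horner_sum mulr_suml.
by apply: eq_bigr => k _; rewrite hornerZ hornerXn /sgn; ring.
Qed.

Lemma lame_rev_expand B r : r != 0 -> (lame_poly g2 g3 n B).[r^-1] = 0 ->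
  \sum_(l < n.+1) (gco l).[r] * B ^+ l = 0.
Proof.
move=> r0 h; transitivity (r ^+ n * (lame_poly g2 g3 n B).[r^-1]); last by
    rewrite h mulr0.
rewrite lame_polyE horner_poly mulr_sumr.
under [RHS]eq_bigr do rewrite (horner_coef_wide _ (s_size _)) mulr_sumr mulr_suml
    mulr_sumr.
rewrite [RHS]exchange_big; apply: eq_bigr => l _; rewrite horner_sum mulr_suml.
apply: eq_bigr => k _; rewrite hornerZ hornerXn /sgn.
have kn : (k <= n)%N by rewrite -ltnS.
have -> : r ^+ n = r ^+ (n - k) * r ^+ k by rewrite -exprD subnK.
rewrite exprVn.
transitivity ((-1) ^+ (n + k) * (s (n - k))`_l * B ^+ l * r ^+ (n - k) * (r ^+ k
    / r ^+ k)); last by ring.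
by rewrite divff ?expf_neq0 //; ring.
Qed.

Let aco_n x : (aco n).[x] = sgn 0 * (s n)`_n.
Proof.
rewrite horner_sum big_ord_recl big1 ?addr0.
  by rewrite hornerZ hornerXn expr0 mulr1 subn0.
move=> i _; rewrite nth_default; first by rewrite mulr0 scale0r horner0.
have [h _ _] := triple_size n_gt0 g2 g3 (n - lift ord0 i); rewrite (leq_trans h) //.
by rewrite lift0; have := ltn_ord i; lia.
Qed.

Let gco_0 l : (gco l).[0] = (l == 0%N)%:R.
Proof.
rewrite horner_sum big_ord_recr big1 /= ?add0r.
  rewrite hornerZ hornerXn subnn expr0 mulr1 /= coefC /sgn addnn -mul2n exprM
      sqrrN !expr1n mul1r.
  by case: l.
move=> i _; rewrite hornerZ hornerXn expr0n.
have -> : (n - i == 0)%N = false by have := ltn_ord i; lia.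
by rewrite mulr0.
Qed.

(** As a polynomial in B, f_B(x) has degree n and a nonzero constant as leading coefficient, so B^n
    and all higher powers reduce to lower ones with coefficients polynomial in x. The second clause
    keeps the powers below n as they are, which makes the determinant computable at r = 0. *)
Let reduce m : exists e : 'I_n -> {poly K},
  (forall B x, (lame_poly g2 g3 n B).[x] = 0 -> B ^+ m = \sum_l (e l).[x] * B ^+ l) /\
  ((m < n)%N -> forall l, e l = (l == m :> nat)%:R).
Proof.
elim/ltn_ind: m => m IH; have [mn|nm] := ltnP m n.
  exists (fun l => (l == m :> nat)%:R); split=> // B x _.
  rewrite (bigD1 (Ordinal mn)) //= eqxx hornerC mul1r big1 ?addr0 // => l lm.
  rewrite -val_eqE /= in lm.
  by rewrite (negPf lm) horner0 mul0r.
have sn0 : sgn 0 * (s n)`_n != 0.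
  by rewrite mulf_neq0 ?triple_lead // expf_neq0 // oppr_eq0 oner_neq0.
have IH' (j : 'I_n) : exists e : 'I_n -> {poly K}, forall B x,
    (lame_poly g2 g3 n B).[x] = 0 -> B ^+ (j + (m - n)) = \sum_l (e l).[x] * B ^+ l.
  have [|e [he _]] := IH (j + (m - n))%N; first by have := ltn_ord j; lia.
  by exists e.
have [e he] := choice IH'.
exists (fun l : 'I_n => \sum_(j < n) - (sgn 0 * (s n)`_n)^-1 *: (aco j * e j l));
    split; last first.
  by [].
move=> B x h; have Bn : B ^+ n = \sum_(j < n) - (sgn 0 * (s n)`_n)^-1 * (aco
    j).[x] * B ^+ j.
  move: h; rewrite lame_poly_expand big_ord_recr /= aco_n => h.
  have {}h : sgn 0 * (s n)`_n * B ^+ n = - \sum_(j < n) (aco j).[x] * B ^+ j.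
    by apply/eqP; rewrite -addr_eq0 addrC h.
  apply: (mulfI sn0); rewrite h mulr_sumr -sumrN; apply: eq_bigr => j _.
  by rewrite mulNr mulNr mulrN !mulrA divff // mul1r.
rewrite -(subnK nm) addnC exprD Bn mulr_suml.
transitivity (\sum_(j < n) - (sgn 0 * (s n)`_n)^-1 * (aco j).[x] * \sum_l (e j
    l).[x] * B ^+ l).
  by apply: eq_bigr => j _; rewrite -[LHS]mulrA -exprD (he j B x h).
under eq_bigr do rewrite mulr_sumr.
rewrite exchange_big; apply: eq_bigr => l _; rewrite horner_sum mulr_suml.
by apply: eq_bigr => j _; rewrite hornerZ hornerM !mulrA.
Qed.

(* If x and 1/r are roots of lame_poly B, then B is integral over x, and 1/r is
   integral over B; the determinant expresses this without B. *)
Lemma mixed_relation : exists h : K * K -> K,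
  [/\ polyfun (@plane_coord K) h, forall x, h (x, 0) = 1 &
      forall B x r, r != 0 -> (lame_poly g2 g3 n B).[x] = 0 ->
        (lame_poly g2 g3 n B).[r^-1] = 0 -> h (x, r) = 0].
Proof.
have [e he] := choice reduce.
(* Column j expands B^j r^n f_B(1/r) in 1, B, ..., B^(n-1) modulo f_B(x). At r = 0 the factor r^n
   f_B(1/r) is 1, as f_B is monic, and the matrix is the identity; when the factor vanishes, the row
   of powers of B lies in the kernel. *)
pose M (p : K * K) : 'M[K]_n :=
  \matrix_(l, j) \sum_(m < n.+1) (gco m).[p.2] * (e (j + m)%N l).[p.1].
exists (fun p => \det (M p)); split.
- have pa := polyfun_alg (@plane_coord K).
  apply: alg_sum => // s _; apply: alg_scale => //; apply: alg_prod => // i _.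
  apply: (alg_ext (f := fun p => \sum_(m < n.+1) (gco m).[p.2] * (e (s i + m)%N
      i).[p.1])).
    by move=> p; rewrite mxE.
  apply: alg_sum => // m _; apply: alg_mul => //; apply: alg_horner => //.
    exact: (polyfun_var (@plane_coord K) true).
  exact: (polyfun_var (@plane_coord K) false).
- move=> x; rewrite (_ : M _ = 1%:M) ?det1 //; apply/matrixP => l j; rewrite !mxE.
  rewrite big_ord_recl /= gco_0 mul1r big1 ?addr0.
    have [_ h] := he (j + 0)%N; rewrite h ?addn0 //.
    by rewrite -val_eqE; case: eqP => _; rewrite ?hornerC ?horner0.
  by move=> m _; rewrite gco_0 mul0r.
- move=> B x r r0 hx hr; apply/eqP/det0P; exists (\row_l B ^+ l).
    apply/eqP => /matrixP/(_ ord0 (Ordinal n_gt0)); rewrite !mxE expr0 => /eqP.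
    by rewrite oner_eq0.
  apply/matrixP => i j; rewrite !mxE.
  transitivity (\sum_(m < n.+1) (gco m).[r] * B ^+ (j + m)).
    under eq_bigr do rewrite !mxE mulr_sumr.
    rewrite exchange_big; apply: eq_bigr => m _.
    have [h _] := he (j + m)%N; rewrite (h B x hx) mulr_sumr; apply: eq_bigr => l _.
    ring.
  transitivity (B ^+ j * \sum_(m < n.+1) (gco m).[r] * B ^+ m).
    by rewrite mulr_sumr; apply: eq_bigr => m _; rewrite exprD mulrCA.
  by rewrite lame_rev_expand ?mulr0.
Qed.

(** The sum is symmetric in the roots of [lame_hat u], hence polynomial in u. Through \sum t_i = (v
    / L) ka(u) it recovers v near infinity, where ka(0) != 0 is essential. *)
Lemma kappa_poly : exists2 ka : {poly K}, ka.[0] != 0 &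
  forall u (xi : 'I_n -> K), prodX xi = lame_hat n g2 g3 u ->
    \sum_i xi i * (lame_hat n g2 g3 u)^`().[xi i] = ka.[u].
Proof.
(* Pairs of a value u and a numbering of the roots of [lame_hat u]; [A] consists of the functions of
   such pairs that are a polynomial in u alone. *)
pose T := {p : K * ('I_n -> K) | `[< prodX p.2 = lame_hat n g2 g3 p.1 >]}.
pose A (f : T -> K) := exists q : {poly K}, forall t, f t = q.[(val t).1].
have algA : fun_alg A.
  split=> [c|f h [p hp] [q hq]|f h [p hp] [q hq]].
  - by exists c%:P => t; rewrite hornerC.
  - by exists (p + q) => t; rewrite hornerD hp hq.
  - by exists (p * q) => t; rewrite hornerM hp hq.
have Tp (t : T) : prodX (val t).2 = lame_hat n g2 g3 (val t).1.
  by apply/asboolP; exact: (valP t).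
have Au : A (fun t => (val t).1) by exists 'X => t; rewrite hornerX.
have Af k : A (fun t => (lame_hat n g2 g3 (val t).1)`_k) by exact: lame_hat_closed.
have AS r : A (fun t => \sum_i (val t).2 i ^+ r).
  by apply: alg_power_sums => // k; apply: alg_ext (Af k) => t; rewrite Tp.
have sf u : size (lame_hat n g2 g3 u) = n.+1.
  by case: (lame_poly_monic (g2 * u ^+ 2) (g3 * u ^+ 3) n 1).
have [ka hka] : A (fun t => \sum_i (val t).2 i * (lame_hat n g2 g3 (val
    t).1)^`().[(val t).2 i]).
  apply: (alg_ext (f := fun t => \sum_(k < n) (k.+1%:R * (lame_hat n g2 g3 (val
      t).1)`_k.+1) *
      \sum_i (val t).2 i ^+ k.+1)); last first.
    by apply: alg_sum => // k _; apply: alg_mul => //; apply: alg_scale.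
  move=> t; under eq_bigr do rewrite mulr_sumr.
  rewrite exchange_big; apply: eq_bigr => i _.
  rewrite (@horner_coef_wide _ n); last by rewrite (leq_trans (size_poly _ _)) // sf.
  rewrite mulr_sumr; apply: eq_bigr => k _.
  by rewrite coef_deriv exprS -mulr_natl; ring.
have hk u (xi : 'I_n -> K) : prodX xi = lame_hat n g2 g3 u ->
    \sum_i xi i * (lame_hat n g2 g3 u)^`().[xi i] = ka.[u].
  by move=> /asboolP e; exact: (hka (exist _ (u, xi) e)).
exists ka => //.
have [mf sf0] := lame_poly_monic (g2 * 0 ^+ 2) (g3 * 0 ^+ 3) n 1.
have [xi fxi] := monic_prodX mf sf0.
rewrite -(hk 0 xi (esym fxi)) /lame_hat fxi; apply: kappa0_neq0 => //.
by rewrite -fxi !expr0n !mulr0.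
Qed.

End Mixed.

(** * The coordinates u and v near the tuple n O *)

Section InfinityCoordinates.
Variables (K : numClosedFieldType) (g2 g3 : K) (n : nat) (ka : {poly K}).
Hypothesis n_gt0 : (0 < n)%N.
Hypothesis ka0 : ka.[0] != 0.
Hypothesis kaP : forall u (xi : 'I_n -> K), prodX xi = lame_hat n g2 g3 u ->
  \sum_i xi i * (lame_hat n g2 g3 u)^`().[xi i] = ka.[u].
Local Notation E := (E g2 g3).
Local Notation tuples := {ffun 'I_n -> E}.
Implicit Types (P Q : tuples) (e : E) (B C u v : K).

(* The local parameter t = X/Y at the origin O of E, w = Z/Y, and
   r = 1/x = Z/X, which is regular at O because the cubic reads
   w (1 + g2 t w + g3 w^2) = 4 t^3. *)
Definition tE e : K := ecoord cY cX e.
Definition wE e : K := ecoord cY cZ e.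
Definition denE e : K := 1 + g2 * tE e * wE e + g3 * wE e ^+ 2.
Definition rE e : K := 4 * tE e ^+ 2 / denE e.

Lemma rE_x e x y : val e = Some (x, y) -> y != 0 -> denE e != 0 -> rE e * x = 1.
Proof.
move=> ev y0 d0; have yx := wpolyP ev; rewrite horner_wpoly in yx.
have te : tE e = x / y by rewrite /tE /ecoord ev.
have we : wE e = 1 / y by rewrite /wE /ecoord ev.
have h : denE e * y ^+ 2 = 4 * x ^+ 3.
  rewrite /denE te we; transitivity (y ^+ 2 + g2 * x + g3); first by field.
  by rewrite yx; ring.
apply: (mulfI d0); rewrite mulr1 /rE te.
transitivity (4 * x ^+ 3 / y ^+ 2); last by rewrite -h mulfK ?expf_neq0.
by field; rewrite d0 y0.
Qed.

Definition rho Q : {poly K} := \prod_i (1 - rE (Q i) *: 'X).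

(* The equation lame_ode at x = 0, divided by f(0), is linear in B and gives
   u = 1/B in terms of the coefficients of rho = f / f(0). *)
Definition denU Q : K :=
  n%:R * (n%:R + 1) + 3 / 2 * g2 * (rho Q)`_2 + 3 * g3 * (rho Q)`_3.
Definition Uinf Q : K := - 2 * (rho Q)`_1 / denU Q.
(** Solves \sum t_i = (v / L) ka(u) for v. *)
Definition Vinf Q : K :=
  (\sum_i tE (Q i)) * (ell_rev g2 g3 n).[Uinf Q] / ka.[Uinf Q].

Definition near_inf : set tuples := [set Q | [/\ ndom cY Q,
  forall i, denE (Q i) != 0, denU Q != 0, ka.[Uinf Q] != 0 &
  (ell_rev g2 g3 n).[Uinf Q] != 0]].

Lemma rho_pact s Q : rho (pact s Q) = rho Q.
Proof.
rewrite /rho [RHS](reindex_inj (@perm_inj _ s)).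
by apply: eq_bigr => i _; rewrite ffunE.
Qed.

Lemma Uinf_pact s Q : Uinf (pact s Q) = Uinf Q.
Proof. by rewrite /Uinf /denU rho_pact. Qed.

Lemma Vinf_pact s Q : Vinf (pact s Q) = Vinf Q.
Proof.
rewrite /Vinf Uinf_pact [in RHS](reindex_inj (@perm_inj _ s)) /=.
by congr (_ * _ / _); apply: eq_bigr => i _; rewrite ffunE.
Qed.

Lemma near_inf_pact : invariant_set near_inf.
Proof.
move=> s Q [dQ den0 dU kU lU]; split.
- exact: ndom_pact.
- by move=> i; rewrite ffunE.
- by rewrite /denU rho_pact.
- by rewrite Uinf_pact.
- by rewrite Uinf_pact.
Qed.

Section Germs.
Variable P : tuples.
Hypothesis SP : near_inf P.
Local Notation germP := (germ (@ncoord _ g2 g3 n cY) P (@ndom _ g2 g3 n cY)).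
Let algA := germ_alg (@ncoord _ g2 g3 n cY) P (@ndom _ g2 g3 n cY).
Let dP : ndom cY P. Proof. by case: SP. Qed.

Let gt i : germP (fun Q => tE (Q i)).
Proof. by apply: germ_polyfun; exact: (polyfun_var (@ncoord _ g2 g3 n cY) (i, cX)). Qed.

Let gw i : germP (fun Q => wE (Q i)).
Proof. by apply: germ_polyfun; exact: (polyfun_var (@ncoord _ g2 g3 n cY) (i, cZ)). Qed.

Let gden i : germP (fun Q => denE (Q i)).
Proof.
apply: alg_add => //; last by apply: alg_scale => //; exact: alg_exp.
apply: alg_add => //; first exact: alg_cst.
by apply: alg_mul => //; apply: alg_scale.
Qed.

Let grho k : germP (fun Q => (rho Q)`_k).
Proof.
apply: (alg_coef_prod algA _ (F := fun i Q => 1 - rE (Q i) *: 'X)) => i {}k.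
apply: (alg_ext (f := fun Q => (1 : {poly K})`_k - ('X : {poly K})`_k * rE (Q i))).
  by move=> Q; rewrite coefB coefZ mulrC.
apply: alg_sub => //; first exact: alg_cst.
apply: alg_scale => //; apply: alg_mul => //.
  by apply: alg_scale => //; exact: alg_exp.
by apply: germ_inv => //; case: SP.
Qed.

Let gdenU : germP denU.
Proof.
apply: alg_add => //; last exact: alg_scale.
by apply: alg_add => //; [exact: alg_cst|exact: alg_scale].
Qed.

Lemma germ_Uinf : germP Uinf.
Proof.
apply: alg_mul => //; first exact: alg_scale.
by apply: germ_inv => //; case: SP.
Qed.

Lemma germ_Vinf : germP Vinf.
Proof.
apply: alg_mul => //; last first.
  by apply: germ_inv => //; [apply: alg_horner => //; exact: germ_Uinf|case: SP].
apply: alg_mul => //; last by apply: alg_horner => //; exact: germ_Uinf.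
exact: alg_sum.
Qed.

Lemma near_inf_open : znear (@ncoord _ g2 g3 n cY) P [set Q | ndom cY Q -> near_inf Q].
Proof.
have [_ h1 h2 h3 h4] := SP.
have gU := germ_Uinf.
have n1 : znear (@ncoord _ g2 g3 n cY) P [set Q | ndom cY Q -> \prod_i denE (Q i) != 0].
  apply: germ_neq0 => //; first exact: alg_prod.
  exact/prodf_neq0.
have n2 := germ_neq0 dP gdenU h2.
have n3 := germ_neq0 dP (alg_horner algA ka gU) h3.
have n4 := germ_neq0 dP (alg_horner algA (ell_rev g2 g3 n) gU) h4.
apply: znearW (znearI (znearI n1 n2) (znearI n3 n4)) => Q [[/= m1 m2] [/= m3 m4]] dQ.
split=> //; try by [exact: m2|exact: m3|exact: m4].
by move=> i; have /prodf_neq0/(_ i isT) := m1 dQ.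
Qed.
End Germs.

Lemma origin_near_inf Q : (forall i, val (Q i) = None) ->
  [/\ near_inf Q, Uinf Q = 0 & Vinf Q = 0].
Proof.
move=> e.
have t0 i : tE (Q i) = 0 by rewrite /tE /ecoord e /= mul0r.
have w0 i : wE (Q i) = 0 by rewrite /wE /ecoord e /= mul0r.
have d1 i : denE (Q i) = 1 by rewrite /denE t0 w0 expr0n /= !mulr0 !addr0.
have r1 : rho Q = 1.
  by rewrite /rho big1 // => i _; rewrite /rE t0 expr0n /= mulr0 mul0r scale0r subr0.
have dU : denU Q = n%:R * (n%:R + 1).
  by rewrite /denU r1 !coefC /= !mulr0 !addr0.
have U0 : Uinf Q = 0 by rewrite /Uinf r1 coefC /= mulr0 mul0r.
split=> //.
- split.
  + by move=> i; rewrite e /= oner_neq0.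
  + by move=> i; rewrite d1 oner_neq0.
  + by rewrite dU mulf_neq0 ?pnatr_eq0 -?lt0n // natr1 pnatr_eq0.
  + by rewrite U0.
  + by rewrite U0 ell_rev0_neq0.
- by rewrite /Vinf big1 ?mul0r.
Qed.

(** All entries are finite with y_i != 0, so rho = f / f(0), and the differential equation at X = 0
    becomes denU = -2 B rho_1. As [denU] is nonzero on [near_inf], so are B and rho_1. *)
Lemma lame_near_inf Q B C : lame_point Q B C -> near_inf Q ->
  [/\ B != 0, Uinf Q = B^-1 & Vinf Q = C / B ^+ n.+1].
Proof.
move=> lp SQ; have [x [y [e t]]] := lp; have [dQ den0 dU kU lU] := SQ.
have y0 i : y i != 0 by have := dQ i; rewrite e.
have rx i : rE (Q i) * x i = 1 by exact: rE_x (e i) (y0 i) (den0 i).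
have x0 i : x i != 0.
  by apply: contra_eq_neq (rx i) => ->; rewrite mulr0 eq_sym oner_neq0.
have rV i : rE (Q i) = (x i)^-1 by apply: (mulIf (x0 i)); rewrite rx mulVf.
have [_ fx _ _] := t.
have f0 : (prodX x)`_0 != 0.
  rewrite -horner_coef0 horner_prod; apply/prodf_neq0 => i _.
  by rewrite hornerXsubC sub0r oppr_eq0.
have rhoE k : (rho Q)`_k = (prodX x)`_k / (prodX x)`_0.
  have -> : prodX x = (prodX x)`_0 *: rho Q.
    rewrite -horner_coef0 horner_prod /rho -mul_polyC rmorph_prod /= -big_split /=.
    apply: eq_bigr => i _; rewrite hornerXsubC sub0r rV mulrBr mulr1 mul_polyC scalerA.
    by rewrite mulNr divff // scaleN1r opprK polyCN addrC.
  rewrite !coefZ -horner_coef0 [(rho Q)`_0](_ : _ = 1).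
    rewrite mulr1 mulrAC divff ?mul1r //.
    by rewrite horner_coef0.
  rewrite -horner_coef0 horner_prod big1 // => i _.
  by rewrite hornerD hornerN hornerZ hornerX mulr0 subr0 hornerC.
have ode := coef_lame_ode g2 g3 (prodX x) (4 * n%:R * (n%:R + 1)) (4 * B) 0.
have dE : denU Q = - 2 * B * (rho Q)`_1.
  move: ode; rewrite /= fx -[_ *: 'X + _]/(lame_h n B) lame_poly_ode coef0 -fx.
  move: (rhoE 1%N) (rhoE 2%N) (rhoE 3%N) f0; rewrite /denU.
  move: (prodX x)`_0 (prodX x)`_1 (prodX x)`_2 (prodX x)`_3 => a0 a1 a2 a3 -> ->
      -> a00 ode.
  apply/eqP; rewrite -subr_eq0; apply/eqP; apply: (mulfI a00); rewrite mulr0.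
  rewrite -[RHS](mulr0 (- 4^-1)) [in RHS]ode; field; exact: a00.
have B0 : B != 0.
  by apply: contraNneq dU => B0; rewrite dE B0 mulr0 mul0r.
have UE : Uinf Q = B^-1.
  rewrite /Uinf dE; have r10 : (rho Q)`_1 != 0.
    by apply: contraNneq dU => r0; rewrite dE r0 mulr0.
  by field; rewrite r10 B0.
split=> //; set u := Uinf Q in UE kU lU *; set v := C / B ^+ n.+1.
have u0 : u != 0 by rewrite UE invr_eq0.
have BE : B = u^-1 by rewrite UE invrK.
have CE : C = v / u ^+ n.+1 by rewrite UE /v exprVn invrK divfK // expf_neq0.
have uv : v ^+ 2 = u * (ell_rev g2 g3 n).[u].
  rewrite ell_revE // -BE -(lame_tuple_curve n_gt0 t) mulrA -exprS CE expr_div_n -exprM.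
  have -> : (n.+1 * 2 = (2 * n).+2)%N by lia.
  by rewrite -CE BE exprVn invrK mulrC.
have [xi [fxi _ tx _]] : exists xi, inf_point Q xi u v.
  by apply: lame_inf_point => //; rewrite -BE -CE.
rewrite /Vinf -/u (eq_bigr _ (fun i _ => tx i)) -mulr_sumr kaP //.
by field; rewrite kU lU.
Qed.

End InfinityCoordinates.

(** * The isomorphism *)

Section Isomorphism.
Variables (K : numClosedFieldType) (g2 g3 : K) (n : nat).
Hypothesis n_gt0 : (0 < n)%N.
Local Notation E := (E g2 g3).
Local Notation SymE := (SymE g2 g3 n).
Local Notation Xn := (@Xn K g2 g3 n).
Local Notation barX := (barX g2 g3 n).
Local Notation hatX := (hatX g2 g3 n).
Local Notation hatX_pt := (hatX_pt g2 g3 n).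
Local Notation curve_fin := (curve_fin g2 g3 n).
Local Notation curve_inf := (curve_inf g2 g3 n).
Local Notation tuples := {ffun 'I_n -> E}.
Local Notation cls P := (\pi_(sympow n E) P).
Implicit Types (P Q : tuples) (B C u v : K).

Definition over_inf P u v : Prop :=
  (u = 0 -> forall i, val (P i) = None) /\
  (u != 0 -> lame_point P u^-1 (v / u ^+ n.+1)).

Lemma over_inf_exists (a : curve_inf) : exists P, over_inf P (val a).1 (val a).2.
Proof.
have [u0|u0] := eqVneq (val a).1 0.
  have [e he] := wpoint_inf g2 g3.
  by exists [ffun=> e]; split=> [_ i|]; rewrite ?ffunE // u0 eqxx.
have [P lp] := lame_point_exists n_gt0 (curve_inf_fin n_gt0 u0 (curve_infP a)).
by exists P; split=> // e; rewrite e eqxx in u0.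
Qed.

Lemma over_inf_perm P Q u v : over_inf P u v -> over_inf Q u v -> cls P = cls Q.
Proof.
move=> [P0 P1] [Q0 Q1]; have [u0|u0] := eqVneq u 0.
  congr (\pi_(sympow n E) _); apply/ffunP => i; apply: val_inj.
  by rewrite P0 // Q0.
exact: lame_point_perm (P1 u0) (Q1 u0).
Qed.

(** An arbitrary choice; by [lame_point_perm] its class in Sym^n E does not depend on it. *)
Definition tuple_fin (a : curve_fin) : tuples :=
  sval (cid (lame_point_exists n_gt0 (curve_finP a))).

Lemma tuple_finP a : lame_point (tuple_fin a) (val a).1 (val a).2.
Proof. by rewrite /tuple_fin; case: cid. Qed.

Definition tuple_inf (a : curve_inf) : tuples := sval (cid (over_inf_exists a)).

Lemma tuple_infP a : over_inf (tuple_inf a) (val a).1 (val a).2.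
Proof. by rewrite /tuple_inf; case: cid. Qed.

Lemma lame_point_BC P B C B' C' : lame_point P B C -> lame_point P B' C' ->
  B = B' /\ C = C'.
Proof.
move=> [x [y [e t]]] [x' [y' [e' t']]].
have xy i : x i = x' i /\ y i = y' i by have := e i; rewrite e' => -[-> ->].
have ex : x = x' by apply/funext => i; case: (xy i).
have ey : y = y' by apply/funext => i; case: (xy i).
rewrite (lame_tuple_B n_gt0 t) (lame_tuple_B n_gt0 t') ex; split=> //.
by case: t t' => _ _ _ <- [_ _ _ <-]; rewrite ex ey.
Qed.

Definition of_curves (p : curve_fin + curve_inf) : SymE :=
  match p with inl a => cls (tuple_fin a) | inr a => cls (tuple_inf a) end.

Lemma of_curves_glue p q : glue_rel p q -> of_curves p = of_curves q.
Proof.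
have fi (a : curve_fin) (b : curve_inf) : glued n (val a) (val b) ->
    cls (tuple_fin a) = cls (tuple_inf b).
  move=> /and3P[u0 /eqP eB /eqP eC]; apply: (lame_point_perm (tuple_finP a)).
  by rewrite eB eC; case: (tuple_infP b) => _; apply.
by case: p q => a [] b /=; [move=> /eqP ->|exact: fi|move=> /fi ->|move=> /eqP ->].
Qed.

Definition psi0 (h : hatX) : SymE := of_curves (repr (h : hatX_pt)).

Lemma psi0_pi p : psi0 (\pi_hatX_pt p) = of_curves p.
Proof.
by apply: of_curves_glue; rewrite -[glue_rel _ _]/(glue_equiv g2 g3 n _ _)
    -eqmodE reprK.
Qed.

Lemma hatX_ind (Q : hatX -> Prop) : (forall p, Q (\pi_hatX_pt p)) -> forall h, Q h.
Proof. by move=> H h; rewrite -[h](@reprK _ hatX_pt); exact: H. Qed.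

Lemma pi_glue p q : glue_rel p q -> \pi_hatX_pt p = \pi_hatX_pt q.
Proof. by move=> h; apply/eqP; rewrite piE. Qed.

Lemma hatX_cover (h : hatX) : (exists a, h = \pi_hatX_pt (inl a)) \/
  (exists2 a : curve_inf, h = \pi_hatX_pt (inr a) & (val a).1 = 0).
Proof.
move: h; apply: hatX_ind => -[a|a]; first by left; exists a.
have [u0|u0] := eqVneq (val a).1 0; first by right; exists a.
have [b eb] := curve_fin_pt (curve_inf_fin n_gt0 u0 (curve_infP a)).
by left; exists b; apply: pi_glue => /=; rewrite /glued eb u0 !eqxx.
Qed.

Lemma cls_lame P Q B C : lame_point P B C -> cls P = cls Q -> lame_point Q B C.
Proof. by move=> lp /pi_eq[s ->]; exact: lame_point_pact. Qed.

Lemma origin_not_lame P B C : (forall i, val (P i) = None) -> ~ lame_point P B C.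
Proof. by move=> h [x [y [e _]]]; have := e (Ordinal n_gt0); rewrite h. Qed.

Lemma psi0_inj : injective psi0.
Proof.
have fin_inf (a : curve_fin) (b : curve_inf) : (val b).1 = 0 ->
    cls (tuple_fin a) <> cls (tuple_inf b).
  move=> b0 /(cls_lame (tuple_finP a)); apply: origin_not_lame.
  by case: (tuple_infP b) => + _; apply.
move=> h h'; have [[a ->]|[a -> a0]] := hatX_cover h; have [[b ->]|[b -> b0]] :=
    hatX_cover h';
  rewrite !psi0_pi /= => e.
- have [e1 e2] := lame_point_BC (cls_lame (tuple_finP a) e) (tuple_finP b).
  congr (\pi_hatX_pt (inl _)); apply: val_inj.
  by move: e1 e2; case: (val a) (val b) => ? ? [? ?] /= -> ->.
- by case: (fin_inf a b b0).
- by case: (fin_inf b a a0).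
- congr (\pi_hatX_pt (inr _)); apply: val_inj.
  have := curve_infP a; have := curve_infP b; rewrite a0 b0 !mul0r.
  move=> /eqP; rewrite sqrf_eq0 => /eqP vb /eqP; rewrite sqrf_eq0 => /eqP va.
  by move: a0 b0 va vb; case: (val a) (val b) => ? ? [? ?] /= -> -> -> ->.
Qed.

(** * Regularity of the map from the curves to the symmetric power *)

Definition regular_at (A : set (affine_plane K)) (f : A -> SymE) (a : A) : Prop :=
  (forall V, kopen V -> V (f a) -> znear (@curve_coord K A) a [set b | V (f b)]) /\
  (forall V g, kreg V g -> V (f a) ->
    germ (@curve_coord K A) a [set b | V (f b)] (fun b => g (f b))).

Section RegularAt.
Variables (A : set (affine_plane K)) (f : A -> SymE) (a : A) (D : set A) (c : 'I_3).
Variable Pt : A -> tuples.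
Hypotheses (Da : D a) (nD : znear (@curve_coord K A) a D).
Hypotheses (dPt : forall b, D b -> ndom c (Pt b)) (ePt : forall b, D b -> f b =
    cls (Pt b)).
Hypothesis gPt : forall m, polyfun (ecoord c) m ->
  germ (@curve_coord K A) a D (fun b => \sum_i m (Pt b i)).

Lemma param_regular_at : regular_at f a.
Proof.
split=> [V oV|V g rV]; rewrite ePt // => Va.
  have n1 := param_open Da dPt gPt oV Va.
  by apply: znearW (znearI nD n1) => b [/= Db h]; rewrite ePt //; exact: h.
apply: germ_near (param_reg Da dPt gPt rV Va) _.
by apply: znearW nD => b Db; rewrite /= ePt.
Qed.
End RegularAt.

Lemma curve_coord1 A : polyfun (@curve_coord K A) (fun b => (val b).1).
Proof. exact: (polyfun_var (@curve_coord K A) false). Qed.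

Lemma curve_coord2 A : polyfun (@curve_coord K A) (fun b => (val b).2).
Proof. exact: (polyfun_var (@curve_coord K A) true). Qed.

Lemma lame_point_ndom P B C : lame_point P B C -> ndom cZ P.
Proof. by move=> [x [y [e _]]] i; rewrite e /= oner_neq0. Qed.

Lemma regular_fin (a : curve_fin) : regular_at (of_curves \o inl) a.
Proof.
apply: (@param_regular_at _ _ _ setT cZ tuple_fin) => //.
- exact: znear_all.
- by move=> b _; exact: lame_point_ndom (tuple_finP b).
- move=> m; apply: (fin_sums n_gt0 (B := fun b => (val b).1) (C := fun b => (val b).2)).
  + by move=> b _; exact: tuple_finP.
  + by apply: germ_polyfun; exact: curve_coord1.
  + by apply: germ_polyfun; exact: curve_coord2.
Qed.

Lemma regular_inf (a : curve_inf) : regular_at (of_curves \o inr) a.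
Proof.
have pu := curve_coord1 curve_inf; have pv := curve_coord2 curve_inf.
have [u0|u0] := eqVneq (val a).1 0; last first.
  pose D := [set b : curve_inf | (val b).1 != 0].
  have algA := germ_alg (@curve_coord K curve_inf) a D.
  have gV f : polyfun (@curve_coord K curve_inf) f -> f a != 0 ->
      germ (@curve_coord K curve_inf) a D (fun b => (f b)^-1).
    by move=> pf fa; apply: germ_inv => //; exact: germ_polyfun.
  apply: (@param_regular_at _ _ _ D cZ tuple_inf) => //.
  - exact: znear_polyfun pu u0.
  - by move=> b Db; case: (tuple_infP b) => _ /(_ Db); exact: lame_point_ndom.
  move=> m; apply: (fin_sums n_gt0 (B := fun b => (val b).1^-1)
    (C := fun b => (val b).2 / (val b).1 ^+ n.+1)).
  - by move=> b Db; case: (tuple_infP b) => _; apply.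
  - exact: gV.
  - apply: alg_mul => //; first exact: germ_polyfun.
    by apply: gV; [apply: alg_exp => //; exact: polyfun_alg|exact: expf_neq0].
(* Over u = 0 all entries are O, outside the chart [cZ]. Where L != 0, a point with u != 0 has C !=
   0, so every y_i is nonzero and the chart [cY] applies. *)
pose D := [set b : curve_inf | (ell_rev g2 g3 n).[(val b).1] != 0].
have ip (b : curve_inf) : exists xi, D b -> inf_point (tuple_inf b) xi (val b).1
    (val b).2.
  have [Db|nDb] := pselect (D b); last by exists (fun=> 0).
  have [b0|b0] := eqVneq (val b).1 0.
    have v0 : (val b).2 = 0.
      by apply/eqP; rewrite -sqrf_eq0 curve_infP b0 mul0r.
    have [|xi h] := @origin_inf_point _ g2 g3 n (tuple_inf b).
      by case: (tuple_infP b) => + _; apply.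
    by exists xi => _; rewrite b0 v0.
  have [xi h] : exists xi, inf_point (tuple_inf b) xi (val b).1 (val b).2.
    apply: lame_inf_point => //; first exact: curve_infP.
    by case: (tuple_infP b) => _; apply.
  by exists xi.
have [xi hxi] := choice ip.
have Da : D a by rewrite /D /= u0 ell_rev0_neq0.
have algP := polyfun_alg (@curve_coord K curve_inf).
apply: (@param_regular_at _ _ _ D cY tuple_inf) => //.
- apply: (znear_polyfun (G := fun b => (ell_rev g2 g3 n).[(val b).1])) => //.
  exact: alg_horner.
- by move=> b /hxi[].
move=> m; apply: (inf_sums n_gt0 Da hxi) => //.
- exact: germ_polyfun.
- exact: germ_polyfun.
Qed.

(** A neighbourhood of the point contains points of the curve with C != 0, and these map into
    X_n. *)
Lemma psi0_closure (h : hatX) : kclosure Xn (psi0 h).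
Proof.
move=> U oU; have [[a ->]|[a -> a0]] := hatX_cover h; rewrite psi0_pi => Ua.
  have [G [pG Ga GU]] := (regular_fin a).1 U oU Ua.
  have [b [Gb lb]] := curve_density (fun=> iff_refl _) (ell_neq0 n_gt0 g2 g3)
    (ell_neq0 n_gt0 g2 g3) pG Ga.
  exists (of_curves (inl b)); split; first exact: GU.
  apply: lame_tupleX (tuple_finP b).
  by rewrite -sqrf_eq0 curve_finP.
have [G [pG Ga GU]] := (regular_inf a).1 U oU Ua.
have L0 : 'X * ell_rev g2 g3 n != 0.
  rewrite mulf_neq0 ?polyX_eq0 //.
  by apply: contraNneq (ell_rev0_neq0 n_gt0 g2 g3) => ->; rewrite horner0.
have hA (p : K * K) : curve_inf p <-> p.2 ^+ 2 = ('X * ell_rev g2 g3 n).[p.1].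
  by rewrite hornerM hornerX.
have [b [Gb]] := curve_density hA L0 L0 pG Ga.
rewrite hornerM hornerX mulf_eq0 negb_or => /andP[b0 lb].
exists (of_curves (inr b)); split; first exact: GU.
have [_ /(_ b0)] := tuple_infP b; apply: lame_tupleX.
rewrite mulf_neq0 ?invr_eq0 ?expf_neq0 //.
by rewrite -sqrf_eq0 curve_infP mulf_neq0.
Qed.

(** * Every point of the closure comes from the curve *)

Definition xE (e : E) : K := ecoord cZ cX e.
Definition yE (e : E) : K := ecoord cZ cY e.

(* The coordinates (B, C) as functions on Sym^n (E \ O). *)
Definition Bfin P : K := (2 * n - 1)%:R * \sum_i xE (P i).
Definition Cfin P : K := \sum_i xE (P i) ^+ n.-1 * yE (P i).

Lemma xyE P x y : (forall i, val (P i) = Some (x i, y i)) ->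
  [/\ forall i, xE (P i) = x i & forall i, yE (P i) = y i].
Proof. by move=> e; split=> i; rewrite /xE /yE /ecoord e /= divr1. Qed.

Lemma lame_point_coord P B C : lame_point P B C -> Bfin P = B /\ Cfin P = C.
Proof.
move=> [x [y [e t]]]; have [ex ey] := xyE e; rewrite /Bfin /Cfin.
have -> : \sum_i xE (P i) = \sum_i x i by apply: eq_bigr => i _; rewrite ex.
have -> : \sum_i xE (P i) ^+ n.-1 * yE (P i) = \sum_i x i ^+ n.-1 * y i.
  by apply: eq_bigr => i _; rewrite ex ey.
rewrite -(lame_tuple_B n_gt0 t); split=> //.
by case: t.
Qed.

Lemma Bfin_pact s P : Bfin (pact s P) = Bfin P.
Proof.
rewrite /Bfin [in RHS](reindex_inj (@perm_inj _ s)) /=.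
by congr (_ * _); apply: eq_bigr => i _; rewrite ffunE.
Qed.

Lemma Cfin_pact s P : Cfin (pact s P) = Cfin P.
Proof.
rewrite /Cfin [in RHS](reindex_inj (@perm_inj _ s)) /=.
by apply: eq_bigr => i _; rewrite ffunE.
Qed.

Local Notation coordZ := (@ncoord _ g2 g3 n cZ).

Lemma poly_xE i : polyfun coordZ (fun P => xE (P i)).
Proof. exact: (polyfun_var coordZ (i, cX)). Qed.

Lemma poly_yE i : polyfun coordZ (fun P => yE (P i)).
Proof. exact: (polyfun_var coordZ (i, cY)). Qed.

Lemma poly_moment r : polyfun coordZ (fun P => \sum_i xE (P i) ^+ r * yE (P i)).
Proof.
have algA := polyfun_alg coordZ; apply: alg_sum => // i _.
apply: alg_mul => //; last exact: poly_yE.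
by apply: alg_exp => //; exact: poly_xE.
Qed.

Lemma poly_Bfin : polyfun coordZ Bfin.
Proof.
have algA := polyfun_alg coordZ; apply: alg_scale => //; apply: alg_sum => // i _.
exact: poly_xE.
Qed.

(** Nonvanishing of an invariant polynomial is an open condition on Sym^n E, so a relation that
    holds on X_n passes to the closure. *)
Lemma closure_fin (H : tuples -> K) P : polyfun coordZ H ->
  (forall s Q, H (pact s Q) = H Q) -> ndom cZ P -> kclosure Xn (cls P) ->
  (forall Q x y, tupleX Q x y -> H Q = 0) -> H P = 0.
Proof.
move=> pH iH dP clP HX; apply/eqP; apply: contraT => HP.
pose S : set tuples := [set Q | ndom cZ Q /\ H Q != 0].
have oS : kopen ([set q | S (repr q)] : set SymE).
  apply: (@SymE_open _ g2 g3 n cZ S).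
  - by move=> s Q [dQ HQ]; split; [exact: ndom_pact|rewrite iH].
  - by move=> Q [].
  - by move=> Q [dQ HQ]; exists H; split=> // R HR dR; split.
have [|q [/= [_ Hq] [Q [x [y [tX eq]]]]]] := clP _ oS.
  by have [s e] := repr_pi P; rewrite /= e; split; [exact: ndom_pact|rewrite iH].
have [s es] := repr_pi Q; move: Hq; rewrite eq es iH (HX _ _ _ tX).
by rewrite eqxx.
Qed.

Lemma closure_lame P : ndom cZ P -> kclosure Xn (cls P) -> lame_point P (Bfin P)
    (Cfin P).
Proof.
move=> dP clP; pose x i := xE (P i); pose y i := yE (P i).
have e i : val (P i) = Some (x i, y i).
  have [x' [y' e']] := hcoord_Z (dP i).
  by rewrite /x /y /xE /yE /ecoord e' /= !divr1.
exists x, y; split=> //.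
have algA := polyfun_alg coordZ.
have fx : prodX x = lame_poly g2 g3 n (Bfin P).
  apply/polyP => k; apply/eqP; rewrite -subr_eq0; apply/eqP.
  pose H Q := (\prod_i ('X - (xE (Q i))%:P))`_k - (lame_poly g2 g3 n (Bfin Q))`_k.
  apply: (@closure_fin H P) => //.
  - apply: alg_sub => //; last by apply: lame_poly_closed => //; exact: poly_Bfin.
    apply: (alg_coef_prod algA _ (F := fun i Q => 'X - (xE (Q i))%:P)) => i k'.
    apply: (alg_ext (f := fun Q => ('X : {poly K})`_k' - (k' == 0%N)%:R * xE (Q i))).
      by move=> Q; rewrite coefB coefC; case: eqP; rewrite ?mul1r ?mul0r.
    apply: alg_sub => //; first exact: alg_cst.
    by apply: alg_scale => //; exact: poly_xE.
  - move=> s Q; rewrite /H Bfin_pact.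
    have -> // : \prod_i ('X - (xE (pact s Q i))%:P) = \prod_i ('X - (xE (Q i))%:P).
    rewrite [RHS](reindex_inj (@perm_inj _ s)); apply: eq_bigr => i _.
    by rewrite ffunE.
  - move=> Q x' y' /(tupleX_lame n_gt0)[_ _ e' t].
    have lp : lame_point Q ((2 * n - 1)%:R * \sum_i x' i) (\sum_i x' i ^+ n.-1 * y' i).
      by exists x', y'.
    have [ex _] := xyE e'; rewrite /H (lame_point_coord lp).1.
    case: t => _ <- _ _; rewrite (eq_bigr (fun i => 'X - (x' i)%:P)) ?subrr //.
    by move=> i _; rewrite ex.
split=> //.
- by move=> i; exact: wpolyP (e i).
- move=> r rn; apply: (@closure_fin (fun Q => \sum_i xE (Q i) ^+ r * yE (Q i)) P) => //.
  + exact: poly_moment.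
  + move=> s Q; rewrite [in RHS](reindex_inj (@perm_inj _ s)) /=.
    by apply: eq_bigr => i _; rewrite ffunE.
  + move=> Q x' y' /(tupleX_lame n_gt0)[_ _ e' [_ _ m0 _]].
    have [ex ey] := xyE e'; rewrite -[RHS](m0 r rn); apply: eq_bigr => i _.
    by rewrite ex ey.
Qed.

Lemma hcoord_neq0 (e : E) : exists k, hcoord (val e) k != 0.
Proof.
by case: (val e) => [[a b]|]; [exists cZ|exists cY]; rewrite /= oner_neq0.
Qed.

(** If P_i is finite and P_j = O, then h(x, 0) = 1 makes the condition h(x_i, r_j) != 0 hold on a
    neighbourhood of P. On X_n it fails, since x_i and 1 / r_j are roots of one and the same f_B. *)
Lemma closure_mixed P i j : kclosure Xn (cls P) -> (val (P i)) <> None ->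
  val (P j) <> None.
Proof.
move=> clP Pi Pj.
have [h [ph h1 h0]] := mixed_relation g2 g3 n_gt0.
(* Quantifying over the two indices makes [W] invariant under permutations. *)
pose W : set tuples := [set Q | exists i j, [/\ i != j, hcoord (val (Q i)) cZ != 0,
  hcoord (val (Q j)) cY != 0, denE (Q j) != 0 & h (xE (Q i), rE (Q j)) != 0]].
have iW s Q : W Q -> W (pact s Q).
  move=> [i' [j' [ij a b c d]]]; exists ((s^-1)%g i'), ((s^-1)%g j').
  by rewrite !ffunE !permKV (inj_eq perm_inj).
have oW : kopen ([set q | W (repr q)] : set SymE).
  move=> Q WQ; have {WQ}[i' [j' [ij a b c d]]] : W Q.
    have [s e] := repr_pi Q; rewrite /= e in WQ.
    by rewrite -[Q]pact1 -(mulVg s) -pactM; exact: iW.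
  have [si hsi] := choice (fun k => hcoord_neq0 (Q k)).
  (* A product chart adapted to the situation: [cZ] at the finite entry, [cY] at the entry near O,
     and at the others any chart that contains them. *)
  pose sigma k := if k == i' then cZ else if k == j' then cY else si k.
  exists sigma.
  pose x := (fun (ik : 'I_n * 'I_3) (P : tuples) =>
    hcoord (val (P ik.1)) ik.2 / hcoord (val (P ik.1)) (sigma ik.1)).
  pose D := [set R : tuples | forall k, hcoord (val (R k)) (sigma k) != 0].
  have DQ : D Q.
    by move=> k; rewrite /sigma; case: (k =P i') => [->|_] //; case: (k =P j') =>
        [->|_].
  have si' : sigma i' = cZ by rewrite /sigma eqxx.
  have sj' : sigma j' = cY by rewrite /sigma eq_sym (negPf ij) eqxx.
  have algA := germ_alg x Q D.
  have gx : germ x Q D (fun R => xE (R i')).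
    apply: germ_polyfun; apply: (alg_ext _ (polyfun_var x (i', cX))) => R.
    by rewrite /x /= si'.
  have gt : germ x Q D (fun R => tE (R j')).
    apply: germ_polyfun; apply: (alg_ext _ (polyfun_var x (j', cX))) => R.
    by rewrite /x /= sj'.
  have gw : germ x Q D (fun R => wE (R j')).
    apply: germ_polyfun; apply: (alg_ext _ (polyfun_var x (j', cZ))) => R.
    by rewrite /x /= sj'.
  have gd : germ x Q D (fun R => denE (R j')).
    apply: alg_add => //; last by apply: alg_scale => //; exact: alg_exp.
    apply: alg_add => //; first exact: alg_cst.
    by apply: alg_mul => //; apply: alg_scale.
  have gr : germ x Q D (fun R => rE (R j')).
    apply: alg_mul => //; first by apply: alg_scale => //; exact: alg_exp.
    exact: germ_inv.
  have gh : germ x Q D (fun R => h (xE (R i'), rE (R j'))).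
    by apply: (alg_comp algA) ph => -[].
  have [G [pG GQ GW]] := znearI (germ_neq0 DQ gd c) (germ_neq0 DQ gh d).
  exists G; split=> // R DR GR.
  have [/= m1 m2] := GW R GR.
  have [s e] := repr_pi R; rewrite /= e; apply: iW; exists i', j'; split=> //.
  - by have := DR i'; rewrite si'.
  - by have := DR j'; rewrite sj'.
  - exact: m1.
  - exact: m2.
have WP : W P.
  have t0 : tE (P j) = 0 by rewrite /tE /ecoord Pj /= mul0r.
  have w0 : wE (P j) = 0 by rewrite /wE /ecoord Pj /= mul0r.
  exists i, j; split.
  - by apply/eqP => ij; rewrite ij in Pi.
  - by case: (val (P i)) Pi => [[a b]|] // _; rewrite /= oner_neq0.
  - by rewrite Pj /= oner_neq0.
  - by rewrite /denE t0 w0 expr0n /= !mulr0 !addr0 oner_neq0.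
  - by rewrite /rE t0 expr0n /= mulr0 mul0r h1 oner_neq0.
have [|q [/= Wq [Q [x [y [tX eq]]]]]] := clP _ oW.
  by have [s es] := repr_pi P; rewrite /= es; exact: iW.
have {Wq} : W Q.
  have [s e] := repr_pi Q; rewrite eq e in Wq.
  by rewrite -[Q]pact1 -(mulVg s) -pactM; exact: iW.
have [_ y0 eQ t] := tupleX_lame n_gt0 tX.
move=> [i' [j' [ij _ _ dj /eqP]]]; apply.
have [_ fx _ _] := t; have [ex _] := xyE eQ; rewrite ex.
have rx := rE_x (eQ j') (y0 j') dj.
have x0 : x j' != 0 by apply: contra_eq_neq rx => ->; rewrite mulr0 eq_sym oner_neq0.
have rV : rE (Q j') = (x j')^-1 by apply: (mulIf x0); rewrite rx mulVf.
rewrite rV; apply: (h0 ((2 * n - 1)%:R * \sum_i x i)).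
- by rewrite invr_eq0.
- by rewrite -fx prodX_root.
- by rewrite invrK -fx prodX_root.
Qed.

Lemma psi0_surj q : kclosure Xn q -> exists h, psi0 h = q.
Proof.
rewrite -[q]reprK; set P := repr q => clP.
have [fin|] := pselect (forall i, val (P i) <> None).
  have dP : ndom cZ P.
    by move=> i; case: (val (P i)) (fin i) => [[a b]|] // _; rewrite /= oner_neq0.
  have lp := closure_lame dP clP; have [x [y [e t]]] := lp.
  have [a ea] := curve_fin_pt (lame_tuple_curve n_gt0 t).
  exists (\pi_hatX_pt (inl a)); rewrite psi0_pi /=.
  by apply: lame_point_perm lp; have := tuple_finP a; rewrite ea.
move=> /existsNP[j /contrapT Pj].
have all0 i : val (P i) = None.
  by apply: contrapT => Pi; exact: (closure_mixed clP Pi Pj).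
have [a ea] : exists a : curve_inf, val a = (0, 0).
  by apply: curve_inf_pt; rewrite expr0n mul0r.
exists (\pi_hatX_pt (inr a)); rewrite psi0_pi /=.
apply: over_inf_perm (tuple_infP a) _; rewrite ea /=; split=> //.
by rewrite eqxx.
Qed.

Definition psi (h : hatX) : barX := SigSub (mem_set (@psi0_closure h)).

Lemma psiE h : val (psi h) = psi0 h. Proof. by []. Qed.

Lemma psi_surj (q : barX) : exists h, psi h = q.
Proof.
have [h e] := psi0_surj (set_valP q).
by exists h; apply: val_inj.
Qed.

Definition phi (q : barX) : hatX := sval (cid (psi_surj q)).

Lemma phiK : cancel phi psi.
Proof. by move=> q; rewrite /phi; case: cid. Qed.

Lemma psiK : cancel psi phi.
Proof. by move=> h; apply: psi0_inj; rewrite -!psiE phiK. Qed.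

(** * Regularity of psi and of its inverse *)

Lemma psi_morphism : kmorphism psi.
Proof.
have pullback (A : set (affine_plane K)) (f : A -> SymE) (j : A -> hatX) :
    (forall a, regular_at f a) -> (forall a, psi0 (j a) = f a) ->
    (forall V : set barX, kopen V -> kopen (j @^-1` (psi @^-1` V) : set (subspace
        A))) /\
    (forall (V : set barX) g, kopen V -> kreg V g ->
       kreg (j @^-1` (psi @^-1` V) : set (subspace A)) ((g \o psi) \o j)).
  move=> rf ej.
  have op (V : set barX) : kopen V -> kopen (j @^-1` (psi @^-1` V) : set (subspace A)).
    move=> [V' oV' ->]; apply: curve_open => a /=; rewrite ej => Va.
    by apply: znearW ((rf a).1 _ oV' Va) => b /=; rewrite ej.
  split=> // V g oV [_ rg]; apply: curve_reg; first exact: op.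
  move=> a /= Va; have [V' [g' [oV' Va' rg' eg]]] := rg _ Va.
  rewrite psiE ej in Va'.
  apply: germ_near ((rf a).2 _ _ rg' Va') _.
  apply: znearW ((rf a).1 _ oV' Va') => b /= Vb' Vb; split=> //.
  by rewrite eg ?psiE ?ej.
have [op1 rg1] := pullback _ _ (fun a => \pi_hatX_pt (inl a)) regular_fin (fun a
    => psi0_pi _).
have [op2 rg2] := pullback _ _ (fun a => \pi_hatX_pt (inr a)) regular_inf (fun a
    => psi0_pi _).
split.
- by move=> V oV; split; [exact: op1|exact: op2].
- by move=> V g oV rg; split; [exact: rg1|exact: rg2].
Qed.

Section LocalCoordinates.
Variables (c : 'I_3) (S : set tuples) (b : tuples -> K * K).
Variables (A : set (affine_plane K)) (j : A -> hatX).
Hypotheses (iS : invariant_set S) (dS : forall P, S P -> ndom c P).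
Hypothesis nS : forall P, S P -> znear (ncoord c) P [set Q | ndom c Q -> S Q].
Hypothesis ib : forall s P, S P -> b (pact s P) = b P.
Hypothesis gb : forall P k, S P ->
  germ (ncoord c) P (ndom c) (fun Q => plane_coord k (b Q)).
Hypothesis oj : forall V : set hatX, kopen V -> kopen (j @^-1` V : set (subspace A)).
Hypothesis rj : forall (V : set hatX) f, kreg V f ->
  kreg (j @^-1` V : set (subspace A)) (f \o j).
Hypothesis bj : forall q : barX, S (repr (val q : sympow n E)) ->
  exists2 a : A, val a = b (repr (val q : sympow n E)) & phi q = j a.

Lemma phi_open_at (V : set hatX) (q : barX) : kopen V -> V (phi q) ->
  S (repr (val q : sympow n E)) ->
  exists W : set SymE, [/\ kopen W, W (val q) & forall q' : barX, W (val q') -> V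
      (phi q')].
Proof.
move=> oV Vq Sq; have [a ea pa] := bj Sq; rewrite pa in Vq.
have [G [/polyfun_curve[G' pG' eG] Ga GV]] := curve_open_near (oj oV) Vq.
rewrite eG in Ga.
exists [set q | S (repr q) /\ G' (b (repr q)) != 0]; split.
- exact: (coord_open iS dS nS ib gb pG').
- by split=> //; rewrite -ea.
- move=> q' [Sq' Gq']; have [a' ea' ->] := bj Sq'.
  by apply: GV; rewrite eG ea'.
Qed.

Lemma phi_reg_at (V : set hatX) f (q : barX) : kreg V f -> V (phi q) ->
  S (repr (val q : sympow n E)) ->
  exists (W : set SymE) g, [/\ kopen W, W (val q), kreg W g &
    forall q' : barX, V (phi q') -> W (val q') -> f (phi q') = g (val q')].
Proof.
move=> rV Vq Sq; have [a ea pa] := bj Sq; rewrite pa in Vq.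
have [F [G [/polyfun_curve[F' pF' eF] /polyfun_curve[G' pG' eG] Ga]]] :=
  curve_reg_at (rj rV) Vq.
move=> [H [/polyfun_curve[H' pH' eH] Ha HV]].
(* Multiplying numerator and denominator by H' confines the neighbourhood to the points where the
   germ identity for f holds. *)
have pHG : polyfun (@plane_coord K) (fun p => H' p * G' p) by exact: polyfun_mul.
have pFH : polyfun (@plane_coord K) (fun p => H' p * F' p) by exact: polyfun_mul.
exists [set q | S (repr q) /\ H' (b (repr q)) * G' (b (repr q)) != 0].
exists (fun q => (H' (b (repr q)) * F' (b (repr q))) / (H' (b (repr q)) * G' (b
    (repr q)))).
split.
- exact: (coord_open iS dS nS ib gb pHG).
- by split=> //; rewrite -ea -eH -eG mulf_neq0.
- exact: (coord_reg iS dS nS ib gb pFH pHG).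
move=> q' Vq' [Sq' Gq']; have [a' ea' pa'] := bj Sq'; rewrite pa' in Vq' *.
move: (Gq'); rewrite mulf_eq0 negb_or => /andP[H0 G0].
have /= := HV a'; rewrite eH ea' => /(_ H0 Vq') ->.
by rewrite eF eG ea' -mulf_div divff // mul1r.
Qed.
End LocalCoordinates.

Lemma phi_local (q : barX) :
  (forall V : set hatX, kopen V -> V (phi q) -> exists W : set SymE,
    [/\ kopen W, W (val q) & forall q' : barX, W (val q') -> V (phi q')]) /\
  (forall (V : set hatX) f, kreg V f -> V (phi q) -> exists (W : set SymE) g,
    [/\ kopen W, W (val q), kreg W g &
    forall q' : barX, V (phi q') -> W (val q') -> f (phi q') = g (val q')]).
Proof.
have [ka ka0 kaP] := kappa_poly g2 g3 n_gt0.
have bq (q' : barX) : cls (repr (val q' : sympow n E)) = psi0 (phi q').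
  by rewrite reprK -psiE phiK.
pose P : tuples := repr (val q : sympow n E).
have [SP|SP] := pselect (ndom cZ P).
  pose b Q := (Bfin Q, Cfin Q).
  have nS Q : ndom cZ Q -> znear (@ncoord _ g2 g3 n cZ) Q [set R | ndom cZ R ->
      ndom cZ R].
    by move=> _; apply: znear_all => R.
  have ib s Q : ndom cZ Q -> b (pact s Q) = b Q.
    by rewrite /b Bfin_pact Cfin_pact.
  have gb Q k : ndom cZ Q ->
      germ (@ncoord _ g2 g3 n cZ) Q (ndom cZ) (fun R => plane_coord k (b R)).
    move=> _; apply: germ_polyfun; case: k; [exact: poly_moment|exact: poly_Bfin].
  have bj (q' : barX) : ndom cZ (repr (val q' : sympow n E)) -> exists2 a : curve_fin,
      val a = b (repr (val q' : sympow n E)) & phi q' = \pi_hatX_pt (inl a).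
    move=> dq; have := bq q'; have [[a ->]|[a -> a0]] := hatX_cover (phi q');
      rewrite psi0_pi /= => e; last first.
      have [s es] := pi_eq (esym e); have := dq (Ordinal n_gt0).
      rewrite es ffunE; case: (tuple_infP a) => /(_ a0) -> _.
      by rewrite /= eqxx.
    exists a => //; have lp := cls_lame (tuple_finP a) (esym e).
    have [eB eC] := lame_point_coord lp; rewrite /b eB eC.
    exact: surjective_pairing.
  split.
  - move=> V oV Vq.
    by apply: (phi_open_at (@ndom_pact _ g2 g3 n cZ) (fun _ => id) nS ib gb _ bj)
        => // V' [].
  - move=> V f rV Vq.
    by apply: (phi_reg_at (@ndom_pact _ g2 g3 n cZ) (fun _ => id) nS ib gb _ bj)
        => // V' f' [].
(* In this case the class is n O. The neighbourhood [near_inf] also contains finite tuples, for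
   which [bj] passes through the gluing with u = 1/B. *)
pose b Q := (Uinf Q, Vinf ka Q).
pose S := @near_inf K g2 g3 n ka.
have [[a pq]|[a pq a0]] := hatX_cover (phi q).
  have := bq q; rewrite pq psi0_pi /= => e; case: SP.
  exact: lame_point_ndom (cls_lame (tuple_finP a) (esym e)).
have PO i : val (P i) = None.
  have := bq q; rewrite pq psi0_pi /= => /esym/pi_eq[s es].
  have -> : P = pact s (tuple_inf a) by [].
  by rewrite ffunE; case: (tuple_infP a) => ->.
have [SP' _ _] := origin_near_inf n_gt0 ka0 PO.
have iS := @near_inf_pact _ g2 g3 n ka.
have dS Q : S Q -> ndom cY Q by case.
have nS Q : S Q -> znear (@ncoord _ g2 g3 n cY) Q [set R | ndom cY R -> S R].
  exact: near_inf_open.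
have ib s Q : S Q -> b (pact s Q) = b Q.
  by rewrite /b Uinf_pact Vinf_pact.
have gb Q k : S Q ->
    germ (@ncoord _ g2 g3 n cY) Q (ndom cY) (fun R => plane_coord k (b R)).
  by move=> SQ; case: k; [exact: (germ_Vinf SQ)|exact: (germ_Uinf SQ)].
have bj (q' : barX) : S (repr (val q' : sympow n E)) -> exists2 a : curve_inf,
    val a = b (repr (val q' : sympow n E)) & phi q' = \pi_hatX_pt (inr a).
  move=> Sq; have := bq q'; have [[a' ->]|[a' -> a0']] := hatX_cover (phi q');
    rewrite psi0_pi /= => e.
  - have lp := cls_lame (tuple_finP a') (esym e).
    have [B0 eU eV] := lame_near_inf n_gt0 ka0 kaP lp Sq.
    have [a2 e2] : exists a2 : curve_inf, val a2 = b (repr (val q' : sympow n E)).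
      apply: curve_inf_pt; rewrite /b eU eV ell_revE ?invr_eq0 // invrK -curve_finP.
      rewrite mulrA -exprS exprVn expr_div_n -exprM mulrC.
      by have -> : (n.+1 * 2 = (2 * n).+2)%N by lia.
    exists a2 => //; apply: pi_glue => /=; rewrite /glued e2 /b eU eV invr_eq0 B0
        invrK eqxx /=.
    by rewrite exprVn invrK divfK // expf_neq0.
  - have O i : val (repr (val q' : sympow n E) i) = None.
      by have [s ->] := pi_eq (esym e); rewrite ffunE; case: (tuple_infP a') => ->.
    exists a' => //; have [_ U0 V0] := origin_near_inf n_gt0 ka0 O.
    have v0 : (val a').2 = 0.
      by apply/eqP; rewrite -sqrf_eq0 curve_infP a0' mul0r.
    rewrite /b U0 V0; exact: etrans (surjective_pairing _) (congr2 pair a0' v0).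
split.
- move=> V oV Vq.
  by apply: (phi_open_at iS dS nS ib gb _ bj) => // V' [].
- move=> V f rV Vq.
  by apply: (phi_reg_at iS dS nS ib gb _ bj) => // V' f' [].
Qed.

Lemma phi_morphism : kmorphism phi.
Proof.
have op (V : set hatX) : kopen V -> kopen (phi @^-1` V : set barX).
  move=> oV; pose Ws := [set W : set SymE | kopen W /\ forall q : barX, W (val q)
      -> V (phi q)].
  exists (\bigcup_(W in Ws) W).
    by apply: SymE_open_bigcup => W [].
  apply/seteqP; split=> [q Vq|q [W [_ h] /h //]].
  have [W [oW Wq h]] := (phi_local q).1 V oV Vq.
  by exists W.
split=> // V f oV rV; split; first exact: op.
move=> q Vq; have [W [g [oW Wq rg h]]] := (phi_local q).2 V f rV Vq.
by exists W, g; split.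
Qed.

Lemma lame_isomorphism : exists phi : barX -> hatX,
  kisomorphism phi /\ extends_identity phi.
Proof.
exists phi; split.
  split; first exact: phi_morphism.
  exists psi; split; [exact: phiK|exact: psiK|exact: psi_morphism].
move=> q P x y tX eq; have [_ _ eP t] := tupleX_lame n_gt0 tX.
have lp : lame_point P ((2 * n - 1)%:R * \sum_i x i) (\sum_i x i ^+ n.-1 * y i).
  by exists x, y.
have [a ea] := curve_fin_pt (lame_tuple_curve n_gt0 t).
exists a; split.
- apply: psi0_inj; rewrite -psiE phiK eq psi0_pi /=.
  by apply: lame_point_perm lp _; have := tuple_finP a; rewrite ea.
- by rewrite ea.
(* C = f'(x_i) y_i, and f'(x_i) is the product of the differences x_i - x_j. *)
- move=> i; rewrite ea /= -(lame_tuple_C i t) -cofX_diag horner_prod mulrC.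
  by congr (_ * _); apply: eq_bigr => j _; rewrite hornerXsubC.
Qed.

End Isomorphism.

Theorem proposition7p7 (R : realType) (Lambda : set R[i])
    (hLambda : is_lattice Lambda) (n : nat) (hn : (1 <= n)%N) :
  exists phi : barX (lattice_g2 Lambda) (lattice_g3 Lambda) n ->
               hatX (lattice_g2 Lambda) (lattice_g3 Lambda) n,
    kisomorphism phi /\ extends_identity phi.
Proof. exact: lame_isomorphism. Qed.
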